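(* Let $\alpha_1=e^{a_1i}$ and $\alpha_2=e^{a_2i}$ be parameters with $0<a_j<2\pi/3$, $j=1,2$. Then $\mathsf E_{\alpha_1,\alpha_2}$ is the union of the sets $\mathsf E_{\alpha_1,\alpha_2}^{\sigma_1\sigma_2}$, $\sigma_1,\sigma_2\in\{-,+\}$, which (as subsets of $\rho(\mathcal E)=\mathsf T/\!\simeq$) are as follows. (1) $\mathsf E_{\alpha_1,\alpha_2}^{--}$ is a single line segment (possibly a single point), given by $\big[(3a_1+3a_2,3a_1+3a_2),(2\pi,\pi+\frac{3(a_1+a_2)}{2})\big]$ if $0<a_1+a_2\leq 2\pi/3$, and by $\big[(3(a_1+a_2)-2\pi,3(a_1+a_2)-2\pi),(\frac{3(a_1+a_2)}{2}-\pi,0)\big]$ if $a_1+a_2>2\pi/3$. If $\mathsf E_{\alpha_1,\alpha_2}^{--}$ is a single point, then it is the class of the identical isometry. Otherwise, its endpoint in the diagonal side of $\rho(\mathcal E)$ corresponds to a special elliptic isometry with negative center and its endpoint in the nondiagonal side of $\rho(\mathcal E)$ corresponds to an ellipto-parabolic isometry. (2) $\mathsf E_{\alpha_1,\alpha_2}^{++}$ is the union of two line segments with a common endpoint, one of slope $-1$ and the other of slope $\frac12$ or $2$ (the latter possibly a single point), given by: $\big[(2\pi-3a_1,2\pi-3a_2),(2\pi,2\pi-3(a_1+a_2))\big]\cup\big[(2\pi,2\pi-3(a_1+a_2)),(\pi+\frac{3(a_1+a_2)}{2},0)\big]$ if $a_1\leq a_2$ and $0<a_1+a_2\leq 2\pi/3$;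 $\big[(2\pi-3a_2,2\pi-3a_1),(2\pi,2\pi-3(a_1+a_2))\big]\cup\big[(2\pi,2\pi-3(a_1+a_2)),(\pi+\frac{3(a_1+a_2)}{2},0)\big]$ if $a_1\geq a_2$ and $0<a_1+a_2\leq 2\pi/3$; $\big[(2\pi,\frac{3(a_1+a_2)}{2}-\pi),(4\pi-3(a_1+a_2),0)\big]\cup\big[(4\pi-3(a_1+a_2),0),(2\pi-3a_1,2\pi-3a_2)\big]$ if $a_1\leq a_2$ and $a_1+a_2>2\pi/3$; $\big[(2\pi,\frac{3(a_1+a_2)}{2}-\pi),(4\pi-3(a_1+a_2),0)\big]\cup\big[(4\pi-3(a_1+a_2),0),(2\pi-3a_2,2\pi-3a_1)\big]$ if $a_1\geq a_2$ and $a_1+a_2>2\pi/3$. If the segment of slope $\frac12$ or $2$ is a single point, that point corresponds to both the identical class and the $3$-step unipotent class. Otherwise, the common endpoint of the two segments corresponds to both a class of a special elliptic isometry with positive center and an ellipto-parabolic class; the other endpoint of the segment of slope $-1$ corresponds to a (possibly special) elliptic isometry; the remaining endpoint corresponds to an ellipto-parabolic isometry. (3) $\mathsf E_{\alpha_1,\alpha_2}^{+-}$ is a single line segment (possibly a point), given by $\big[(3a_2,3a_2-3a_1),(\frac{3(a_1+a_2)}{2},0)\big]$ if $a_1\leq a_2$, and by $\big[(2\pi+3a_2-3a_1,3a_2),(2\pi,\frac{3(a_1+a_2)}{2})\big]$ if $a_1\geq a_2$. It is a single point corresponding to the class of a special elliptic isometry with positive center if and only if $\alpha_1=\alpha_2$;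 otherwise it has one endpoint in $\mathcal E^{\mathrm{reg}}$ and the other endpoint corresponds to an ellipto-parabolic class. (4) $\mathsf E_{\alpha_1,\alpha_2}^{-+}$ is a single line segment (possibly a point), given by $\big[(2\pi+3a_1-3a_2,3a_1),(2\pi,\frac{3(a_1+a_2)}{2})\big]$ if $a_1\leq a_2$, and by $\big[(3a_1,3a_1-3a_2),(\frac{3(a_1+a_2)}{2},0)\big]$ if $a_1\geq a_2$. It is a single point corresponding to the class of a special elliptic isometry with positive center if and only if $\alpha_1=\alpha_2$; otherwise it has one endpoint in $\mathcal E^{\mathrm{reg}}$ and the other endpoint corresponds to an ellipto-parabolic class.
   Context: $V$ is a 3-dimensional complex vector space with a Hermitian form $\langle\cdot,\cdot\rangle$ of signature $++-$. A point of $\mathbb PV$ and a representative in $V$ are denoted by the same letter; $p\in\mathbb PV$ is negative, isotropic or positive according to $\langle p,p\rangle<0$, $=0$, $>0$; $\mathrm SV$ is the set of isotropic points. $\mathrm{SU}(2,1)$ is the group of determinant-one linear automorphisms of $V$ preserving the form, $\Omega=\{1,\omega,\omega^2\}$, $\omega=e^{2\pi i/3}$, $\mathrm{PU}(2,1)=\mathrm{SU}(2,1)/\Omega$. $\mathbb S^1$ is the set of unit complex numbers; a parameter is an element of $\mathbb S^1\setminus\Omega$. For $p\in\mathbb PV\setminus\mathrm SV$ and a parameter $\alpha$, $R_\alpha^p\in\mathrm{SU}(2,1)$ is $R_\alpha^p x=(\alpha^{-2}-\alpha)\frac{\langle x,p\rangle}{\langle p,p\rangle}p+\alpha x$; $p$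 is its center. A nonidentical isometry is elliptic if it fixes a negative point, parabolic if it fixes exactly one isotropic point and is not elliptic. An elliptic isometry is regular elliptic if a lift has three distinct eigenvalues, special elliptic otherwise (special elliptic isometries are exactly those with a lift $R_\alpha^p$). A parabolic isometry is unipotent if it has a unipotent lift, and ellipto-parabolic otherwise. A unipotent isometry is $3$-step unipotent if its only fixed point in $\mathbb PV$ is one isotropic point (these form one conjugacy class), and $2$-step unipotent if it fixes pointwise the line $\mathbb Pv^\perp$, $v$ being its isotropic fixed point. Space of classes. $\mathcal G$ is the space of $\mathrm{PU}(2,1)$-conjugacy classes with the quotient topology, $c(\mathcal G)$ its maximal Hausdorff quotient, $\rho:\mathcal G\to c(\mathcal G)$ the projection; $\mathcal E\subset\mathcal G$ is the set of elliptic classes together with the identical one, $\mathcal E^{\mathrm{reg}}$ the regular elliptic classes, $\mathcal B$ the classes of parabolic or special elliptic isometries. Let $\mathsf T=\{(\theta_1,\theta_2)\in\mathbb R^2\mid 0\le\theta_2\le\theta_1\le2\pi\}$ with the identification $(\theta,0)\simeq(2\pi,\theta)$, $0\le\theta\le 2\pi$. Every unordered pair of angles mod $2\pi$ determines a point of $\mathsf T/\!\simeq$. An elliptic isometry with negative fixed point of eigenvalue $\mu$ and with the other two eigenvalues $\mu e^{i\theta_1},\mu e^{i\theta_2}$ has angle pair $\{\theta_1,\theta_2\}$; the identity has angle pair $\{0,0\}$; an ellipto-parabolic isometry with repeated eigenvalue $e^{i\theta}$ has angle pair $\{-3\theta,0\}$; unipotent isometries have angle pair $\{0,0\}$. Via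 angle pairs, $\rho(\mathcal E)=\rho(\mathcal E\cup\mathcal B)$ is identified with $\mathsf T/\!\simeq$, and $\mathcal E^{\mathrm{reg}}$ with the interior of $\mathsf T$. The diagonal side of $\rho(\mathcal E)$ consists of the points $(\theta,\theta)$, $0<\theta<2\pi$ (fiber of $\rho$: one special elliptic class, with negative center); the nondiagonal side consists of the points $(\theta,0)\simeq(2\pi,\theta)$, $0<\theta<2\pi$ (fiber: one special elliptic class with positive center and one ellipto-parabolic class); the vertex is the common image of $(0,0),(2\pi,0),(2\pi,2\pi)$ (fiber: identity, two $2$-step unipotent classes, the $3$-step unipotent class). The sets. $\mathsf E_{\alpha_1,\alpha_2}\subset\rho(\mathcal E)$ is the image under $\rho$ of the set of classes in $\mathcal E\cup\mathcal B$ of isometries having a lift of the form $F=R_{\alpha_2}^{p_2}R_{\alpha_1}^{p_1}$ with $p_1,p_2\in\mathbb PV\setminus\mathrm SV$. $\mathsf E_{\alpha_1,\alpha_2}^{\sigma_1\sigma_2}$ is defined in the same way, requiring in addition that $p_i$ be positive if $\sigma_i=+$ and negative if $\sigma_i=-$, $i=1,2$. Saying that a point of $\mathsf E_{\alpha_1,\alpha_2}^{\sigma_1\sigma_2}$ ''corresponds to'' certain classes means that these are the classes in the fiber of $\rho$ over that point whose isometries admit such a decomposition with signs $\sigma_1,\sigma_2$. $[x,y]$ denotes the (image in $\mathsf T/\!\simeq$ of the) straight line segment with endpoints $x,y\in\mathsf T$.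
   Formalization: In (2), if a1+a2 is 2π/9 or 10π/9 the common and remaining endpoints are one point of T/≃, so their classes cannot be told apart; there it is proved instead that this point corresponds to exactly the special elliptic and ellipto-parabolic classes announced for the two endpoints together. *)

(* Defs.v *)
From HB Require Import structures.
From Stdlib Require Import Relations.
From mathcomp Require Import all_boot all_order all_algebra.
From mathcomp Require Import all_classical all_reals all_analysis.
From mathcomp Require Import complex.

Set Implicit Arguments.
Unset Strict Implicit.
Unset Printing Implicit Defensive.

Import Order.TTheory GRing.Theory Num.Theory numFieldNormedType.Exports.
Local Open Scope classical_set_scope.
Local Open Scope ring_scope.
Local Open Scope quotient_scope.

(* [R[i]] packed as a [numClosedFieldType]; in this form it, and matrices over
   it, receive the norm topology. *)
Definition CC (R : realType) : numClosedFieldType := R[i].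

Definition expi (R : realType) (t : R) : CC R := (cos t +i* sin t)%C.

Section HermitianPlane.
Context {R : realType}.
Implicit Types (J g : 'M[CC R]_3) (x y p v : 'cV[CC R]_3).
Implicit Types (alpha mu w : CC R).

Definition adj m n (A : 'M[CC R]_(m, n)) : 'M[CC R]_(n, m) :=
  map_mx Num.conj A^T.

(* V is C^3 with the form <x, y> = y^* J x, linear in x. *)
Definition form J x y : CC R := (adj y *m J *m x) 0 0.

(* J is the Gram matrix of a Hermitian form of signature ++-: some basis (the
   columns of P) is orthogonal with squares 1, 1, -1. *)
Definition signature_ppm J : Prop :=
  exists2 P : 'M[CC R]_3, P \in unitmx &
    adj P *m J *m P = diag_mx (\row_j (if j == ord_max then -1 else 1)).

(* A point of PV is given by a nonzero vector.  A vector with <p, p> != 0 is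
   nonzero, so this is only explicit for isotropic points. *)
Definition negative J : set 'cV[CC R]_3 := [set p | form J p p < 0].
Definition positive J : set 'cV[CC R]_3 := [set p | 0 < form J p p].
Definition nonisotropic J : set 'cV[CC R]_3 := [set p | form J p p != 0].
Definition isotropic J : set 'cV[CC R]_3 :=
  [set p | p != 0 /\ form J p p = 0].

Definition SU J : set 'M[CC R]_3 :=
  [set g | (forall x y, form J (g *m x) (g *m y) = form J x y) /\ \det g = 1].

Definition Omega : set (CC R) := [set w | w ^+ 3 = 1].

Definition parameter alpha : Prop := `|alpha| = 1 /\ ~ Omega alpha.

Definition complex_reflection J alpha p : 'M[CC R]_3 :=
  ((alpha ^- 2 - alpha) / form J p p) *: (p *m adj p *m J) + alpha%:M.

Lemma complex_reflectionE J alpha p x :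
  complex_reflection J alpha p *m x =
  ((alpha ^- 2 - alpha) * (form J x p / form J p p)) *: p + alpha *: x.
Proof.
rewrite /complex_reflection mulmxDl mul_scalar_mx -scalemxAl -!mulmxA.
congr (_ + _).
rewrite [adj p *m _]mulmxA (mx11_scalar (adj p *m J *m x)) mul_mx_scalar.
by rewrite scalerA mulrAC mulrA.
Qed.

(* An element of PU(2,1) is given by a lift g in SU(2,1); the notions below are
   invariant under g |-> w g for w in Omega. *)

Definition fixes g p : Prop := exists mu, g *m p = mu *: p.

Definition same_point p x : Prop := exists mu, x = mu *: p.

Definition identical g : Prop := exists2 w, Omega w & g = w%:M.

Definition elliptic J g : Prop :=
  ~ identical g /\ exists2 p, negative J p & fixes g p.

Definition parabolic J g : Prop :=
  [/\ ~ identical g, ~ elliptic J g &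
      exists v, [/\ isotropic J v, fixes g v &
        forall x, isotropic J x -> fixes g x -> same_point v x]].

Definition regular_elliptic J g : Prop :=
  elliptic J g /\
  exists s : seq (CC R), [/\ size s = 3, uniq s & all (eigenvalue g) s].

Definition special_elliptic J g : Prop :=
  elliptic J g /\ ~ regular_elliptic J g.

(* P is meant to be [positive J] or [negative J]. *)
Definition special_elliptic_center J (P : set 'cV[CC R]_3) g : Prop :=
  special_elliptic J g /\
  exists alpha p w, [/\ parameter alpha, P p, Omega w &
    w *: g = complex_reflection J alpha p].

Definition unipotent J g : Prop :=
  parabolic J g /\
  exists2 w, Omega w & exists n : nat, (w *: g - 1%:M) ^+ n = 0.

Definition ellipto_parabolic J g : Prop := parabolic J g /\ ~ unipotent J g.

Definition three_step_unipotent J g : Prop :=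
  unipotent J g /\
  exists v, [/\ isotropic J v, fixes g v &
    forall x, x != 0 -> fixes g x -> same_point v x].

(* The union of the identity, the elliptic and the parabolic isometries, whose
   classes form E u B (special elliptic isometries are elliptic). *)
Definition elliptic_or_boundary J g : Prop :=
  [\/ identical g, elliptic J g | parabolic J g].

Lemma SU1 J : SU J 1%:M.
Proof. by split=> [x y|]; rewrite ?mul1mx // det1. Qed.

Lemma SUM J g h : SU J g -> SU J h -> SU J (g *m h).
Proof.
move=> [gJ g1] [hJ h1]; split=> [x y|]; first by rewrite -!mulmxA gJ hJ.
by rewrite det_mulmx g1 h1 mulr1.
Qed.

Lemma SU_unit J g : SU J g -> g \in unitmx.
Proof. by case=> _ g1; rewrite unitmxE g1 unitr1. Qed.

Lemma SUV J g : SU J g -> SU J (invmx g).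
Proof.
move=> gSU; have gu := SU_unit gSU; have [gJ g1] := gSU.
split=> [x y|]; last by rewrite det_inv g1 invr1.
by rewrite -gJ !mulmxA mulmxV // !mul1mx.
Qed.

(* Conjugacy in PU(2,1), on lifts.  The space of PU(2,1)-conjugacy classes, a
   quotient of a quotient of SU(2,1), is obtained at once as the quotient of
   SU(2,1) by this relation.  The type [SU J] has the subspace topology. *)
Definition conjugate J (g h : SU J) : Prop :=
  exists k : SU J, exists2 w, Omega w &
    val h = w *: (val k *m val g *m invmx (val k)).

Definition conjugateb J : rel (SU J) :=
  fun g h : SU J => `[< conjugate g h >].

Lemma conjugateb_equiv J : equiv_class_of (@conjugateb J).
Proof.
split=> [g|g h|h g k].
- apply/asboolP; exists (SigSub (mem_set (SU1 J))), 1.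
    by rewrite /Omega /= expr1n.
  by rewrite /= scale1r mul1mx invmx1 mulmx1.
- have sym (a b : SU J) : conjugate a b -> conjugate b a.
    move=> [k [w w3 bE]]; have kSU := set_mem (valP k).
    have ku := SU_unit kSU.
    exists (SigSub (mem_set (SUV kSU))), w^-1.
      by rewrite /Omega /= exprVn w3 invr1.
    have w0 : w != 0.
      apply/eqP => w0; move: w3; rewrite /Omega /= w0 expr0n => /eqP.
      by rewrite eq_sym oner_eq0.
    rewrite /= invmxK bE -scalemxAr -scalemxAl scalerA mulVf // scale1r.
    by rewrite -!mulmxA mulVmx // mulmx1 mulmxA mulVmx // mul1mx.
  by apply/asboolP/asboolP; exact: sym.
- move=> /asboolP[a [w w3 hE]] /asboolP[b [u u3 kE]]; apply/asboolP.
  have aSU := set_mem (valP a); have bSU := set_mem (valP b).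
  exists (SigSub (mem_set (SUM bSU aSU))), (u * w).
    by rewrite /Omega /= exprMn u3 w3 mulr1.
  have -> : invmx (val b *m val a) = invmx (val a) *m invmx (val b).
    have au := SU_unit aSU; have bu := SU_unit bSU.
    have bau : val b *m val a \in unitmx by rewrite unitmx_mul bu.
    apply: (can_inj (mulKmx bau)); rewrite mulmxV // -mulmxA (mulmxA (val a)).
    by rewrite mulmxV // mul1mx mulmxV.
  by rewrite kE hE -!(scalemxAr, scalemxAl) scalerA !mulmxA.
Qed.

Canonical conjugate_equiv J := EquivRelPack (conjugateb_equiv J).

Definition classes_space J : topologicalType :=
  quotient_topology {eq_quot conjugate_equiv J}.

Definition class_of J (g : SU J) : classes_space J :=
  \pi_({eq_quot conjugate_equiv J}) g.

Definition classes J (P : 'M[CC R]_3 -> Prop) : set (classes_space J) :=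
  @class_of J @` [set g | P (val g)].

End HermitianPlane.

Arguments classes {R} J P.

Section MaximalHausdorffQuotient.
Context {X : topologicalType}.

(* Two points have the same image in the maximal Hausdorff quotient when no
   continuous map to a Hausdorff space separates them; see the two lemmas
   [max_hausdorff_quotient_hausdorff] and [max_hausdorff_quotient_universal]. *)
Definition unseparated (x y : X) : Prop :=
  forall Y : topologicalType, hausdorff_space Y ->
  forall f : X -> Y, continuous f -> f x = f y.

Definition unseparatedb : rel X := fun x y => `[< unseparated x y >].

Lemma unseparatedb_equiv : equiv_class_of unseparatedb.
Proof.
split=> [x|x y|y x z].
- exact/asboolP.
- by apply/asboolP/asboolP => xy Y hY f cf; rewrite (xy Y hY f cf).
- move=> /asboolP xy /asboolP yz; apply/asboolP => Y hY f cf.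
  by rewrite (xy Y hY f cf) (yz Y hY f cf).
Qed.

Canonical unseparated_equiv := EquivRelPack unseparatedb_equiv.

End MaximalHausdorffQuotient.

Definition max_hausdorff_quotient (X : topologicalType) : topologicalType :=
  quotient_topology {eq_quot @unseparated_equiv X}.

Definition rho (X : topologicalType) (x : X) : max_hausdorff_quotient X :=
  \pi_({eq_quot @unseparated_equiv X}) x.

Lemma rho_eqP (X : topologicalType) (x y : X) :
  rho x = rho y <-> unseparated x y.
Proof.
split=> [/eqmodP /asboolP //|xy]; apply/eqmodP; exact/asboolP.
Qed.

Lemma rho_continuous (X : topologicalType) : continuous (@rho X).
Proof. exact: pi_continuous. Qed.

Lemma max_hausdorff_quotient_universal (X Y : topologicalType) (f : X -> Y) :
  hausdorff_space Y -> continuous f ->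
  exists2 h : max_hausdorff_quotient X -> Y, continuous h & h \o @rho X = f.
Proof.
move=> hY cf; pose h (q : max_hausdorff_quotient X) := f (repr q).
have hE : h \o @rho X = f.
  apply/funext => x; rewrite /h /=; apply: (rho_eqP _ _).1 => //.
  by rewrite /rho reprK.
exists h => //; apply/quotient_continuous.
by rewrite -[_ \o _]/(h \o @rho X) hE.
Qed.

Lemma max_hausdorff_quotient_hausdorff (X : topologicalType) :
  hausdorff_space (max_hausdorff_quotient X).
Proof.
move=> p q pq; rewrite -[p]reprK -[q]reprK; apply/rho_eqP => Y hY f cf.
have [h ch hE] := max_hausdorff_quotient_universal hY cf.
rewrite -hE /= /rho !reprK; apply: hY => A B pA qB.
by have [z [Az Bz]] := pq _ _ (ch _ _ pA) (ch _ _ qB); exists (h z).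
Qed.

Section Triangle.
Context {R : realType}.

Definition triangle : set (R * R) :=
  [set t | 0 <= t.2 /\ t.2 <= t.1 /\ t.1 <= 2 * pi].

Definition glue (s t : R * R) : Prop :=
  exists th : R, [/\ 0 <= th <= 2 * pi, s = (th, 0) & t = (2 * pi, th)].

Definition glueb : rel (R * R) :=
  fun s t => `[< clos_refl_sym_trans _ glue s t >].

Lemma glueb_equiv : equiv_class_of glueb.
Proof.
split=> [x|x y|y x z].
- by apply/asboolP; exact: rst_refl.
- by apply/asboolP/asboolP; exact: rst_sym.
- by move=> /asboolP xy /asboolP yz; apply/asboolP; exact: rst_trans xy yz.
Qed.

Canonical glue_equiv := EquivRelPack glueb_equiv.

(* The identification is extended trivially outside the triangle, so that
   T/~ is the subset [tpoint @` triangle] of this type. *)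
Definition triangle_quotient : Type := {eq_quot glue_equiv}.

Definition tpoint (t : R * R) : triangle_quotient :=
  \pi_({eq_quot glue_equiv}) t.

(* The straight segment [x, y], in T/~. *)
Definition segment (x y : R * R) : set triangle_quotient :=
  tpoint @` [set z | exists2 l : R, 0 <= l <= 1 &
    z = ((1 - l) * x.1 + l * y.1, (1 - l) * x.2 + l * y.2)].

Definition slope (x y : R * R) (m : R) : Prop :=
  x.1 != y.1 /\ y.2 - x.2 = m * (y.1 - x.1).

Definition single_point (S : set triangle_quotient) : Prop :=
  exists q, S = [set q].

Definition diagonal_side : set triangle_quotient :=
  [set tpoint (th, th) | th in [set th : R | 0 < th < 2 * pi]].

Definition nondiagonal_side : set triangle_quotient :=
  [set tpoint (th, 0) | th in [set th : R | 0 < th < 2 * pi]].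

(* Equality of unordered pairs of angles modulo 2 pi. *)
Definition same_angles (s t : R * R) : Prop :=
  (expi s.1 = expi t.1 /\ expi s.2 = expi t.2) \/
  (expi s.1 = expi t.2 /\ expi s.2 = expi t.1).

Definition angles_point (t : R * R) : set triangle_quotient :=
  tpoint @` [set s | triangle s /\ same_angles s t].

End Triangle.

Unset Implicit Arguments.

Section Decompositions.
Context {R : realType}.
Implicit Types (J g : 'M[CC R]_3) (x y p v : 'cV[CC R]_3).
Implicit Types (alpha mu w : CC R).

(* [angle_pair J g t]: the isometry with lift g has angle pair {t.1, t.2}. *)
Definition angle_pair J g (t : R * R) : Prop :=
  [\/ elliptic J g /\
        (exists p mu, [/\ negative J p, g *m p = mu *: p &
           char_poly g = ('X - mu%:P) * ('X - (mu * expi t.1)%:P) *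
                         ('X - (mu * expi t.2)%:P)]),
      identical g /\ t = (0, 0),
      ellipto_parabolic J g /\
        (exists th : R,
           ('X - (expi th)%:P) ^+ 2 %| char_poly g /\ t = (- 3 * th, 0))
    | unipotent J g /\ t = (0, 0)].

Definition angle_point J (c : classes_space J) : set triangle_quotient :=
  [set q | exists g : SU J, exists2 t,
     c = class_of g /\ angle_pair J (val g) t & angles_point t q].

Definition elliptic_or_boundary_classes J : set (classes_space J) :=
  classes J (elliptic_or_boundary J).

(* The subset of T/~ identified with a subset S of rho(E) = rho(E u B). *)
Definition in_triangle J (S : set (max_hausdorff_quotient (classes_space J))) :
    set triangle_quotient :=
  [set q | exists c : classes_space J,
     [/\ elliptic_or_boundary_classes J c, S (rho c) & angle_point J c q]].

(* The fiber of rho over a point of T/~ = rho(E u B). *)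
Definition fiber J (q : triangle_quotient) : set (classes_space J) :=
  [set c | exists d : classes_space J,
     [/\ elliptic_or_boundary_classes J d, angle_point J d q & rho c = rho d]].

(* Classes of isometries with a lift R_{alpha2}^{p2} R_{alpha1}^{p1}, where p1
   is in P1 and p2 is in P2. *)
Definition decomposable J alpha1 alpha2 P1 P2 : set (classes_space J) :=
  classes J (fun g => exists p1 p2, [/\ P1 p1, P2 p2 &
    g = complex_reflection J alpha2 p2 *m complex_reflection J alpha1 p1]).

(* E_{alpha1,alpha2} is obtained with P1 = P2 = [nonisotropic J], and
   E_{alpha1,alpha2}^{s1 s2} with Pi = [positive J] or [negative J] according
   to the sign si. *)
Definition Eset J alpha1 alpha2 P1 P2 :
    set (max_hausdorff_quotient (classes_space J)) :=
  @rho (classes_space J) @`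
    (elliptic_or_boundary_classes J `&` decomposable J alpha1 alpha2 P1 P2).

Definition Etri J alpha1 alpha2 P1 P2 : set triangle_quotient :=
  in_triangle J (Eset J alpha1 alpha2 P1 P2).

Definition corresponding J alpha1 alpha2 P1 P2 (q : triangle_quotient) :
    set (classes_space J) :=
  fiber J q `&` decomposable J alpha1 alpha2 P1 P2.

(* q corresponds to exactly one class, and this class is of kind K. *)
Definition corresponds_to J alpha1 alpha2 P1 P2 q (K : 'M[CC R]_3 -> Prop) :
    Prop :=
  exists2 g : SU J, K (val g) &
    corresponding J alpha1 alpha2 P1 P2 q = [set class_of g].

(* q corresponds to exactly two classes, of kinds K1 and K2. *)
Definition corresponds_to_both J alpha1 alpha2 P1 P2 q
    (K1 K2 : 'M[CC R]_3 -> Prop) : Prop :=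
  exists g1 g2 : SU J, [/\ K1 (val g1), K2 (val g2) &
    corresponding J alpha1 alpha2 P1 P2 q = [set class_of g1; class_of g2]].

(* Shape of E^{--}: x is the endpoint in the diagonal side, y the other one. *)
Definition shape_mm J alpha1 alpha2 (x y : R * R) : Prop :=
  let N := negative J in
  let E := Etri J alpha1 alpha2 N N in
  [/\ E = segment x y,
      forall q, E = [set q] -> corresponds_to J alpha1 alpha2 N N q identical
    & ~ single_point E ->
      [/\ diagonal_side (tpoint x),
          corresponds_to J alpha1 alpha2 N N (tpoint x)
            (special_elliptic_center J N),
          nondiagonal_side (tpoint y)
        & corresponds_to J alpha1 alpha2 N N (tpoint y)
            (ellipto_parabolic J)]].

(* Shape of E^{++}: [x, y] is the segment of slope -1, y is the common endpoint,
   [y, z] is the other segment, of slope m unless it is a single point.  The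
   distinct endpoints y = (2 pi, th) and z = (th', 0), or y = (th, 0) and
   z = (2 pi, th'), become one point of T/~ when th = th'; for alpha_j = e^{i a_j}
   with 0 < a_j < 2 pi / 3, this is when a1 + a2 is 2 pi / 9 or 10 pi / 9.  The classes of y and those of z are then
   in the same fiber. *)
Definition shape_pp J alpha1 alpha2 (x y z : R * R) (m : R) : Prop :=
  let P := positive J in
  let E := Etri J alpha1 alpha2 P P in
  let classes_at t := corresponding J alpha1 alpha2 P P (tpoint t) in
  [/\ E = segment x y `|` segment y z,
      slope x y (-1),
      y = z \/ slope y z m,
      single_point (segment y z) ->
        corresponds_to_both J alpha1 alpha2 P P (tpoint y)
          identical (three_step_unipotent J)
    & ~ single_point (segment y z) ->
      corresponds_to J alpha1 alpha2 P P (tpoint x) (elliptic J) /\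
      exists gy1 gy2 gz : SU J,
        [/\ special_elliptic_center J P (val gy1),
            ellipto_parabolic J (val gy2),
            ellipto_parabolic J (val gz),
            tpoint y <> tpoint z ->
              classes_at y = [set class_of gy1; class_of gy2] /\
              classes_at z = [set class_of gz]
          & tpoint y = tpoint z ->
              classes_at y =
                [set class_of gy1; class_of gy2] `|` [set class_of gz]]].

(* Shape of E^{+-} and E^{-+}, according to P1 and P2. *)
Definition shape_pm J alpha1 alpha2 P1 P2 (x y : R * R) : Prop :=
  let E := Etri J alpha1 alpha2 P1 P2 in
  [/\ E = segment x y,
      (exists2 q, E = [set q] & corresponds_to J alpha1 alpha2 P1 P2 q
                     (special_elliptic_center J (positive J)))
        <-> alpha1 = alpha2
    & alpha1 <> alpha2 ->
      in_triangle J (@rho (classes_space J) @` classes J (regular_elliptic J))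
        (tpoint x) /\
      corresponds_to J alpha1 alpha2 P1 P2 (tpoint y) (ellipto_parabolic J)].

End Decompositions.

(* Main.v *)
(* Let A = a1 + a2 and F = R2 R1.  Besides the signs of p1 and p2, everything
   depends on tau = |<p1, p2>|^2 / (<p1, p1> <p2, p2>), which runs over
   [1, +oo) for two negative points, [0, +oo) for two positive ones and
   (-oo, 0] for opposite signs, and which determines the pair up to SU(2,1)
   except for positive points with tau = 1, where either p1 = p2 or the plane
   they span is degenerate.  F acts as e^{iA} on the orthogonal of p1 and p2, and
   its trace is affine in tau, so its other eigenvalues are e^{-iA/2 +- i psi} with
   cos psi affine in tau; psi is real exactly when F is elliptic, parabolic or the
   identity.  The sign of <v, v> for an explicit eigenvector v tells which
   eigenvalue is of negative type, and then the angles are affine in psi: this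
   gives the segments.  Their endpoints are the values of tau where two
   eigenvalues collide (a Jordan block, so F is ellipto-parabolic), where tau = 0
   or where tau = 1.

   That the points of the fibers of rho are told apart by their angles comes from
   the phase of an isometry, the argument of its eigenvalue of nonpositive type.
   It is a continuous function mu on SU(2,1), and tr(g) / mu and mu^3 are
   invariant under conjugation in PU(2,1), so they factor through the maximal
   Hausdorff quotient. *)

Require Import Defs.
From mathcomp Require Import all_boot all_order all_algebra.
From mathcomp Require Import all_classical all_reals all_analysis.
From mathcomp Require Import complex ring lra.
Set Implicit Arguments.
Unset Strict Implicit.
Unset Printing Implicit Defensive.
Import Order.TTheory GRing.Theory Num.Theory numFieldNormedType.Exports.
Local Open Scope classical_set_scope.
Local Open Scope ring_scope.
Import Defs.

(** * The Hermitian form *)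

(** The target space is known only through its universal property, so every passage through [rho] is
    reduced to the predicate [has_angles]: a class enters a fiber with itself as witness, and is
    kept out by continuous invariants. The obstacle is continuity of the phase, since eigenvectors
    cannot be chosen continuously; compactness of a sphere of vectors replaces the choice. Write S =
    3(a1 + a2)/2 and delta = 3(a1 - a2)/2. Then kappa is cos S at tau = 1 and cos delta at tau = 0.
    Where the phase comes from the span of the centers, psi is not confined to [0, pi]: it runs
    between S and pi, or between 0 and delta, whatever the order of these numbers, so that one
    formula gives the eigenvalue of negative type. The distinctions a1 + a2 <= 2 pi / 3, that is S
    <= pi, and a1 <= a2 then only decide how the angles are shifted and ordered to lie in the
    triangle. Hence each shape is proved once, for abstract affine paths, and instantiated at the
    end. At tau = 0 and tau = 1 the explicit eigenvector can vanish, so these values are treated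
    apart. *)

Section HermitianForm.
Context {R : realType}.
Implicit Types (J : 'M[CC R]_3) (x y z : 'cV[CC R]_3) (c k : CC R).

Lemma adjM m n l (A : 'M[CC R]_(m, n)) (B : 'M[CC R]_(n, l)) :
  adj (A *m B) = adj B *m adj A.
Proof. by rewrite /adj trmx_mul map_mxM. Qed.

Lemma adjK m n : cancel (@adj R m n) (@adj R n m).
Proof. by move=> A; apply/matrixP => i j; rewrite !mxE conjCK. Qed.

Lemma adjD m n (A B : 'M[CC R]_(m, n)) : adj (A + B) = adj A + adj B.
Proof. by apply/matrixP => i j; rewrite !mxE rmorphD. Qed.

Lemma adjZ m n c (A : 'M[CC R]_(m, n)) : adj (c *: A) = c^* *: adj A.
Proof. by apply/matrixP => i j; rewrite !mxE rmorphM. Qed.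

Lemma formDl J x y z : form J (x + y) z = form J x z + form J y z.
Proof. by rewrite /form mulmxDr [LHS]mxE. Qed.

Lemma formDr J x y z : form J z (x + y) = form J z x + form J z y.
Proof. by rewrite /form adjD 2!mulmxDl [LHS]mxE. Qed.

Lemma formZl J c x y : form J (c *: x) y = c * form J x y.
Proof. by rewrite /form -scalemxAr !mxE. Qed.

Lemma formZr J c x y : form J x (c *: y) = c^* * form J x y.
Proof. by rewrite /form adjZ -!scalemxAl !mxE. Qed.

Lemma formNl J x y : form J (- x) y = - form J x y.
Proof. by rewrite -scaleN1r formZl mulN1r. Qed.

Lemma formNr J x y : form J x (- y) = - form J x y.
Proof. by rewrite -scaleN1r formZr rmorphN1 mulN1r. Qed.

Lemma form0l J y : form J 0 y = 0.
Proof. by rewrite -(scale0r 0) formZl mul0r. Qed.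

Lemma form0r J y : form J y 0 = 0.
Proof. by rewrite -(scale0r 0) formZr rmorph0 mul0r. Qed.

Lemma scaler_inj (V : lmodType (CC R)) (v : V) (a b : CC R) : v != 0 ->
  a *: v = b *: v -> a = b.
Proof.
move=> v0 /eqP; rewrite -subr_eq0 -scalerBl scaler_eq0 (negPf v0) orbF subr_eq0.
by move/eqP.
Qed.

Definition formE := (formDl, formDr, formZl, formZr, formNl, formNr).

Lemma gramE J (B : 'M[CC R]_3) i j :
  (adj B *m J *m B) i j = form J (col j B) (col i B).
Proof.
rewrite /form !mxE; apply: eq_bigr => k _; rewrite !mxE; congr (_ * _).
by apply: eq_bigr => l _; rewrite !mxE.
Qed.

Lemma gram_form J (B : 'M[CC R]_3) x y :
  form J (B *m x) (B *m y) = form (adj B *m J *m B) x y.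
Proof. by rewrite /form adjM !mulmxA. Qed.

Lemma sum3 (V : nmodType) (F : 'I_3 -> V) :
  \sum_i F i = F 0 + F 1 + F 2%:R.
Proof.
rewrite !big_ord_recl big_ord0 addr0 addrA.
by congr (_ + F _ + F _); apply/val_inj.
Qed.

Lemma ord3P (P : 'I_3 -> Prop) : P 0 -> P 1 -> P 2%:R -> forall i, P i.
Proof.
move=> P0 P1 P2 [[|[|[|//]]] Hi].
- by rewrite (_ : Ordinal Hi = 0) //; apply/val_inj.
- by rewrite (_ : Ordinal Hi = 1) //; apply/val_inj.
- by rewrite (_ : Ordinal Hi = 2%:R) //; apply/val_inj.
Qed.

End HermitianForm.

(** * Consequences of the signature *)

Section Signature.
Context {R : realType}.
Variables (J : 'M[CC R]_3) (HJ : signature_ppm J).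
Implicit Types (x y w : 'cV[CC R]_3) (c : CC R).
Local Notation "<< x , y >>" := (form J x y).

(** [signature_ppm] does not mention that [J] is Hermitian. This is forced: the diagonal form is
    real, and the invertible [P] cancels on both sides. *)
Lemma signature_hermitian : adj J = J.
Proof.
have [P Pu PE] := HJ.
set D := diag_mx _ in PE.
have DE : adj D = D.
  apply/matrixP => i j; rewrite !mxE [j == i]eq_sym.
  case: (eqVneq i j) => [->|ij]; last by rewrite rmorphMn /= !mulr0n.
  by rewrite eq_sym; case: ifP => _; rewrite ?rmorphN1 ?rmorph1.
have : adj (adj P *m J *m P) = adj P *m J *m P by rewrite PE.
rewrite !adjM adjK mulmxA => /(can_inj (mulmxK Pu)).
have aPu : adj P \in unitmx by rewrite /adj map_unitmx unitmx_tr.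
exact: (can_inj (mulKmx aPu)).
Qed.

Lemma formC x y : <<y, x>> = <<x, y>>^*.
Proof.
rewrite /form; set a := adj y *m J *m x.
have -> : adj x *m J *m y = adj a.
  by rewrite /a !adjM adjK signature_hermitian mulmxA.
by rewrite !mxE.
Qed.

Lemma form_real x : <<x, x>> \is Num.real.
Proof. by rewrite CrealE -formC. Qed.

Lemma formC0 x y : <<x, y>> = 0 -> <<y, x>> = 0.
Proof. by rewrite (formC x y) => ->; rewrite rmorph0. Qed.

Lemma form_nneg x : ~~ (<<x, x>> <= 0) = (0 < <<x, x>>).
Proof. by rewrite real_ltNge ?form_real ?real0. Qed.

Lemma form_le0Vgt0 x : (<<x, x>> <= 0) || (0 < <<x, x>>).
Proof. by rewrite -form_nneg orbN. Qed.

Lemma signature_basis : exists e1 e2 e3,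
  [/\ [/\ <<e1, e1>> = 1, <<e2, e2>> = 1 & <<e3, e3>> = -1],
      [/\ <<e1, e2>> = 0, <<e1, e3>> = 0 & <<e2, e3>> = 0] &
      forall x, exists a b c, x = a *: e1 + b *: e2 + c *: e3].
Proof.
have [P Pu PE] := HJ.
have gE i j : <<col j P, col i P>> =
    (if i == j then (if i == ord_max then -1 else 1) else 0).
  by rewrite -gramE PE !mxE; case: (eqVneq i j) => [->|]; rewrite ?mulr1n.
exists (col 0 P), (col 1 P), (col 2%:R P); split; rewrite ?gE // => x.
exists ((invmx P *m x) 0 0), ((invmx P *m x) 1 0), ((invmx P *m x) 2%:R 0).
apply/matrixP => i j; rewrite ord1 -{1}[x](mulKVmx Pu) mxE sum3 !mxE.
by rewrite ![P i _ * _]mulrC.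
Qed.

(** The signature enters the sign arguments here: the complement of the basis vector of square -1 is
    spanned by two orthogonal vectors of square 1. Other negative vectors are reached later by
    [orthogonal_to_negative]. *)
Lemma negative_orthogonal_positive : exists2 e, <<e, e>> = -1 &
  forall w, <<w, e>> = 0 -> w != 0 -> 0 < <<w, w>>.
Proof.
have [e1 [e2 [e3 [[e11 e22 e33] [e12 e13 e23] span]]]] := signature_basis.
exists e3 => // w; have [a [b [c ->]]] := span w.
rewrite !formE e13 e23 e33 !mulr0 !add0r mulrN1 => /eqP; rewrite oppr_eq0 => /eqP ->.
rewrite scale0r addr0 e12 (formC0 e12) e11 e22 !mul0r !mulr0 !addr0 add0r.
rewrite !mulr1 -!normCK => n0.
have [a0|a0] := eqVneq a 0.
  rewrite a0 normr0 expr0n add0r exprn_gt0 // normr_gt0.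
  by apply: contraNneq n0 => ->; rewrite a0 !scale0r addr0.
by rewrite ltr_wpDr ?exprn_ge0 // exprn_gt0 // normr_gt0.
Qed.
End Signature.

Definition cols3 {R : realType} (u v w : 'cV[CC R]_3) : 'M[CC R]_3 :=
  \matrix_(i, j) tnth [tuple u; v; w] j i 0.

Section Frames.
Context {R : realType}.
Implicit Types (u v w y : 'cV[CC R]_3).

Lemma col_cols3 u v w :
  [/\ col 0 (cols3 u v w) = u, col 1 (cols3 u v w) = v &
      col 2%:R (cols3 u v w) = w].
Proof. by split; apply/matrixP => i j; rewrite !mxE ord1. Qed.

Lemma cols3_mul u v w y :
  cols3 u v w *m y = y 0 0 *: u + y 1 0 *: v + y 2%:R 0 *: w.
Proof.
apply/matrixP => i j; rewrite ord1 mxE sum3 !mxE.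
by rewrite ![y _ _ * _]mulrC.
Qed.

Lemma cols3_unit u v w :
  (forall a b c : CC R, a *: u + b *: v + c *: w = 0 ->
    [/\ a = 0, b = 0 & c = 0]) -> cols3 u v w \in unitmx.
Proof.
move=> free; rewrite -unitmx_tr -row_free_unit -kermx_eq0.
apply/eqP/row_matrixP => i; rewrite row0.
have : row i (kermx (cols3 u v w)^T) *m (cols3 u v w)^T = 0.
  by rewrite -row_mul mulmx_ker row0.
move: (row i _) => y yB.
have : cols3 u v w *m y^T = 0.
  by rewrite -[LHS]trmxK trmx_mul trmxK yB trmx0.
rewrite cols3_mul => /free[]; rewrite !mxE => y0 y1 y2.
by apply/matrixP => k j; rewrite ord1 [RHS]mxE; move: j; apply: ord3P.
Qed.

Lemma cols3_span u v w x : cols3 u v w \in unitmx ->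
  exists a b c : CC R, x = a *: u + b *: v + c *: w.
Proof.
by move=> Bu; rewrite -[x](mulKVmx Bu) cols3_mul; do 3 eexists.
Qed.

End Frames.

(** * Orthogonal projections and complements *)

Section Orthogonality.
Context {R : realType}.
Variables (J : 'M[CC R]_3) (HJ : signature_ppm J).
Implicit Types (x y z p q u v w e : 'cV[CC R]_3) (c k : CC R).
Local Notation "<< x , y >>" := (form J x y).
Local Notation formC := (formC HJ).
Local Notation formC0 := (formC0 HJ).

Lemma form_neq0 x : <<x, x>> != 0 -> x != 0.
Proof. by apply: contraNneq => ->; rewrite form0l. Qed.

(* Reverse Cauchy-Schwarz: a combination of u and v orthogonal to the negative
   vector e has nonpositive square, so it vanishes. *)
Lemma nonpositive_orthogonal u v : u != 0 -> <<u, u>> <= 0 -> <<v, v>> <= 0 ->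
  <<u, v>> = 0 -> exists k, v = k *: u.
Proof.
move=> u0 u_le v_le uv; have [e ee epos] := negative_orthogonal_positive HJ.
have U0 : <<u, e>> != 0.
  by apply/eqP => /epos /(_ u0) /(le_lt_trans u_le); rewrite ltxx.
set U := <<u, e>> in U0 *; set V := <<v, e>>.
have w0 : V *: u - U *: v = 0.
  apply/eqP; apply: contraT => w0.
  suff : <<V *: u - U *: v, V *: u - U *: v>> <= 0.
    move=> /(lt_le_trans (epos _ _ w0)); rewrite ltxx; apply.
    by rewrite !formE -/U -/V mulrC subrr.
  have -> : <<V *: u - U *: v, V *: u - U *: v>> =
      `|V| ^+ 2 * <<u, u>> + `|U| ^+ 2 * <<v, v>>.
    by rewrite !formE uv (formC0 uv) !normCK; ring.
  by rewrite -oppr_ge0 opprD -!mulrN addr_ge0 // mulr_ge0 ?exprn_ge0 ?oppr_ge0.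
exists (V / U); apply: (scalerI U0); rewrite scalerA mulrCA mulfV // mulr1.
by apply/eqP; rewrite eq_sym -subr_eq0 w0.
Qed.

Lemma orthogonal_to_negative e w : <<e, e>> < 0 -> <<w, e>> = 0 -> w != 0 ->
  0 < <<w, w>>.
Proof.
move=> e_lt we w0; case/orP: (form_le0Vgt0 HJ w) => // w_le.
have e0 : e != 0 by rewrite form_neq0 // lt_eqF.
have [k wE] := nonpositive_orthogonal e0 (ltW e_lt) w_le (formC0 we).
move: we w0; rewrite wE formE => /eqP; rewrite mulf_eq0 (lt_eqF e_lt) orbF.
by move=> /eqP ->; rewrite scale0r eqxx.
Qed.

Lemma orthogonal_frame_unit u v w : <<u, u>> != 0 -> <<v, v>> != 0 ->
  <<w, w>> != 0 -> <<u, v>> = 0 -> <<u, w>> = 0 -> <<v, w>> = 0 ->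
  cols3 u v w \in unitmx.
Proof.
move=> u0 v0 w0 uv uw vw; apply: cols3_unit => a b c E.
have F x : a * <<u, x>> + b * <<v, x>> + c * <<w, x>> = 0.
  by rewrite -!formZl -!formDl E form0l.
move: (F u) (F v) (F w); rewrite uv uw vw !(formC0 uv, formC0 uw, formC0 vw).
rewrite !mulr0 !addr0 !add0r => /eqP + /eqP + /eqP.
by rewrite !mulf_eq0 (negPf u0) (negPf v0) (negPf w0) !orbF => /eqP ? /eqP ? /eqP ?.
Qed.

Lemma orthogonal_frame_zero u v w x : <<u, u>> != 0 -> <<v, v>> != 0 ->
  <<w, w>> != 0 -> <<u, v>> = 0 -> <<u, w>> = 0 -> <<v, w>> = 0 ->
  <<x, u>> = 0 -> <<x, v>> = 0 -> <<x, w>> = 0 -> x = 0.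
Proof.
move=> u0 v0 w0 uv uw vw xu xv xw.
have [a [b [c xE]]] := cols3_span x (orthogonal_frame_unit u0 v0 w0 uv uw vw).
move: xu xv xw; rewrite xE !formE uv uw vw !(formC0 uv, formC0 uw, formC0 vw).
rewrite !mulr0 !addr0 !add0r => /eqP + /eqP + /eqP.
rewrite !mulf_eq0 (negPf u0) (negPf v0) (negPf w0) !orbF => /eqP -> /eqP -> /eqP ->.
by rewrite !scale0r !addr0.
Qed.

(** The Gram-Schmidt step along [p]. For isotropic [p] the quotient is 0 and [x] is returned
    unchanged. *)
Definition reject p x := x - (<<x, p>> / <<p, p>>) *: p.

Lemma reject_orthogonal p x : <<p, p>> != 0 -> <<reject p x, p>> = 0.
Proof. by move=> p0; rewrite /reject !formE divfK // subrr. Qed.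

Lemma form_reject p x y : <<p, y>> = 0 -> <<reject p x, y>> = <<x, y>>.
Proof. by move=> py; rewrite /reject !formE py mulr0 oppr0 addr0. Qed.

Lemma form_reject_self p x : <<p, p>> != 0 ->
  <<reject p x, reject p x>> = <<x, x>> - `|<<x, p>>| ^+ 2 / <<p, p>>.
Proof.
move=> p0; rewrite {2}/reject formDr formNr formZr reject_orthogonal //.
rewrite mulr0 subr0 /reject !formE (formC x p) normCK.
by rewrite mulrAC.
Qed.

Lemma negative_reject p x : 0 < <<p, p>> -> <<x, x>> < 0 ->
  <<reject p x, reject p x>> < 0.
Proof.
move=> p_gt x_lt; rewrite form_reject_self ?gt_eqF //.
by rewrite subr_lt0 (lt_le_trans x_lt) // divr_ge0 ?exprn_ge0 // ltW.
Qed.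

(** Removing from a negative vector its component along a positive one can only decrease its square,
    so two Gram-Schmidt steps stay negative. Uniqueness holds because the three vectors form an
    orthogonal basis. *)
Lemma positive_plane_complement p q : 0 < <<p, p>> -> 0 < <<q, q>> ->
  <<p, q>> = 0 -> exists e, [/\ <<e, e>> < 0, <<e, p>> = 0, <<e, q>> = 0 &
    forall x, <<x, p>> = 0 -> <<x, q>> = 0 -> exists k, x = k *: e].
Proof.
move=> p_gt q_gt pq; have [f ff _] := negative_orthogonal_positive HJ.
have [p0 q0] : <<p, p>> != 0 /\ <<q, q>> != 0 by rewrite !gt_eqF.
pose e := reject q (reject p f).
have e_lt : <<e, e>> < 0.
  by rewrite /e !negative_reject // ff oppr_lt0 ltr01.
have ep : <<e, p>> = 0 by rewrite /e form_reject ?(formC0 pq) // reject_orthogonal.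
have eq : <<e, q>> = 0 by rewrite /e reject_orthogonal.
exists e; split=> // x xp xq; exists (<<x, e>> / <<e, e>>).
apply/eqP; rewrite -subr_eq0 -/(reject e x); apply/eqP.
apply: (orthogonal_frame_zero p0 q0 _ pq (formC0 ep) (formC0 eq)).
- by rewrite lt_eqF.
- by rewrite form_reject.
- by rewrite form_reject.
- by rewrite reject_orthogonal // lt_eqF.
Qed.

(** A dimension count, valid also for collinear or isotropic vectors: the columns of [A] are the two
    functionals, and a 3 by 2 matrix has a nonzero left kernel. *)
Lemma orthogonal_vector p q : exists2 c, c != 0 & <<c, p>> = 0 /\ <<c, q>> = 0.
Proof.
pose A : 'M[CC R]_(3, 1 + 1) := row_mx (J^T *m (adj p)^T) (J^T *m (adj q)^T).
have /rowV0Pn[y yA y0] : kermx A != 0.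
  rewrite kermx_eq0; apply/negP => /eqP rA.
  by have := rank_leq_col A; rewrite rA.
exists y^T; first by rewrite -trmx0 (inj_eq trmx_inj).
have {}yA : y *m A = 0 by apply/sub_kermxP.
have fE z : <<y^T, z>> = (y *m (J^T *m (adj z)^T)) 0 0.
  have -> : y *m (J^T *m (adj z)^T) = (adj z *m J *m y^T)^T.
    by rewrite !trmx_mul trmxK.
  by rewrite [RHS]mxE.
move: yA; rewrite mul_mx_row -(row_mx0 _ 1 1 1) => /eq_row_mx[yp yq].
by rewrite !fE yp yq !mxE.
Qed.

(** As [v] is isotropic, the square of w + c v is <w, w> + 2 Re (c <v, w>), affine and nonconstant
    in c; the witness makes it -1. *)
Lemma isotropic_pair_negative v w : <<v, v>> = 0 -> <<w, v>> != 0 ->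
  exists c, <<w + c *: v, w + c *: v>> < 0.
Proof.
move=> vv wv; pose b := <<w, v>>.
exists (- ((<<w, w>> + 1) / (2 * b^*))).
have b0 : b^* != 0 by rewrite conjC_eq0.
have ww : <<w, w>>^* = <<w, w>> by rewrite -formC.
rewrite !formE vv !mulr0 addr0 (formC w v) -/b rmorphN /=.
have -> : ((<<w, w>> + 1) / (2 * b^*))^* = (<<w, w>> + 1) / (2 * b).
  rewrite rmorphM fmorphV /= [in X in _ / X]rmorphM /= conjCK conjC_nat.
  by rewrite rmorphD /= ww rmorph1.
have -> : <<w, w>> + - ((<<w, w>> + 1) / (2 * b)) * b +
  - ((<<w, w>> + 1) / (2 * b^*)) * b^* = -1.
  by field; rewrite b0 -conjC_eq0.
by rewrite oppr_lt0 ltr01.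
Qed.

End Orthogonality.

(** * Characteristic polynomials of 3 by 3 matrices *)

Section CubicCharPoly.
Context {F : closedFieldType}.
Implicit Types (g : 'M[F]_3) (a b c : F).

Definition cubic a b c : {poly F} := ('X - a%:P) * ('X - b%:P) * ('X - c%:P).

Lemma cubicE a b c : cubic a b c =
  'X^3 - (a + b + c)%:P * 'X^2 + (a * b + b * c + c * a)%:P * 'X - (a * b * c)%:P.
Proof. by rewrite /cubic !(polyCD, polyCM); ring. Qed.

Lemma eq_cubic a b c a' b' c' : a + b + c = a' + b' + c' ->
  a * b + b * c + c * a = a' * b' + b' * c' + c' * a' ->
  a * b * c = a' * b' * c' -> cubic a b c = cubic a' b' c'.
Proof. by move=> e1 e2 e3; rewrite !cubicE e1 e2 e3. Qed.

Lemma root_cubic a b c x :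
  root (cubic a b c) x = [|| x == a, x == b | x == c].
Proof. by rewrite /cubic !rootM !root_XsubC orbA. Qed.

Lemma horner_cubic a b c x : (cubic a b c).[x] = (x - a) * (x - b) * (x - c).
Proof. by rewrite /cubic !hornerE. Qed.

Lemma char_poly_split g : exists a b c, char_poly g = cubic a b c.
Proof.
have [r rE] := closed_field_poly_normal (char_poly g).
move: rE; rewrite (monicP (char_poly_monic g)) scale1r => rE.
have : size (char_poly g) = 4 by rewrite size_char_poly.
rewrite rE size_prod_XsubC; case: r rE => [|a [|b [|c [|]]]] //= rE _.
by exists a, b, c; rewrite !big_cons big_nil mulr1 mulrA.
Qed.

Lemma char_poly_cubic_trace g a b c : char_poly g = cubic a b c ->
  \tr g = a + b + c.
Proof.
move=> gE; have := @char_poly_trace _ _ g isT; rewrite gE cubicE /=.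
rewrite !(coefB, coefD, coefCM, coefXn, coefX, coefC) /= => E.
by apply: oppr_inj; rewrite -E; ring.
Qed.

Lemma char_poly_cubic_det g a b c : char_poly g = cubic a b c ->
  \det g = a * b * c.
Proof.
move=> gE; have := @char_poly_det _ _ g; rewrite gE -horner_coef0 horner_cubic.
move=> E; apply: oppr_inj; transitivity ((-1) ^+ 3 * \det g); first by ring.
by rewrite -E; ring.
Qed.

Lemma horner_char_poly g x : (char_poly g).[x] = \det (x%:M - g).
Proof.
rewrite /char_poly -horner_evalE -det_map_mx; congr (\det _).
apply/matrixP => i j; rewrite !mxE /= horner_evalE hornerD hornerN hornerC.
by case: (i == j); rewrite ?mulr1n ?mulr0n ?hornerX ?horner0.
Qed.

Lemma char_poly_tr g : char_poly g^T = char_poly g.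
Proof.
rewrite /char_poly -[RHS]det_tr; congr (\det _).
by apply/matrixP => i j; rewrite !mxE eq_sym.
Qed.

(** [eigenvalue] is about row vectors; transposition, which keeps the characteristic polynomial,
    gives columns. *)
Lemma root_eigenvector g a : root (char_poly g) a ->
  exists2 v : 'cV_3, v != 0 & g *m v = a *: v.
Proof.
rewrite -char_poly_tr -eigenvalue_root_char => /eigenvalueP[v vE v0].
exists v^T; first by rewrite -trmx0 (inj_eq trmx_inj).
by rewrite -[LHS]trmxK trmx_mul trmxK vE linearZ.
Qed.

Lemma eigenvector_root g a (v : 'cV_3) : v != 0 -> g *m v = a *: v ->
  root (char_poly g) a.
Proof.
move=> v0 vE; rewrite -char_poly_tr -eigenvalue_root_char; apply/eigenvalueP.
exists v^T; last by rewrite -trmx0 (inj_eq trmx_inj).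
by rewrite -trmx_mul vE linearZ.
Qed.

(** Cayley-Hamilton in factored form produces eigenvectors: on a nonzero vector, the last nonzero
    partial product is one. *)
Lemma cubic_annihilates g a b c : char_poly g = cubic a b c ->
  (g - a%:M) *m (g - b%:M) *m (g - c%:M) = 0.
Proof.
move=> gE; have := Cayley_Hamilton g; rewrite gE /cubic !rmorphM /=.
by rewrite !rmorphB /= !horner_mx_X !horner_mx_C.
Qed.

End CubicCharPoly.

(** * The unit circle *)

Section Expi.
Context {R : realType}.
Implicit Types (x y : R) (z : CC R).

Lemma expiD x y : expi (x + y) = expi x * expi y.
Proof.
apply/eqP; rewrite eq_complex /= cosD sinD; apply/andP; split; apply/eqP => //.
by rewrite addrC mulrC [in X in _ + X]mulrC.
Qed.

Lemma expi0 : expi 0 = 1 :> CC R.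
Proof. by apply/eqP; rewrite eq_complex /= cos0 sin0 !eqxx. Qed.

Lemma expiN x : expi (- x) = (expi x)^-1.
Proof.
apply: (@mulIf _ (expi x)).
  apply/eqP => e0; have := expiD x (- x).
  by rewrite subrr e0 mul0r expi0 => /eqP; rewrite oner_eq0.
rewrite -expiD addNr expi0 mulVf //; apply/eqP => e0.
by have := expiD x (- x); rewrite subrr e0 mul0r expi0 => /eqP; rewrite oner_eq0.
Qed.

Lemma expi_neq0 x : expi x != 0.
Proof.
apply/eqP => e0; have := expiD x (- x).
by rewrite subrr e0 mul0r expi0 => /eqP; rewrite oner_eq0.
Qed.

Lemma conj_expi x : (expi x)^* = expi (- x).
Proof. by apply/eqP; rewrite eq_complex /= cosN sinN !eqxx. Qed.

Lemma norm_expi x : `|expi x| = 1.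
Proof.
apply/eqP; rewrite -sqrp_eq1 // normCK conj_expi expiN mulfV ?expi_neq0 //.
Qed.

Lemma expi_pi : expi pi = -1 :> CC R.
Proof. by apply/eqP; rewrite eq_complex /= cospi sinpi oppr0 !eqxx. Qed.

Lemma expi_2pi : expi (2 * pi) = 1 :> CC R.
Proof. by rewrite mulr_natl mulr2n expiD expi_pi mulrNN mulr1. Qed.

Lemma expi_cos x : (cos x)%:C%C = (expi x + expi (- x)) / 2 :> CC R.
Proof.
apply: (@mulIf _ 2); rewrite ?pnatr_eq0 // divfK ?pnatr_eq0 //.
rewrite mulr_natr mulr2n; apply/eqP.
by rewrite eq_complex /= cosN sinN subrr addr0 !eqxx.
Qed.

Lemma expi_pihalf_sqr : expi (pi / 2) ^+ 2 = -1 :> CC R.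
Proof. by rewrite expr2 -expiD -splitr expi_pi. Qed.

(** The imaginary unit is written [expi (pi / 2)], so that identities between sines become rational
    identities in exponentials. *)
Lemma expi_sin x :
  (sin x)%:C%C = (expi x - expi (- x)) / (2 * expi (pi / 2)) :> CC R.
Proof.
have e0 : 2 * expi (pi / 2) != 0 :> CC R by rewrite mulf_neq0 ?pnatr_eq0 ?expi_neq0.
apply: (mulIf e0); rewrite divfK // mulrA mulr_natr mulr2n; apply/eqP.
rewrite eq_complex /= cosN sinN cos_pihalf sin_pihalf subrr !mulr0 !mulr1.
by rewrite !addr0 subrr opprK !eqxx.
Qed.

Lemma expi_eq1 x : 0 <= x <= 2 * pi -> expi x = 1 -> x = 0 \/ x = 2 * pi.
Proof.
move=> /andP[x0 x2] /eqP; rewrite eq_complex /= => /andP[/eqP c1 _].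
have pi0 := pi_gt0 R.
have [xpi|xpi] := leP x pi.
  left; apply: (@cos_inj R); rewrite ?cos0 // in_itv /= ?x0 ?lexx ?xpi ?pi_ge0 //.
right; suff : 2 * pi - x = 0 by lra.
apply: (@cos_inj R); rewrite ?in_itv /= ?lexx ?pi_ge0 //; first lra.
rewrite cos0 mulr_natl cosB cos2pi sin2pi c1; lra.
Qed.

(** The two exceptional cases are the source of the gluing of the triangle. *)
Lemma expi_inj x y : 0 <= x <= 2 * pi -> 0 <= y <= 2 * pi -> expi x = expi y ->
  [\/ x = y, x = 0 /\ y = 2 * pi | x = 2 * pi /\ y = 0].
Proof.
wlog xy : x y / x <= y => [H|] hx hy exy.
  have [xy|/ltW yx] := leP x y; first exact: H.
  by case: (H y x yx hy hx (esym exy)) => [->|[-> ->]|[-> ->]];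
    [constructor 1|constructor 3|constructor 2].
have : expi (y - x) = 1 by rewrite expiD expiN exy mulfV ?expi_neq0.
move=> /expi_eq1[|E|E]; [lra|constructor 1; lra|constructor 2; lra].
Qed.

Lemma expi_surj z : `|z| = 1 -> exists2 x, 0 <= x <= 2 * pi & z = expi x.
Proof.
move=> z1; have : (complex.Re z) ^+ 2 + (complex.Im z) ^+ 2 = 1.
  move: z1 => /(congr1 (fun u => u ^+ 2)); rewrite normCK expr1n.
  by case: z => a b /eqP; rewrite eq_complex /= => /andP[/eqP <- _]; ring.
move: z1 => _; case: z => a b /= ab.
have b2 : 0 <= b ^+ 2 by exact: sqr_ge0.
have a1 : -1 <= a <= 1 by rewrite -ler_norml -(@expr_le1 _ 2%N) // ?normrE // real_normK ?num_real //; lra.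
have [c0 c1] := (acos_ge0 a1, acos_lepi a1).
have cE : cos (acos a) = a by rewrite acosK // in_itv.
have := sin_acos a1; have -> : 1 - a ^+ 2 = b ^+ 2 by lra.
rewrite sqrtr_sqr => sE.
have [b_ge|b_lt] := leP 0 b.
  exists (acos a); first lra.
  by rewrite /expi cE sE ger0_norm.
exists (2 * pi - acos a); first lra.
rewrite expiD expi_2pi mul1r; apply/eqP.
by rewrite eq_complex /= cosN sinN cE sE ltr0_norm // opprK !eqxx.
Qed.

Lemma unit_sum_prod_inj (u v u' v' : CC R) : u + v = u' + v' ->
  u * v = u' * v' -> (u = u' /\ v = v') \/ (u = v' /\ v = u').
Proof.
move=> s p; have : (u - u') * (u - v') = 0.
  have -> : (u - u') * (u - v') = u * u - (u' + v') * u + u' * v' by ring.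
  by rewrite -s -p; ring.
move=> /eqP; rewrite mulf_eq0 !subr_eq0 => /orP[] /eqP E; [left|right]; split=> //.
  by apply: (@addrI _ u); rewrite s E.
by apply: (@addrI _ u); rewrite s E addrC.
Qed.

Lemma ler_cos_pi (b d : R) : 0 <= b <= pi -> 0 <= d <= pi -> (cos b <= cos d) = (d <= b).
Proof. by move=> hb hd; rewrite !leNgt ltr_cos // in_itv. Qed.

Lemma cos_interval (b d c : R) : 0 <= b -> b <= d -> d <= pi -> cos d <= c <= cos b ->
  exists2 psi, b <= psi <= d & cos psi = c.
Proof.
move=> b0 bd dpi /andP[c1 c2].
have hc : -1 <= c <= 1 by rewrite (le_trans (cos_geN1 _) c1) (le_trans c2) // cos_le1.
have [h0 hpi] := (acos_ge0 hc, acos_lepi hc).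
have cE : cos (acos c) = c by rewrite acosK.
have hb : 0 <= b <= pi by rewrite b0 (le_trans bd).
have hd : 0 <= d <= pi by rewrite dpi (le_trans b0).
have ha : 0 <= acos c <= pi by rewrite h0.
exists (acos c); last exact: cE.
by rewrite -(ler_cos_pi ha hb) -(ler_cos_pi hd ha) cE c1 c2.
Qed.

End Expi.

(** * The phase of an isometry *)

(* [phase J g mu]: g has a nonpositive eigenvector, whose eigenvalue is a
   positive multiple of the unit number mu.  This is the eigenvalue of negative
   type of an elliptic g, and it depends continuously on g even across parabolic
   and loxodromic isometries. *)
Definition phase {R : realType} (J g : 'M[CC R]_3) (mu : CC R) : Prop :=
  `|mu| = 1 /\ exists r v,
    [/\ 0 < r, v != 0, form J v v <= 0 & g *m v = (r * mu) *: v].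

Section Isometries.
Context {R : realType}.
Variables (J : 'M[CC R]_3) (HJ : signature_ppm J).
Implicit Types (g k : 'M[CC R]_3) (x y : 'cV[CC R]_3).
Implicit Types (a b c mu : CC R).
Local Notation "<< x , y >>" := (form J x y).

Lemma unit_inv_conj mu : `|mu| = 1 -> mu^* = mu^-1.
Proof.
move=> m1; have m0 : mu != 0 by rewrite -normr_eq0 m1 oner_eq0.
by apply: (mulfI m0); rewrite -normCK m1 expr1n mulfV.
Qed.

Lemma unit_neq0 mu : `|mu| = 1 -> mu != 0.
Proof. by move=> m1; rewrite -normr_eq0 m1 oner_eq0. Qed.

Lemma SU_form g x y : SU J g -> <<g *m x, g *m y>> = <<x, y>>.
Proof. by case. Qed.

Lemma SU_det g : SU J g -> \det g = 1.
Proof. by case. Qed.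

Lemma eigen_product g a b x y : SU J g -> g *m x = a *: x -> g *m y = b *: y ->
  a * b^* * <<x, y>> = <<x, y>>.
Proof. by move=> gS gx gy; rewrite -[RHS](SU_form _ _ gS) gx gy !formE mulrA. Qed.

Lemma eigen_norm1 g a x : SU J g -> g *m x = a *: x -> <<x, x>> != 0 -> `|a| = 1.
Proof.
move=> gS gx x0; have := eigen_product gS gx gx; rewrite -normCK.
move=> /(canRL (mulfK x0)); rewrite mulfV // => /eqP.
by rewrite sqrp_eq1 // => /eqP.
Qed.

Lemma eigen_neq0 g a x : SU J g -> g *m x = a *: x -> x != 0 -> a != 0.
Proof.
move=> gS gx; apply: contraNneq => a0; move: gx; rewrite a0 scale0r => gx.
by rewrite -[x](mulKmx (SU_unit gS)) gx mulmx0.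
Qed.

Lemma SU_preserves_orthogonal g a x y : SU J g -> g *m x = a *: x -> x != 0 ->
  <<y, x>> = 0 -> <<g *m y, x>> = 0.
Proof.
move=> gS gx x0 yx; have a0 := eigen_neq0 gS gx x0.
apply: (@mulfI _ a^*); first by rewrite conjC_eq0.
by rewrite -formZr -gx SU_form // yx mulr0.
Qed.

Lemma signature_unit : J \in unitmx.
Proof.
have [P Pu PE] := HJ; rewrite unitmxE unitfE.
have : \det (adj P *m J *m P) != 0.
  rewrite PE det_diag prodf_seq_neq0; apply/allP => i _ /=; rewrite mxE.
  by case: ifP; rewrite ?oppr_eq0 ?oner_eq0.
by rewrite !det_mulmx !mulf_eq0 !negb_or => /andP[/andP[_ ->]].
Qed.

Lemma SU_gram g : SU J g -> adj g *m J *m g = J.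
Proof.
move=> gS; apply/matrixP => i j; rewrite gramE.
have colg l : col l g = g *m col l 1%:M by rewrite -[in LHS](mulmx1 g) !colE mulmxA.
rewrite !colg SU_form // -gramE.
suff -> : adj 1%:M = 1%:M :> 'M[CC R]_3 by rewrite mul1mx mulmx1.
by apply/matrixP => k l; rewrite !mxE eq_sym rmorph_nat.
Qed.

Lemma det_adj (M : 'M[CC R]_3) : \det (adj M) = (\det M)^*.
Proof. by rewrite /adj det_map_mx det_tr. Qed.

(** From g^* J g = J follows (b - g)^* J g = - b J (b - g) for b = 1 or b = -1; take determinants,
    with b^3 = b. *)
Lemma conj_det_subr g b : SU J g -> b^* = b -> b * b = 1 ->
  (\det (b%:M - g))^* = - (b * \det (b%:M - g)).
Proof.
move: b => x gS xc xx; have E : adj (x%:M - g) *m J *m g = (- x) *: (J *m (x%:M - g)).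
  have -> : adj (x%:M - g) = x%:M - adj g.
    by apply/matrixP => i j; rewrite !mxE rmorphB rmorphMn /= xc eq_sym.
  rewrite !mulmxBl SU_gram // mulmxBr mul_scalar_mx mul_mx_scalar -scalemxAl.
  by rewrite scalerBr scalerA mulNr xx scaleN1r scaleNr opprK addrC.
have := congr1 determinant E.
rewrite detZ !det_mulmx det_adj (SU_det gS) mulr1 mulrCA mulrC.
have Ju : \det J != 0 by have := signature_unit; rewrite unitmxE unitfE.
move=> /(mulfI Ju) ->.
by rewrite -mulNr; congr (_ * _); transitivity (- (x * x) * x); [ring | rewrite xx mulN1r].
Qed.

(** Values of the polynomial at 1 and -1 show that the difference of the two symmetric functions is
    imaginary and their sum real. With determinant 1, the trace thus determines the characteristic
    polynomial. *)
Lemma SU_char_poly g a b c : SU J g -> char_poly g = cubic a b c ->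
  a * b + b * c + c * a = (a + b + c)^*.
Proof.
move=> gS gE; have abc : a * b * c = 1 by rewrite -(char_poly_cubic_det gE) SU_det.
have d1 : \det (1%:M - g) = (a * b + b * c + c * a) - (a + b + c).
  rewrite -horner_char_poly gE horner_cubic.
  by transitivity ((a * b + b * c + c * a) - (a + b + c) + (1 - a * b * c));
    [ring | rewrite abc subrr addr0].
have d2 : \det ((-1)%:M - g) = - ((a * b + b * c + c * a) + (a + b + c) + 2).
  rewrite -horner_char_poly gE horner_cubic.
  by transitivity (- ((a * b + b * c + c * a) + (a + b + c) + 2) + (1 - a * b * c));
    [ring | rewrite abc subrr addr0].
have := conj_det_subr gS (conjC1 _) (mulr1 _).
have N11 : (-1 : CC R)^* = -1 by rewrite rmorphN1.
have := conj_det_subr gS N11; rewrite mulrNN mulr1 => /(_ erefl).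
rewrite d1 d2 mul1r mulN1r opprK.
set s := a + b + c; set t := a * b + b * c + c * a.
rewrite rmorphN rmorphB => /oppr_inj E1 E2.
have {}E1 : t^* + s^* + 2 = t + s + 2 by rewrite -[RHS]E1 !rmorphD /= ?rmorph1.
apply: (@mulfI _ 2); rewrite ?pnatr_eq0 //.
transitivity ((t + s + 2) - 2 - (- (t - s))); first by ring.
by rewrite -E1 -E2; ring.
Qed.

End Isometries.

Section Phase.
Context {R : realType}.
Variables (J : 'M[CC R]_3) (HJ : signature_ppm J).
Implicit Types (g k : 'M[CC R]_3) (x y z p u v w e : 'cV[CC R]_3).
Implicit Types (a b c mu nu : CC R).
Local Notation "<< x , y >>" := (form J x y).
Local Notation formC0 := (formC0 HJ).

(** Orthogonal nonpositive eigenvectors are collinear. Otherwise invariance of the form gives (r mu)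
    (s nu)^* = 1, so r s = 1 and mu = nu: the reciprocal moduli of a loxodromic isometry are
    absorbed by [r] and [s]. *)
Lemma phase_unique g mu nu : SU J g -> phase J g mu -> phase J g nu -> mu = nu.
Proof.
move=> gS [m1 [r [v [r0 v0 v_le gv]]]] [n1 [s [w [s0 w0 w_le gw]]]].
have norm_pos t a : 0 < t -> `|a| = 1 -> `|t * a| = t.
  by move=> t0 a1; rewrite normrM a1 mulr1 gtr0_norm.
have [vw|vw] := eqVneq <<v, w>> 0.
  have [k wE] := nonpositive_orthogonal HJ v0 v_le w_le vw.
  move: gw w0; rewrite wE -scalemxAr gv !scalerA scaler_eq0 negb_or => /eqP + /andP[k0 _].
  rewrite mulrC -subr_eq0 -scalerBl scaler_eq0 (negPf v0) orbF -mulrBl mulf_eq0 (negPf k0) orbF.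
  rewrite subr_eq0 => /eqP rs; have rsE : r = s.
    by rewrite -(norm_pos _ _ r0 m1) rs norm_pos.
  by move: rs; rewrite rsE; apply: mulfI; rewrite gt_eqF.
have /(canRL (mulfK vw)) := eigen_product gS gv gw; rewrite mulfV // => E.
have rs : r * s = 1.
  have := congr1 Num.norm E.
  by rewrite normrM norm_conjC !norm_pos // normr1.
move: E; rewrite rmorphM /= (CrealP (gtr0_real s0)) mulrACA rs mul1r.
by rewrite unit_inv_conj // => /(canRL (mulfVK (unit_neq0 n1))); rewrite mul1r.
Qed.

Lemma nonpositive_eigenvector_phase g a v : SU J g -> v != 0 -> <<v, v>> <= 0 ->
  g *m v = a *: v -> phase J g (a / `|a|).
Proof.
move=> gS v0 v_le gv; have a0 := eigen_neq0 gS gv v0.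
have na0 : `|a| != 0 by rewrite normr_eq0.
split; first by rewrite normf_div normr_id divff.
by exists `|a|, v; rewrite normr_gt0 mulrC divfK.
Qed.

Lemma unit_eigenvector_phase g a v : SU J g -> v != 0 -> <<v, v>> <= 0 ->
  `|a| = 1 -> g *m v = a *: v -> phase J g a.
Proof.
move=> gS v0 v_le a1 gv.
by have := nonpositive_eigenvector_phase gS v0 v_le gv; rewrite a1 divr1.
Qed.

Lemma negative_eigenvector_phase g a v : SU J g -> <<v, v>> < 0 ->
  g *m v = a *: v -> phase J g a.
Proof.
move=> gS v_lt gv; have v0 : <<v, v>> != 0 by rewrite lt_eqF.
apply: (unit_eigenvector_phase gS (form_neq0 v0) (ltW v_lt) _ gv).
exact: eigen_norm1 gS gv v0.
Qed.

(** If an eigenvector [x] is positive, its complement is invariant and contains negative vectors; a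
    second eigenvector is found there. If that one is positive too, the line orthogonal to both is
    negative and invariant. *)
Lemma phase_exists g : SU J g -> exists mu, phase J g mu.
Proof.
move=> gS; have [a [b [c gE]]] := char_poly_split g.
have [|x x0 gx] := @root_eigenvector _ g a; first by rewrite gE root_cubic eqxx.
case/orP: (form_le0Vgt0 HJ x) => [x_le|x_gt].
  by eexists; apply: nonpositive_eigenvector_phase x_le gx.
have [f ff _] := negative_orthogonal_positive HJ.
pose h t z := g *m z - t *: z.
have hx t z : <<z, x>> = 0 -> <<h t z, x>> = 0.
  by move=> zx; rewrite /h !formE zx (SU_preserves_orthogonal gS gx) // mulr0 subr0.
have hE z : h a (h b (h c z)) = 0.
  have hM t w : h t w = (g - t%:M) *m w by rewrite mulmxBl mul_scalar_mx.
  by rewrite !hM !mulmxA cubic_annihilates // mul0mx.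
have h0 t z : h t z = 0 -> g *m z = t *: z by move=> /eqP; rewrite subr_eq0 => /eqP.
pose u := reject J x f.
have u_lt : <<u, u>> < 0 by rewrite negative_reject // ff oppr_lt0 ltr01.
have ux : <<u, x>> = 0 by rewrite reject_orthogonal // gt_eqF.
(* The operators [h c], [h b], [h a] preserve the complement of [x] and their composite is 0, so the
   last nonzero vector met when applying them to [u] is an eigenvector. *)
have [y [t [y0 yx gy]]] : exists y t, [/\ y != 0, <<y, x>> = 0 & g *m y = t *: y].
  have [hc0|hc0] := eqVneq (h c u) 0.
    exists u, c; split=> //; last exact: h0.
    by apply: (@form_neq0 _ J); rewrite lt_eqF.
  have [hb0|hb0] := eqVneq (h b (h c u)) 0.
    by exists (h c u), b; split; [|exact: hx|exact: h0].
  by exists (h b (h c u)), a; split; [|exact/hx/hx|exact: h0].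
case/orP: (form_le0Vgt0 HJ y) => [y_le|y_gt].
  by eexists; apply: nonpositive_eigenvector_phase y_le gy.
have [e [e_lt ex ey span]] := positive_plane_complement HJ x_gt y_gt (formC0 yx).
have [k ge] : exists k : CC R, g *m e = k *: e.
  by apply: span; [apply: SU_preserves_orthogonal gx _ _ | apply: SU_preserves_orthogonal gy _ _].
by exists k; apply: negative_eigenvector_phase e_lt ge.
Qed.

Lemma phase_conj g k c mu : SU J g -> SU J k -> Omega c -> phase J g mu ->
  phase J (c *: (k *m g *m invmx k)) (c * mu).
Proof.
move=> gS kS c3 [m1 [r [v [r0 v0 v_le gv]]]].
have c1 : `|c| = 1.
  have /eqP := congr1 Num.norm c3; rewrite normrX normr1 => /eqP E.
  by apply/eqP; rewrite -(@pexpr_eq1 _ _ 3) // E.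
split; first by rewrite normrM c1 m1 mulr1.
have ku := SU_unit kS.
exists r, (k *m v); split => //.
- by apply: contraNneq v0 => kv; rewrite -[v](mulKmx ku) kv mulmx0.
- by rewrite SU_form.
rewrite -scalemxAl -!mulmxA mulKmx // gv -scalemxAr scalerA.
by rewrite mulrCA.
Qed.

Lemma eigenvector_isotropic g v a : <<v, v>> <= 0 -> g *m v = a *: v ->
  (forall p, <<p, p>> < 0 -> ~ fixes g p) -> <<v, v>> = 0.
Proof.
move=> v_le gv noneg; apply/eqP; apply: contraT => vv.
by case: (noneg v); [rewrite lt_neqAle vv | exists a].
Qed.

(* If a parabolic isometry fixes v, the eigenvalue of v is not simple:
   otherwise the component of a generic vector along it would be an eigenvector
   not orthogonal to v, and the two would span negative fixed points. *)
Lemma isotropic_eigenvalue_multiple g v a b c : SU J g ->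
  char_poly g = cubic a b c -> `|a| = 1 -> v != 0 -> <<v, v>> <= 0 ->
  g *m v = a *: v -> (forall p, <<p, p>> < 0 -> ~ fixes g p) -> a = b \/ a = c.
Proof.
move=> gS gE a1 v0 v_le gv noneg; have vv := eigenvector_isotropic v_le gv noneg.
have [->|ab] := eqVneq a b; first by left.
have [->|ac] := eqVneq a c; first by right.
have [f ff fpos] := negative_orthogonal_positive HJ.
have fv : <<f, v>> != 0.
  by apply: contraTneq isT => /formC0 /fpos /(_ v0); rewrite vv ltxx.
pose h t z := (g - t%:M) *m z.
have hv t z : <<h t z, v>> = (a - t) * <<z, v>>.
  rewrite /h mulmxBl mul_scalar_mx !formE mulrBl; congr (_ - _).
  apply: (@mulfI _ a^*); first by rewrite conjC_eq0 unit_neq0.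
  by rewrite -formZr -gv SU_form // mulrA -normCKC a1 expr1n mul1r.
pose y := h b (h c f).
have yv : <<y, v>> != 0 by rewrite !hv !mulf_neq0 // subr_eq0.
have gy : g *m y = a *: y.
  apply/eqP; rewrite -subr_eq0 -mul_scalar_mx -mulmxBl /y /h !mulmxA.
  by rewrite cubic_annihilates // mul0mx.
have [k k_lt] := isotropic_pair_negative HJ vv yv.
case: (noneg _ k_lt); exists a.
by rewrite mulmxDr -scalemxAr gv gy scalerDr !scalerA [k * a]mulrC.
Qed.

End Phase.

(** * Continuity of the phase *)

(* Stated for an abstract field: on [CC R] itself, unification wanders through
   the several topologies of [R[i]]. *)
Section ClosedFieldLimits.
Context {K : numClosedFieldType} {T : Type} {F : set_system T} {FF : Filter F}.
Implicit Types (f g : T -> K) (a b : K).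

Lemma limD f g a b : f @ F --> a -> g @ F --> b ->
  (fun x => f x + g x) @ F --> a + b.
Proof. by move=> fa gb; exact: cvgD. Qed.

Lemma limM f g a b : f @ F --> a -> g @ F --> b ->
  (fun x => f x * g x) @ F --> a * b.
Proof. by move=> fa gb; exact: cvgM. Qed.

Lemma limB f g a b : f @ F --> a -> g @ F --> b ->
  (fun x => f x - g x) @ F --> a - b.
Proof. by move=> fa gb; exact: cvgB. Qed.

Lemma lim_norm f a : f @ F --> a -> (fun x => `|f x|) @ F --> `|a|.
Proof. by move=> fa; exact: cvg_norm. Qed.

Lemma lim_conj f a : f @ F --> a -> (fun x => (f x)^*) @ F --> a^*.
Proof.
move=> fa; apply/cvgrPdist_lt => e e0; move/cvgrPdist_lt: fa => /(_ e e0).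
by apply: filterS => t; rewrite -rmorphB norm_conjC.
Qed.

Lemma limV f a : a != 0 -> f @ F --> a -> (fun t => (f t)^-1) @ F --> a^-1.
Proof. by move=> a0 fa; exact: cvgV. Qed.

Lemma lim_cst a : (fun _ : T => a) @ F --> a.
Proof. exact: cvg_cst. Qed.

Lemma lim_entry m n (i : 'I_m) (j : 'I_n) (f : T -> 'M[K]_(m, n))
  (A : 'M[K]_(m, n)) : f @ F --> A -> (fun t => f t i j) @ F --> A i j.
Proof. by move=> fa; exact: (cvg_comp _ _ fa (@coord_continuous K m n i j A)). Qed.

Lemma near_neq0 f a : f @ F --> a -> a != 0 -> \forall t \near F, f t != 0.
Proof.
move=> fa a0; move/cvgrPdist_lt: fa => /(_ `|a|); rewrite normr_gt0 => /(_ a0).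
by apply: filterS => t; apply: contraTneq => ->; rewrite subr0 ltxx.
Qed.

Lemma near_dist f a e : f @ F --> a -> 0 < e -> \forall t \near F, `|a - f t| < e.
Proof. by move=> fa e0; move/cvgrPdist_lt: fa; apply. Qed.

End ClosedFieldLimits.
Arguments lim_cst {K T F FF} a.

Lemma closedField_hausdorff (K : numClosedFieldType) : hausdorff_space K.
Proof. exact: norm_hausdorff. Qed.

Section PhaseContinuity.
Context {R : realType}.
Variables (J : 'M[CC R]_3) (HJ : signature_ppm J).
Implicit Types (v w : 'cV[CC R]_3).

Definition toCC (t : R) : CC R := t%:C%C.
Definition iCC : CC R := 'i%C.

Lemma toCC_continuous : continuous toCC.
Proof.
move=> x; apply/cvgrPdist_lt => e; case: e => a b.
rewrite ltcE /= => /andP[/eqP b0 a0].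
exists a => //= t /= xt; rewrite /toCC -rmorphB /= normc_def /= expr0n addr0 sqrtr_sqr.
by rewrite ltcE /= b0 eqxx.
Qed.

(** C^3 is read as R^6 to obtain a compact set of vectors that meets every complex line. The norm on
    R^6 is the maximum norm, so the sphere is the boundary of a cube. *)
Definition real_coords (u : 'rV[R]_(3 + 3)) : 'cV[CC R]_3 :=
  \col_i (toCC (u 0 (lshift 3 i)) + iCC * toCC (u 0 (rshift 3 i))).

Lemma real_coords_entry_continuous (i : 'I_3) (u : 'rV[R]_(3 + 3)) :
  (fun t => real_coords t i 0) @ u --> real_coords u i 0.
Proof.
under eq_fun do rewrite mxE.
rewrite mxE.
have cz j : (fun w : 'rV[R]_(3 + 3) => toCC (w 0 j)) @ u --> toCC (u 0 j).
  apply: (@continuous_comp _ _ _ (fun w : 'rV[R]_(3 + 3) => w 0 j) toCC).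
    exact: coord_continuous.
  exact: toCC_continuous.
exact: (limD (cz _) (limM (lim_cst iCC) (cz _))).
Qed.

Lemma real_coords_inj0 u : real_coords u = 0 -> u = 0.
Proof.
move=> u0; rewrite -[u]hsubmxK -[0]hsubmxK.
suff H i : u 0 (lshift 3 i) = 0 /\ u 0 (rshift 3 i) = 0.
  by congr row_mx; apply/matrixP => k i; rewrite !mxE !ord1; case: (H i).
have /eqP := congr1 (fun v : 'cV_3 => v i 0) u0; rewrite !mxE eq_complex /=.
by rewrite !mul0r !mul1r subr0 !addr0 !add0r => /andP[/eqP -> /eqP ->].
Qed.

Lemma real_coords_surj v : v != 0 -> exists2 u, `|u| = 1 &
  exists2 c : CC R, c != 0 & real_coords u = c *: v.
Proof.
move=> v0; pose u0 : 'rV[R]_(3 + 3) :=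
  row_mx (\row_i complex.Re (v i 0)) (\row_i complex.Im (v i 0)).
have uE : real_coords u0 = v.
  apply/matrixP => i k; rewrite ord1 mxE row_mxEl row_mxEr !mxE.
  by rewrite /toCC /iCC; case: (v i 0) => a b; simpc.
have n0 : `|u0| != 0.
  rewrite normr_eq0; apply: contraNneq v0 => u00; rewrite -uE u00.
  by apply/eqP/matrixP => i k; rewrite !mxE /toCC rmorph0 mulr0 addr0.
exists (`|u0|^-1 *: u0); first by rewrite normrZ normfV normr_id mulVf.
exists (toCC (`|u0|^-1)); first by rewrite /toCC fmorph_eq0 invr_eq0.
rewrite -uE; apply/matrixP => i k; rewrite !mxE /toCC !rmorphM /= mulrDr.
by rewrite [in RHS]mulrCA.
Qed.

Lemma sphere_compact : compact [set u : 'rV[R]_(3 + 3) | `|u| = 1].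
Proof.
apply: bounded_closed_compact.
  by exists 1; split=> // x x1 u /= ->; exact: ltW.
have -> : [set u : 'rV[R]_(3 + 3) | `|u| = 1] = Num.norm @^-1` [set 1] by [].
by apply: closed_comp => [? _|]; [exact: norm_continuous | exact: closed_eq].
Qed.

End PhaseContinuity.

Lemma lim_dist {K : numClosedFieldType} {T : Type} {F : set_system T}
  {FF : Filter F} (f : T -> K) (a : K) :
  (forall e, 0 < e -> \forall t \near F, `|a - f t| < e) -> f @ F --> a.
Proof. by move=> fa; apply/cvgrPdist_lt. Qed.

Section PhaseMap.
Context {R : realType}.
Variables (J : 'M[CC R]_3) (HJ : signature_ppm J).
Implicit Types (g : 'M[CC R]_3) (v w : 'cV[CC R]_3).
Local Notation "<< x , y >>" := (form J x y).

Lemma mul_col3 (g : 'M[CC R]_3) v i :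
  (g *m v) i 0 = g i 0 * v 0 0 + g i 1 * v 1 0 + g i 2%:R * v 2%:R 0.
Proof. by rewrite mxE sum3. Qed.

Lemma adj_mul v w : (adj v *m w) 0 0 =
  (v 0 0)^* * w 0 0 + (v 1 0)^* * w 1 0 + (v 2%:R 0)^* * w 2%:R 0.
Proof. by rewrite mxE sum3 !mxE. Qed.

(** With minors, failing to be an eigenvector becomes the nonvanishing of one continuous function,
    an open condition. *)
Lemma collinear v w : v != 0 ->
  (forall i k, w i 0 * v k 0 - w k 0 * v i 0 = 0) -> exists a : CC R, w = a *: v.
Proof.
move=> v0 E; have [k vk] : exists k, v k 0 != 0.
  apply: contrapT => /forallNP v00; case/eqP: v0; apply/matrixP => i j.
  by rewrite ord1 mxE; apply/eqP; apply: contraT => /v00.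
exists (w k 0 / v k 0); apply/matrixP => i j; rewrite ord1 mxE.
apply: (mulIf vk); rewrite mulrAC divfK //.
by apply/eqP; rewrite -subr_eq0 E.
Qed.

Lemma adj_self_gt0 v : v != 0 -> 0 < (adj v *m v) 0 0.
Proof.
move=> v0; have [k vk] : exists k, v k 0 != 0.
  apply: contrapT => /forallNP v00; case/eqP: v0; apply/matrixP => i j.
  by rewrite ord1 mxE; apply/eqP; apply: contraT => /v00.
have ge0 i : 0 <= (adj v) 0 i * v i 0 by rewrite !mxE -normCKC exprn_ge0.
rewrite mxE (bigD1 k) //= ltr_wpDr ?sumr_ge0 //.
by rewrite !mxE -normCKC exprn_gt0 // normr_gt0.
Qed.

(** Near each vector [v] of the sphere one of three facts settles the claim: [v] is positive, [v] is
    not an eigenvector of [g0], or the phase is read off continuously from the Rayleigh quotient.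
    Compactness then leaves a neighbourhood of [g0] alone. *)
Lemma phase_near g0 mu0 (e : CC R) : SU J g0 -> phase J g0 mu0 -> 0 < e ->
  \forall g \near g0, SU J g -> forall mu, phase J g mu -> `|mu0 - mu| < e.
Proof.
move=> gS0 ph0 e0.
pose P g (u : 'rV[R]_(3 + 3)) := SU J g ->
  <<real_coords u, real_coords u>> <= 0 -> forall a, g *m real_coords u = a *: real_coords u ->
  `|mu0 - a / `|a| | < e.
suff : \forall g \near g0, [set u | `|u| = 1] `<=` P g.
  apply: filterS => g gP gS mu [m1 [r [v [r0 v0 v_le gv]]]].
  have [u u1 [c c0 uE]] := real_coords_surj v0.
  have aE : r * mu / `|r * mu| = mu.
    rewrite normrM m1 mulr1 (gtr0_norm r0) mulrAC mulfV ?mul1r //.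
    by rewrite gt_eqF.
  have := gP u u1 gS; rewrite uE !formE mulrA -normCK => /(_ _ (r * mu)).
  rewrite aE; apply; first by rewrite mulr_ge0_le0 // exprn_ge0.
  by rewrite -scalemxAr gv !scalerA mulrC.
(* The tube lemma: neighbourhoods of the pairs (u, g0) suffice. *)
have cover := (compact_near_coveringP _).1 (@sphere_compact R).
apply: (cover _ (nbhs g0) P) => u u1.
set v := real_coords u.
have v0 : v != 0.
  apply/eqP => /real_coords_inj0 u0; move: u1; rewrite /= u0 normr0 => /eqP.
  by rewrite eq_sym oner_eq0.
have FF : Filter (filter_prod (nbhs u) (nbhs g0)) by exact: filter_prod_filter.
have vlim i : (fun z : 'rV[R]_(3 + 3) * 'M[CC R]_3 => real_coords z.1 i 0) @
    filter_prod (nbhs u) (nbhs g0) --> v i 0.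
  exact: (cvg_comp _ _ cvg_fst (@real_coords_entry_continuous R i u)).
have glim i j : (fun z : 'rV[R]_(3 + 3) * 'M[CC R]_3 => z.2 i j) @
    filter_prod (nbhs u) (nbhs g0) --> g0 i j.
  exact: (lim_entry cvg_snd).
have gvlim i : (fun z : 'rV[R]_(3 + 3) * 'M[CC R]_3 => (z.2 *m real_coords z.1) i 0) @
    filter_prod (nbhs u) (nbhs g0) --> (g0 *m v) i 0.
  under eq_fun do rewrite mul_col3.
  rewrite mul_col3.
  by apply: limD; [apply: limD|]; apply: limM.
have Jvlim i : (fun z : 'rV[R]_(3 + 3) * 'M[CC R]_3 => (J *m real_coords z.1) i 0) @
    filter_prod (nbhs u) (nbhs g0) --> (J *m v) i 0.
  under eq_fun do rewrite mul_col3.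
  rewrite mul_col3.
  by apply: limD; [apply: limD|]; apply: limM => //; exact: lim_cst.
have clim i := lim_conj (FF := FF) (vlim i).
have flim : (fun z : 'rV[R]_(3 + 3) * 'M[CC R]_3 => <<real_coords z.1, real_coords z.1>>) @
    filter_prod (nbhs u) (nbhs g0) --> <<v, v>>.
  under eq_fun do rewrite /form -mulmxA adj_mul.
  rewrite /form -mulmxA adj_mul.
  exact: (limD (FF := FF) (limD (FF := FF) (limM (FF := FF) (clim 0) (Jvlim 0))
    (limM (FF := FF) (clim 1) (Jvlim 1))) (limM (FF := FF) (clim 2%:R) (Jvlim 2%:R))).
have [v_le|v_gt] := orP (form_le0Vgt0 HJ v); last first.
  (* The function x + |x| vanishes for x <= 0 but not at the positive number <<v, v>>, so nearby
     squares are not nonpositive. *)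
  have l := limD (FF := FF) flim (lim_norm (FF := FF) flim).
  have n0 : <<v, v>> + `|<<v, v>>| != 0 by rewrite gtr0_norm // gt_eqF // addr_gt0.
  have := near_neq0 (FF := FF) l n0.
  by apply: filterS => z /= + _ z_le; rewrite ler0_norm // subrr eqxx.
have [[a ga]|] := pselect (exists a, g0 *m v = a *: v); last first.
  move=> na; have [i [k ik]] : exists i k, (g0 *m v) i 0 * v k 0 - (g0 *m v) k 0 * v i 0 != 0.
    apply: contrapT => nik; apply: na; apply: collinear => // i k.
    by apply/eqP; apply: contraT => n; case: nik; exists i, k.
  have := near_neq0 (FF := FF) (limB (FF := FF) (limM (FF := FF) (gvlim i) (vlim k))
    (limM (FF := FF) (gvlim k) (vlim i))) ik.
  apply: filterS => z /= + _ _ b gb; rewrite gb !mxE.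
  by rewrite mulrAC subrr eqxx.
have qlim : (fun z : 'rV[R]_(3 + 3) * 'M[CC R]_3 =>
    (adj (real_coords z.1) *m (z.2 *m real_coords z.1)) 0 0) @
    filter_prod (nbhs u) (nbhs g0) --> (adj v *m (g0 *m v)) 0 0.
  under eq_fun do rewrite adj_mul.
  rewrite adj_mul.
  exact: (limD (FF := FF) (limD (FF := FF) (limM (FF := FF) (clim 0) (gvlim 0))
    (limM (FF := FF) (clim 1) (gvlim 1))) (limM (FF := FF) (clim 2%:R) (gvlim 2%:R))).
have a0 := eigen_neq0 gS0 ga v0.
have q0 : (adj v *m (g0 *m v)) 0 0 != 0.
  by rewrite ga -scalemxAr mxE mulf_neq0 // gt_eqF // adj_self_gt0.
(* The standard Hermitian product of an eigenvector with its image is a positive multiple of the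
   eigenvalue, and it is continuous without any choice of eigenvalue. *)
have quot b w : w != 0 -> (adj w *m (b *: w)) 0 0 / `|(adj w *m (b *: w)) 0 0| = b / `|b|.
  move=> w0; have w_gt := adj_self_gt0 w0.
  rewrite -scalemxAr mxE normrM (gtr0_norm w_gt) invfM mulrACA mulfV ?mulr1 //.
  by rewrite gt_eqF.
have nq0 : `|(adj v *m (g0 *m v)) 0 0| != 0 by rewrite normr_eq0.
have muE : mu0 = (adj v *m (g0 *m v)) 0 0 / `|(adj v *m (g0 *m v)) 0 0|.
  rewrite ga quot //; apply: (phase_unique HJ gS0) => //.
  exact: nonpositive_eigenvector_phase v_le ga.
have l := limM (FF := FF) qlim (limV (FF := FF) nq0 (lim_norm (FF := FF) qlim)).
have := near_dist (FF := FF) l e0.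
have := near_neq0 (FF := FF) qlim q0; apply: filterS2 => z zq0 + _ _ b gb.
rewrite -muE gb quot //.
apply: contraNneq zq0 => ->.
by rewrite mulmx0 mulmx0 mxE.
Qed.

Definition phase_of (g : SU J) : CC R :=
  projT1 (cid (phase_exists HJ (set_mem (valP g)))).

Lemma phase_ofP (g : SU J) : phase J (val g) (phase_of g).
Proof. exact: projT2 (cid (phase_exists HJ (set_mem (valP g)))). Qed.

Lemma phase_of_continuous : continuous phase_of.
Proof.
move=> g0; apply: (lim_dist (FF := nbhs_filter g0)) => e e0.
have gS0 := set_mem (valP g0).
have := phase_near gS0 (phase_ofP g0) e0.
have vc : (val : SU J -> 'M[CC R]_3) @ g0 --> val g0 by exact: initial_continuous.
move=> /vc; apply: (@filterS _ _ (nbhs_filter g0)) => g /= Hg.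
apply: Hg; first exact: set_mem (valP g).
exact: phase_ofP.
Qed.

(** Through [repr], [f] descends to a function on classes; invariance makes it agree with [f] on
    every lift, and the quotient topology makes it continuous. Such a function takes equal values on
    classes that [rho] identifies. *)
Lemma conjugation_invariant_rho (Y : topologicalType) (f : SU J -> Y) :
  hausdorff_space Y -> continuous f ->
  (forall g h : SU J, conjugate g h -> f g = f h) ->
  forall g h : SU J, rho (class_of g) = rho (class_of h) -> f g = f h.
Proof.
move=> hY fc fconj g h /rho_eqP gh.
pose F (c : classes_space J) := f (repr c).
have FE k : F (class_of k) = f k.
  rewrite /F; apply: fconj; apply/asboolP.
  by apply/(@eqmodP _ (conjugate_equiv J)); rewrite reprK.
rewrite -!FE; apply: gh => //.
apply/quotient_continuous => k.
rewrite (_ : F \o _ = f); first exact: fc.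
by apply/funext => l; exact: FE.
Qed.

(** Conjugation in PU(2,1) multiplies phase and trace by the same cube root of unity, which
    disappears from both expressions. *)
Lemma rho_invariants (g h : SU J) : rho (class_of g) = rho (class_of h) ->
  phase_of g ^+ 3 = phase_of h ^+ 3 /\
  \tr (val g) * (phase_of g)^* = \tr (val h) * (phase_of h)^*.
Proof.
have Omega1 c : Omega c -> c * c^* = 1.
  move=> c3; rewrite -normCK; have /eqP := congr1 Num.norm c3.
  by rewrite normrX normr1 (@pexpr_eq1 _ _ 3) // => /eqP ->; rewrite expr1n.
have conjP (k l : SU J) : conjugate k l -> exists2 c, Omega c &
    phase_of l = c * phase_of k /\ \tr (val l) = c * \tr (val k).
  move=> [m [c c3 lE]]; exists c => //.
  have [kS mS] := (set_mem (valP k), set_mem (valP m)).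
  split; last by rewrite lE linearZ /= mxtrace_mulC mulmxA mulVmx ?mul1mx ?(SU_unit mS).
  apply: (phase_unique HJ (set_mem (valP l))); first exact: phase_ofP.
  by rewrite lE; apply: phase_conj => //; exact: phase_ofP.
move=> gh; split.
  apply: (conjugation_invariant_rho (f := fun k => phase_of k ^+ 3)) gh.
  - exact: closedField_hausdorff.
  - move=> k; pose FF := nbhs_filter k; have pc := @phase_of_continuous k.
    exact: (limM (FF := FF) pc (limM (FF := FF) pc pc)).
  - by move=> k l /conjP[c c3 [-> _]]; rewrite exprMn c3 mul1r.
apply: (conjugation_invariant_rho (f := fun k => \tr (val k) * (phase_of k)^*)) gh.
- exact: closedField_hausdorff.
- move=> k; pose FF := nbhs_filter k; have pc := @phase_of_continuous k.
  apply: (limM (FF := FF)); last exact: (lim_conj (FF := FF) pc).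
  under eq_fun do rewrite /mxtrace sum3.
  rewrite /mxtrace sum3.
  have vc : (val : SU J -> 'M[CC R]_3) @ k --> val k by exact: initial_continuous.
  by apply: (limD (FF := FF)); [apply: (limD (FF := FF))|]; exact: lim_entry vc.
- move=> k l /conjP[c c3 [-> ->]].
  by rewrite rmorphM mulrACA Omega1 // mul1r.
Qed.

End PhaseMap.

(** * Angles *)

(* The data (tr g / mu, mu^3), through which g |-> rho (class_of g) determines
   the angles: mu = phase of g, and the eigenvalues are mu, mu e^{i s1},
   mu e^{i s2}. *)
Definition has_angles {R : realType} (J g : 'M[CC R]_3) (s : R * R) : Prop :=
  exists mu, [/\ phase J g mu, \tr g = mu * (1 + expi s.1 + expi s.2) &
    mu ^+ 3 * expi (s.1 + s.2) = 1].

Lemma square_dvd_cubic {F : closedFieldType} (a A B C : F) :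
  ('X - a%:P) ^+ 2 %| cubic A B C -> exists b, cubic A B C = cubic a a b.
Proof.
have main B' C' : ('X - a%:P) ^+ 2 %| cubic a B' C' -> exists b, cubic a B' C' = cubic a a b.
  rewrite /cubic expr2 -mulrA dvdp_mul2l ?polyXsubC_eq0 // dvdp_XsubCl rootM !root_XsubC.
  by case/orP => /eqP <-; [exists C'; rewrite mulrA | exists B'; rewrite mulrAC mulrA].
move=> dv; have : root (cubic A B C) a.
  by rewrite -dvdp_XsubCl; apply: dvdp_trans dv; rewrite expr2 dvdp_mulr.
rewrite root_cubic => /or3P[] /eqP E; move: dv; rewrite -E.
- exact: main.
- by rewrite (_ : cubic A a C = cubic a A C); [exact: main | rewrite /cubic; ring].
- by rewrite (_ : cubic A B a = cubic a A B); [exact: main | rewrite /cubic; ring].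
Qed.

Section HasAngles.
Context {R : realType}.
Variables (J : 'M[CC R]_3) (HJ : signature_ppm J).
Implicit Types (g : 'M[CC R]_3) (x y p v e : 'cV[CC R]_3).
Implicit Types (a b c mu nu : CC R) (s t : R * R).
Local Notation "<< x , y >>" := (form J x y).

(** Trace and determinant give the sum and the product of the two exponentials, hence the unordered
    pair. *)
Lemma has_angles_same g s t : SU J g -> has_angles J g s -> has_angles J g t ->
  same_angles s t.
Proof.
move=> gS [mu [ph tr1 d1]] [nu [ph' tr2 d2]].
move: tr2 d2; rewrite -(phase_unique HJ gS ph ph') => tr2 d2.
have mu0 := unit_neq0 ph.1.
apply: unit_sum_prod_inj.
  by apply: (addrI 1); apply: (mulfI mu0); rewrite !addrA -tr1 -tr2.
by rewrite -!expiD; apply: (mulfI (expf_neq0 3 mu0)); rewrite d1 d2.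
Qed.

Lemma same_angles_has_angles g s t : same_angles s t -> has_angles J g s ->
  has_angles J g t.
Proof.
move=> st [mu [ph tr1 d1]]; exists mu; split=> //.
  by rewrite tr1; case: st => -[-> ->] //; rewrite addrAC.
by rewrite -d1 !expiD; case: st => -[-> ->] //; rewrite [expi t.1 * _]mulrC.
Qed.

(** [has_angles] depends on the isometry only through the two invariants of [rho_invariants]. *)
Lemma rho_has_angles (g h : SU J) s : rho (class_of g) = rho (class_of h) ->
  has_angles J (val g) s -> has_angles J (val h) s.
Proof.
move=> gh [mu [ph tr1 d1]]; have [c3 trE] := rho_invariants HJ gh.
have muE := phase_unique HJ (set_mem (valP g)) (phase_ofP HJ g) ph.
have phh := phase_ofP HJ h; set nu := phase_of HJ h in phh c3 trE *.
exists nu; split=> //; last by rewrite -c3 muE.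
have nuK : nu^* * nu = 1 by rewrite -normCKC phh.1 expr1n.
have muK : mu * mu^* = 1 by rewrite -normCK ph.1 expr1n.
have -> : \tr (val h) = \tr (val h) * nu^* * nu by rewrite -mulrA nuK mulr1.
by rewrite -trE muE tr1 [_ * _ * mu^*]mulrAC muK mul1r mulrC.
Qed.

Lemma negative_vector : exists e, <<e, e>> < 0.
Proof.
have [e ee _] := negative_orthogonal_positive HJ.
by exists e; rewrite ee oppr_lt0 ltr01.
Qed.

Lemma identical_fixes g p : identical g -> fixes g p.
Proof. by move=> [c _ ->]; exists c; rewrite mul_scalar_mx. Qed.

Lemma parabolic_no_negative g p : parabolic J g -> <<p, p>> < 0 -> ~ fixes g p.
Proof. by move=> [ni ne _] p_lt gp; apply: ne; split=> //; exists p. Qed.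

Lemma unit_root a r mu : 0 < r -> `|mu| = 1 -> `|a| = 1 -> r * mu = a -> mu = a.
Proof.
move=> r0 m1 a1 E; have := congr1 Num.norm E.
by rewrite normrM m1 a1 mulr1 gtr0_norm // => r1; rewrite -E r1 mul1r.
Qed.

Lemma Omega_norm1 c : Omega c -> `|c| = 1.
Proof.
move=> c3; have /eqP := congr1 Num.norm c3.
by rewrite normrX normr1 (@pexpr_eq1 _ _ 3) // => /eqP.
Qed.

(** Every eigenvalue a satisfies (c a - 1)^n = 0, so all of them, and the phase, equal the inverse
    of [c]. *)
Lemma unipotent_angles g : SU J g -> unipotent J g -> has_angles J g (0, 0).
Proof.
move=> gS [_ [c c3 [n nil]]]; have c0 := unit_neq0 (Omega_norm1 c3).
have eig a x : x != 0 -> g *m x = a *: x -> a = c^-1.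
  move=> x0 gx; have E : (c *: g - 1%:M) *m x = (c * a - 1) *: x.
    by rewrite mulmxBl -scalemxAl gx mul1mx scalerA scalerBl scale1r.
  have En m : (c *: g - 1%:M) ^+ m *m x = (c * a - 1) ^+ m *: x.
    elim: m => [|m IH]; first by rewrite !expr0 mul1mx scale1r.
    by rewrite exprS -mulmxE -mulmxA IH -scalemxAr E scalerA exprSr.
  have := En n; rewrite nil mul0mx => /esym/eqP.
  rewrite scaler_eq0 (negPf x0) orbF expf_eq0 => /andP[_].
  by rewrite subr_eq0 => /eqP ca; apply: (mulfI c0); rewrite ca mulfV.
have [mu [m1 [r [v [r0 v0 v_le gv]]]]] := phase_exists HJ gS.
have muE : mu = c^-1.
  by apply: unit_root r0 m1 _ (eig _ _ v0 gv) => //; rewrite normfV Omega_norm1 ?invr1.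
have [a1 [a2 [a3 gE]]] := char_poly_split g.
have ev a : [|| a == a1, a == a2 | a == a3] -> a = mu.
  rewrite -root_cubic -gE => /root_eigenvector[x x0 gx].
  by rewrite muE; exact: eig gx.
exists mu; split; first by split=> //; exists r, v.
  rewrite (char_poly_cubic_trace gE) /= expi0 (ev a1) ?eqxx // (ev a2) ?eqxx ?orbT //.
  by rewrite (ev a3) ?eqxx ?orbT // !mulrDr mulr1.
by rewrite addr0 expi0 mulr1 muE exprVn c3 invr1.
Qed.

Lemma angle_pair_has_angles g t : SU J g -> angle_pair J g t -> has_angles J g t.
Proof.
move=> gS [[gell [p [mu [p_lt gp gE]]]]|[[c c3 gE] ->]|[[par nu] [th [dv ->]]]|[uni ->]].
- have {}gE : char_poly g = cubic mu (mu * expi t.1) (mu * expi t.2) by [].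
  exists mu; split; first exact: negative_eigenvector_phase gS p_lt gp.
    by rewrite (char_poly_cubic_trace gE) !mulrDr mulr1.
  by rewrite -(SU_det gS) (char_poly_cubic_det gE) expiD !exprS expr0; ring.
- have [e e_lt] := negative_vector.
  exists c; split.
  + by apply: negative_eigenvector_phase gS e_lt _; rewrite gE mul_scalar_mx.
  + by rewrite gE mxtrace_scalar /= expi0 -mulr_natr; congr (_ * _); ring.
  + by rewrite addr0 expi0 mulr1.
- have [A [B [C gE]]] := char_poly_split g.
  have [b bE] : exists b, char_poly g = cubic (expi th) (expi th) b.
    by move: dv; rewrite gE => /square_dvd_cubic.
  set a := expi th in bE.
  have a1 : `|a| = 1 by exact: norm_expi.
  have a0 := unit_neq0 a1.
  have aab : a * a * b = 1 by rewrite -(char_poly_cubic_det bE) (SU_det gS).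
  have bV : b = (a * a)^-1 by apply: (mulfI (mulf_neq0 a0 a0)); rewrite aab mulfV // mulf_neq0.
  have b1 : `|b| = 1 by rewrite bV normfV normrM a1 mulr1 invr1.
  have [mu [m1 [r [v [r0 v0 v_le gv]]]]] := phase_exists HJ gS.
  have ph : phase J g mu by split=> //; exists r, v.
  (* If the phase were the root [b], it would be a multiple root by [isotropic_eigenvalue_multiple],
     hence equal to [a] anyway. *)
  have muE : mu = a.
    have := eigenvector_root v0 gv; rewrite bE root_cubic orbA orbb => /orP[] /eqP E.
      exact: unit_root r0 m1 a1 E.
    have muE := unit_root r0 m1 b1 E.
    have bE' : char_poly g = cubic b a a by rewrite bE /cubic; ring.
    rewrite muE; have := isotropic_eigenvalue_multiple HJ gS bE' b1 v0 v_le.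
    rewrite -E => /(_ gv) []//= p p_lt; exact: parabolic_no_negative par p_lt.
  have e3 : expi (- 3 * th) = (a * a * a)^-1.
    by rewrite mulNr expiN; congr (_ ^-1); rewrite /a -!expiD; congr expi; ring.
  exists mu; rewrite /= addr0 expi0 e3 muE; split; first by rewrite -muE.
    by rewrite (char_poly_cubic_trace bE) bV; field.
  by field.
- exact: unipotent_angles.
Qed.

(** Trace and determinant fix the polynomial by [SU_char_poly]. Its roots then have modulus 1, which
    forces the radius [r] of the phase to be 1; loxodromic isometries have no angles. *)
Lemma has_angles_char_poly g s : SU J g -> has_angles J g s -> exists mu,
  [/\ phase J g mu, char_poly g = cubic mu (mu * expi s.1) (mu * expi s.2) &
      exists v, [/\ v != 0, <<v, v>> <= 0 & g *m v = mu *: v]].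
Proof.
move=> gS [mu [ph trE dE]]; exists mu.
have [m1 [r [v [r0 v0 v_le gv]]]] := ph.
have [a [b [c gE]]] := char_poly_split g.
have m0 := unit_neq0 m1.
have [e1 e2] : `|expi s.1 : CC R| = 1 /\ `|expi s.2 : CC R| = 1 by rewrite !norm_expi.
have [e10 e20] := (unit_neq0 e1, unit_neq0 e2).
have dE' : mu * (mu * expi s.1) * (mu * expi s.2) = 1 by rewrite -dE expiD; ring.
have gE' : char_poly g = cubic mu (mu * expi s.1) (mu * expi s.2).
  rewrite gE; apply: eq_cubic.
  - by rewrite -(char_poly_cubic_trace gE) trE; ring.
  - rewrite (SU_char_poly HJ gS gE) -(char_poly_cubic_trace gE) trE.
    rewrite rmorphM !rmorphD /= rmorph1 !unit_inv_conj //.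
    rewrite -[LHS]mul1r -[X in X * _]dE'; by field; rewrite m0 e10 e20.
  - by rewrite -(char_poly_cubic_det gE) (SU_det gS).
split=> //; exists v; split=> //.
rewrite gv; congr (_ *: _).
have := eigenvector_root v0 gv; rewrite gE' root_cubic => E.
have nE : `|r * mu| = 1 by case/or3P: E => /eqP ->; rewrite ?normrM ?m1 ?e1 ?e2 ?mulr1.
by rewrite [RHS](unit_root r0 m1 nE erefl).
Qed.

(** Two nonorthogonal isotropic eigenvectors would share their unit eigenvalue, and their span,
    which contains negative vectors, would be fixed pointwise. Orthogonal ones are collinear. *)
Lemma parabolic_of_angles g s : SU J g -> has_angles J g s ->
  (forall p, <<p, p>> < 0 -> ~ fixes g p) -> parabolic J g.
Proof.
move=> gS /(has_angles_char_poly gS)[mu [ph gE [v [v0 v_le gv]]]] noneg.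
have vv := eigenvector_isotropic v_le gv noneg.
split.
- by have [e e_lt] := negative_vector => /identical_fixes gi; apply: (noneg e).
- by move=> [_ [p p_lt gp]]; exact: (noneg p).
exists v; split=> //; first by exists mu.
move=> x [x0 xx] [nu gx]; have [xv|xv] := eqVneq <<v, x>> 0.
  by apply: nonpositive_orthogonal xv => //; rewrite xx.
have [c c_lt] := isotropic_pair_negative HJ xx xv.
case: (noneg _ c_lt); exists mu; rewrite mulmxDr -scalemxAr gv gx.
have := eigen_product gS gv gx => /(canRL (mulfK xv)); rewrite mulfV // => E.
have -> : nu = mu.
  have m0 := unit_neq0 ph.1.
  suff nuc : nu^* = mu^* by rewrite -[nu]conjCK nuc conjCK.
  by rewrite (unit_inv_conj ph.1); apply: (mulfI m0); rewrite E mulfV.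
by rewrite scalerDr !scalerA mulrC.
Qed.

(** The pair [t] may differ from [s], because [angle_pair] imposes a normal form on nonelliptic
    isometries; [has_angles_same] later identifies the two as unordered pairs mod 2 pi. *)
Lemma has_angles_angle_pair g s : SU J g -> has_angles J g s ->
  elliptic_or_boundary J g /\ exists t, angle_pair J g t.
Proof.
move=> gS gs; have [mu [ph gE [v [v0 v_le gv]]]] := has_angles_char_poly gS gs.
have [gi|ngi] := pselect (identical g).
  by split; [constructor 1 | exists (0, 0); constructor 2].
have [[p [p_lt gp]]|noneg] := pselect (exists p, <<p, p>> < 0 /\ fixes g p).
  have ell : elliptic J g by split=> //; exists p.
  split; first by constructor 2.
  exists s; constructor 1; split=> //; case: gp => nu gp; exists p, mu; split=> //.
  by rewrite -(phase_unique HJ gS (negative_eigenvector_phase gS p_lt gp) ph).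
have {}noneg p : <<p, p>> < 0 -> ~ fixes g p by move=> ? ?; apply: noneg; exists p.
have par := parabolic_of_angles gS gs noneg.
split; first by constructor 3.
have [uni|nuni] := pselect (unipotent J g).
  by exists (0, 0); constructor 4.
have [th _ thE] := expi_surj ph.1.
exists (- 3 * th, 0); constructor 3; split=> //; exists th; split=> //.
rewrite -thE gE.
have [E|E] := isotropic_eigenvalue_multiple HJ gS gE ph.1 v0 v_le gv noneg; rewrite -E /cubic expr2.
  exact: dvdp_mulr.
by rewrite mulrAC dvdp_mulr.
Qed.

End HasAngles.

(** * Complex reflections and pairs of centers *)

(** One block matrix is factored in two ways into block triangular ones; compare determinants. *)
Lemma det_rank1 (K : comUnitRingType) n (u : 'cV[K]_n) (v : 'rV[K]_n) :
  \det (1%:M + u *m v) = 1 + (v *m u) 0 0.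
Proof.
pose L := block_mx 1%:M 0 u 1%:M : 'M[K]_(1 + n).
have dL : \det L = 1 by rewrite det_lblock !det1 mulr1.
have E1 : L *m block_mx 1%:M (- v) 0 (1%:M + u *m v) = block_mx 1%:M (- v) u 1%:M.
  rewrite mulmx_block !mul1mx ?mul0mx ?mulmx0 ?mulmx1 ?addr0 ?add0r mulmxN.
  by rewrite addrCA addNr addr0.
have E2 : block_mx (1%:M + v *m u) (- v) 0 1%:M *m L = block_mx 1%:M (- v) u 1%:M.
  rewrite mulmx_block !mul1mx ?mul0mx ?mulmx0 ?mulmx1 ?addr0 ?add0r mulNmx addrK.
  by [].
have := congr1 determinant E1; rewrite -E2 !det_mulmx dL mulr1 mul1r.
rewrite !det_ublock !det1 mulr1 mul1r => ->.
by rewrite (mx11_scalar (1%:M + _)) det_scalar1 !mxE.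
Qed.

Lemma reflection_form_identity (F : fieldType) (a g xp py xy : F) : a != 0 -> g != 0 ->
  (a ^- 2 - a) * (xp / g) * ((a ^+ 2 - a^-1) * (py / g) * g) +
  a^-1 * ((a ^- 2 - a) * (xp / g) * py) +
  a * ((a ^+ 2 - a^-1) * (py / g) * xp + a^-1 * xy) = xy.
Proof. by move=> a0 g0; field; rewrite a0 g0. Qed.

Section Reflections.
Context {R : realType}.
Variables (J : 'M[CC R]_3) (HJ : signature_ppm J).
Implicit Types (g k : 'M[CC R]_3) (x y z p m : 'cV[CC R]_3).
Implicit Types (a b c alpha : CC R).
Local Notation "<< x , y >>" := (form J x y).
Local Notation formC := (formC HJ).

Lemma reflection_center alpha p : <<p, p>> != 0 ->
  complex_reflection J alpha p *m p = alpha ^- 2 *: p.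
Proof. by move=> p0; rewrite complex_reflectionE mulfV // mulr1 -scalerDl subrK. Qed.

Lemma reflection_orthogonal alpha p x : <<x, p>> = 0 ->
  complex_reflection J alpha p *m x = alpha *: x.
Proof. by move=> xp; rewrite complex_reflectionE xp mul0r mulr0 scale0r add0r. Qed.

Lemma reflection_det alpha p : alpha != 0 -> <<p, p>> != 0 ->
  \det (complex_reflection J alpha p) = 1.
Proof.
move=> a0 p0; have -> : complex_reflection J alpha p = alpha *:
    (1%:M + (((alpha ^- 2 - alpha) / <<p, p>> / alpha) *: p) *m (adj p *m J)).
  rewrite scalerDr scalemx1 addrC -scalemxAl scalerA mulrCA mulfV // mulr1.
  by rewrite mulmxA.
rewrite detZ det_rank1 -scalemxAr mxE -/(form J p p).
by field; rewrite p0 a0.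
Qed.

Lemma reflection_SU alpha p : `|alpha| = 1 -> <<p, p>> != 0 ->
  SU J (complex_reflection J alpha p).
Proof.
move=> a1 p0; have a0 := unit_neq0 a1; split; last exact: reflection_det.
move=> x y; rewrite !complex_reflectionE !formE.
have pp : <<p, p>>^* = <<p, p>> by rewrite -formC.
rewrite !rmorphM rmorphB fmorphV /= fmorphV /= rmorphXn /= pp unit_inv_conj // -(formC y p).
by rewrite exprVn invrK; exact: reflection_form_identity.
Qed.

Lemma reflectionZ alpha p c : c != 0 ->
  complex_reflection J alpha (c *: p) = complex_reflection J alpha p.
Proof.
move=> c0; rewrite /complex_reflection !formE adjZ -!scalemxAl -scalemxAr -scalemxAl.
rewrite !scalerA; congr (_ *: _ + _); have cc0 : c^* != 0 by rewrite conjC_eq0.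
have [p0|p0] := eqVneq <<p, p>> 0; first by rewrite p0 !mulr0 invr0 !(mulr0, mul0r).
by move: (alpha ^- 2 - alpha) => b; field; rewrite p0 cc0 c0.
Qed.

Lemma reflection_conj alpha p k : SU J k ->
  k *m complex_reflection J alpha p *m invmx k = complex_reflection J alpha (k *m p).
Proof.
move=> kS; have ku := SU_unit kS.
rewrite /complex_reflection SU_form // mulmxDr mulmxDl mul_mx_scalar.
rewrite -scalemxAl mulmxV // scalemx1; congr (_ + _).
rewrite -scalemxAr -scalemxAl; congr (_ *: _).
rewrite adjM -!mulmxA; congr (_ *m (_ *m (_ *m _))).
by rewrite -[RHS](mulmxK ku) SU_gram.
Qed.

Definition tau p1 p2 : CC R := <<p1, p2>> * <<p2, p1>> / (<<p1, p1>> * <<p2, p2>>).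

(** A reflection is a scalar plus a multiple of p p^* J; the traces of these rank one matrices and
    of their product are products of Gram entries. *)
Lemma product_trace alpha1 alpha2 p1 p2 : <<p1, p1>> != 0 -> <<p2, p2>> != 0 ->
  let beta1 := alpha1 ^- 2 - alpha1 in let beta2 := alpha2 ^- 2 - alpha2 in
  \tr (complex_reflection J alpha2 p2 *m complex_reflection J alpha1 p1) =
  beta1 * beta2 * tau p1 p2 + beta1 * alpha2 + beta2 * alpha1 + 3 * (alpha1 * alpha2).
Proof.
move=> p10 p20 beta1 beta2; rewrite /complex_reflection -/beta1 -/beta2.
have trp p : \tr (p *m adj p *m J) = <<p, p>>.
  by rewrite -mulmxA mxtrace_mulC (mx11_scalar (adj p *m J *m p)) mxtrace_scalar mulr1n.
have trpp : \tr (p2 *m adj p2 *m J *m (p1 *m adj p1 *m J)) = <<p1, p2>> * <<p2, p1>>.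
  rewrite -2!mulmxA mxtrace_mulC !mulmxA (mx11_scalar (adj p2 *m J *m p1)) -/(form J p1 p2).
  rewrite -!mulmxA mul_scalar_mx mxtraceZ mulmxA
    (mx11_scalar (adj p1 *m J *m p2)) mxtrace_scalar mulr1n //.
move: (p1 *m adj p1 *m J) (p2 *m adj p2 *m J) (trp p1) (trp p2) trpp => A B tA tB tBA.
rewrite mulmxDl !mulmxDr !mxtraceD -!scalar_mxM mxtrace_scalar mul_mx_scalar mul_scalar_mx.
rewrite -scalemxAr -scalemxAl !mxtraceZ tA tB tBA /tau.
move: <<p1, p1>> <<p2, p2>> <<p1, p2>> <<p2, p1>> p10 p20 => g1 g2 z z' g10 g20.
by move: beta1 beta2 => b1 b2; field; rewrite g10 g20.
Qed.

Lemma tau_real p1 p2 : exists t : R, tau p1 p2 = t%:C%C.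
Proof.
have gen (z z' g1 g2 : CC R) : z^* = z' -> g1 \is Num.real -> g2 \is Num.real ->
    z * z' / (g1 * g2) \is Num.real.
  by move=> <- g1r g2r; rewrite -normCK; apply: rpredM; rewrite ?rpredV ?rpredM ?rpredX ?normr_real.
have : tau p1 p2 \is Num.real.
  by apply: gen; [rewrite -formC | exact: form_real HJ _ | exact: form_real HJ _].
by case: (tau p1 p2) => a b; rewrite complex_real => /eqP ->; exists a.
Qed.

(** This is the Gram determinant of the pair divided by <p1, p1>. So tau = 1 means that the centers
    coincide or span a degenerate plane. *)
Lemma reject_square p1 p2 : <<p1, p1>> != 0 -> <<p2, p2>> != 0 ->
  <<reject J p1 p2, reject J p1 p2>> = <<p2, p2>> * (1 - tau p1 p2).
Proof.
move=> p10 p20; rewrite form_reject_self // normCK -formC /tau.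
move: <<p1, p1>> <<p2, p2>> <<p1, p2>> <<p2, p1>> p10 p20 => g1 g2 z z' g10 g20.
by field; rewrite g10 g20.
Qed.

Lemma reject_eq0 p1 p2 : reject J p1 p2 = 0 -> p2 = (<<p2, p1>> / <<p1, p1>>) *: p1.
Proof. by move/eqP; rewrite subr_eq0 => /eqP. Qed.

End Reflections.

(** * Witt's theorem for pairs of centers *)

Section Witt.
Context {R : realType}.
Variables (J : 'M[CC R]_3) (HJ : signature_ppm J).
Implicit Types (k : 'M[CC R]_3) (x y p q e n m : 'cV[CC R]_3).
Implicit Types (c : CC R).
Local Notation "<< x , y >>" := (form J x y).
Local Notation formC0 := (formC0 HJ).

(** The change of basis is an isometry with determinant of modulus 1. A cube root normalizes the
    determinant, so vectors are transported up to a scalar, which is enough for projective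
    points. *)
Lemma gram_transport (B B' : 'M[CC R]_3) : B \in unitmx -> B' \in unitmx ->
  adj B *m J *m B = adj B' *m J *m B' ->
  exists k c, [/\ SU J k, c != 0 & k *m B = c *: B'].
Proof.
move=> Bu Bu' E; pose k0 := B' *m invmx B.
have k0B : k0 *m B = B' by rewrite mulmxKV.
have k0J : adj k0 *m J *m k0 = J.
  have aBu : adj B \in unitmx by rewrite /adj map_unitmx unitmx_tr.
  apply: (can_inj (mulKmx aBu)); apply: (can_inj (mulmxK Bu)).
  by rewrite E -[in RHS]k0B adjM !mulmxA.
clearbody k0; have dn : `|\det k0| = 1.
  have := congr1 determinant k0J; rewrite !det_mulmx det_adj mulrAC -normCKC.
  have Ju : \det J != 0 by have := signature_unit HJ; rewrite unitmxE unitfE.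
  rewrite -[X in _ = X]mul1r => /(mulIf Ju) /eqP.
  by rewrite sqrp_eq1 // => /eqP.
pose c := 3.-root (\det k0)^-1.
have c3 : c ^+ 3 = (\det k0)^-1 by rewrite rootCK.
have c1 : `|c| = 1.
  have /eqP := congr1 Num.norm c3; rewrite normrX normfV dn invr1.
  by rewrite (@pexpr_eq1 _ _ 3) // => /eqP.
exists (c *: k0), c; split; last by rewrite -scalemxAl k0B.
- split; last by rewrite detZ c3 mulVf // unit_neq0.
  move=> x y; rewrite -!scalemxAl !formE mulrA -normCK c1 expr1n mul1r.
  by rewrite gram_form k0J.
- exact: unit_neq0.
Qed.

Lemma normalize_positive e : 0 < <<e, e>> ->
  exists2 c : CC R, c != 0 & <<c *: e, c *: e>> = 1.
Proof.
move=> e_gt; have r0 : 0 < sqrtC <<e, e>> by rewrite sqrtC_gt0.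
exists (sqrtC <<e, e>>)^-1; first by rewrite invr_eq0 gt_eqF.
rewrite !formE fmorphV /= (CrealP (gtr0_real r0)) mulrA -expr2 exprVn sqrtCK.
by rewrite mulVf // gt_eqF.
Qed.

Lemma normalize_negative e : <<e, e>> < 0 ->
  exists2 c : CC R, c != 0 & <<c *: e, c *: e>> = -1.
Proof.
move=> e_lt; have r0 : 0 < sqrtC (- <<e, e>>) by rewrite sqrtC_gt0 oppr_gt0.
exists (sqrtC (- <<e, e>>))^-1; first by rewrite invr_eq0 gt_eqF.
rewrite !formE fmorphV /= (CrealP (gtr0_real r0)) mulrA -expr2 exprVn sqrtCK.
by rewrite invrN mulNr mulVf // lt_eqF.
Qed.

(** The sign of the third square is forced by the signature, so orthogonal frames with the same
    first two squares can be given the same Gram matrix. *)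
Lemma orthogonal_frame p n : <<p, p>> != 0 -> <<n, n>> != 0 -> <<p, n>> = 0 ->
  exists e, [/\ <<e, p>> = 0, <<e, n>> = 0 &
    <<e, e>> = if (0 < <<p, p>>) && (0 < <<n, n>>) then -1 else 1].
Proof.
move=> p0 n0 pn.
have neg x : <<x, x>> != 0 -> ~~ (0 < <<x, x>>) -> <<x, x>> < 0.
  by move=> x0; rewrite -form_nneg // negbK lt_neqAle x0.
have pos_case x y : <<x, x>> < 0 -> exists e, [/\ <<e, x>> = 0, <<e, y>> = 0 & <<e, e>> = 1].
  move=> x_lt; have [e e0 [ex ey]] := orthogonal_vector J x y.
  have e_gt := orthogonal_to_negative HJ x_lt ex e0.
  have [c c0 cE] := normalize_positive e_gt.
  by exists (c *: e); rewrite cE !formZl ex ey !mulr0.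
case: ifP => [/andP[p_gt n_gt]|/negbT].
  have [e [e_lt ep en _]] := positive_plane_complement HJ p_gt n_gt pn.
  have [c c0 cE] := normalize_negative e_lt.
  by exists (c *: e); rewrite cE !formZl ep en !mulr0.
rewrite negb_and => /orP[/(neg _ p0) p_lt|/(neg _ n0) n_lt].
  exact: pos_case.
by have [e [en ep ee]] := pos_case n p n_lt; exists e.
Qed.

Lemma orthogonal_transport p n q m : <<p, p>> != 0 -> <<n, n>> != 0 ->
  <<p, n>> = 0 -> <<q, m>> = 0 -> <<q, q>> = <<p, p>> -> <<m, m>> = <<n, n>> ->
  exists k c, [/\ SU J k, c != 0, k *m p = c *: q & k *m n = c *: m].
Proof.
move=> p0 n0 pn qm qq mm.
have [e [ep en ee]] := orthogonal_frame p0 n0 pn.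
have [f [fq fm ff]] : exists f, [/\ <<f, q>> = 0, <<f, m>> = 0 & <<f, f>> = <<e, e>>].
  have [] := orthogonal_frame _ _ qm; rewrite ?qq ?mm // => f [fq fm ff].
  by exists f; rewrite ff ee.
have e0 : <<e, e>> != 0 by rewrite ee; case: ifP; rewrite ?oppr_eq0 oner_eq0.
have Bu := orthogonal_frame_unit HJ p0 n0 e0 pn (formC0 ep) (formC0 en).
have [q0 m0 f0] : [/\ <<q, q>> != 0, <<m, m>> != 0 & <<f, f>> != 0].
  by rewrite qq mm ff.
have Bu' := orthogonal_frame_unit HJ q0 m0 f0 qm (formC0 fq) (formC0 fm).
have [|k [c [kS c0 kB]]] := gram_transport Bu Bu'.
  apply/matrixP => i j; rewrite !gramE.
  have [B0 B1 B2] := col_cols3 p n e; have [B0' B1' B2'] := col_cols3 q m f.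
  move: i j; apply: ord3P; apply: ord3P.
  - by rewrite B0 B0' qq.
  - by rewrite B0 B0' B1 B1' (formC0 pn) (formC0 qm).
  - by rewrite B0 B0' B2 B2' ep fq.
  - by rewrite B0 B0' B1 B1' pn qm.
  - by rewrite B1 B1' mm.
  - by rewrite B1 B1' B2 B2' en fm.
  - by rewrite B0 B0' B2 B2' (formC0 ep) (formC0 fq).
  - by rewrite B1 B1' B2 B2' (formC0 en) (formC0 fm).
  - by rewrite B2 B2' ff.
exists k, c; split=> //.
  have [B0 _ _] := col_cols3 p n e; have [B0' _ _] := col_cols3 q m f.
  by rewrite -{1}B0 colE mulmxA kB -scalemxAl -colE B0'.
have [_ B0 _] := col_cols3 p n e; have [_ B0' _] := col_cols3 q m f.
by rewrite -{1}B0 colE mulmxA kB -scalemxAl -colE B0'.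
Qed.

End Witt.

Section Pairs.
Context {R : realType}.
Variables (J : 'M[CC R]_3) (HJ : signature_ppm J).
Implicit Types (g k : 'M[CC R]_3) (x y z p q n m : 'cV[CC R]_3).
Implicit Types (a b c : CC R).
Local Notation "<< x , y >>" := (form J x y).
Local Notation formC := (formC HJ).
Local Notation formC0 := (formC0 HJ).

Definition same_sign p q : Prop :=
  (0 < <<p, p>> /\ 0 < <<q, q>>) \/ (<<p, p>> < 0 /\ <<q, q>> < 0).

Lemma same_sign_normalize p q : same_sign p q -> exists c c', [/\ c != 0, c' != 0,
  <<c *: p, c *: p>> ^+ 2 = 1 & <<c' *: q, c' *: q>> = <<c *: p, c *: p>>].
Proof.
case=> [[p_gt q_gt]|[p_lt q_lt]].
  have [c c0 cE] := normalize_positive p_gt; have [d d0 dE] := normalize_positive q_gt.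
  by exists c, d; split=> //; rewrite ?dE cE ?expr1n.
have [c c0 cE] := normalize_negative p_lt; have [d d0 dE] := normalize_negative q_lt.
by exists c, d; split=> //; rewrite ?dE cE ?sqrrN ?expr1n.
Qed.

Lemma tauZ p1 p2 c d : c != 0 -> d != 0 -> tau J (c *: p1) (d *: p2) = tau J p1 p2.
Proof.
move=> c0 d0; rewrite /tau !formE.
have [c0' d0'] : c^* != 0 /\ d^* != 0 by rewrite !conjC_eq0.
move: <<p1, p1>> <<p2, p2>> <<p1, p2>> <<p2, p1>> => g1 g2 z z'.
move: c^* d^* c0' d0' => c' d' c0' d0'.
have [->|g10] := eqVneq g1 0; first by rewrite !(mulr0, mul0r, invr0).
have [->|g20] := eqVneq g2 0; first by rewrite !(mulr0, mul0r, invr0).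
by field; rewrite c0 c0' d0 d0' g10 g20.
Qed.

(* The phase of p2 is adjusted so that <p2, p1> is a canonical square root. *)
Lemma phase_normalize p1 p2 : <<p1, p1>> ^+ 2 = 1 -> <<p2, p2>> ^+ 2 = 1 ->
  exists c, [/\ c != 0, <<c *: p2, c *: p2>> = <<p2, p2>> &
    <<c *: p2, p1>> = sqrtC (<<p1, p1>> * <<p2, p2>> * tau J p1 p2)].
Proof.
move=> p1s p2s.
have nz x : <<x, x>> ^+ 2 = 1 -> <<x, x>> != 0.
  by apply: contra_eq_neq => ->; rewrite expr0n /= eq_sym oner_eq0.
have -> : <<p1, p1>> * <<p2, p2>> * tau J p1 p2 = `|<<p2, p1>>| ^+ 2.
  have gen (g z z' : CC R) : g != 0 -> g * (z' * z / g) = z * z'.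
    by move=> g0; rewrite mulrC divfK // mulrC.
  by rewrite normCK -(formC p2 p1) /tau gen // mulf_neq0 ?nz.
rewrite rootCX // sqrtCK.
have [z0|z0] := eqVneq <<p2, p1>> 0.
  by exists 1; rewrite oner_neq0 scale1r z0 normr0.
have n0 : `|<<p2, p1>>| != 0 by rewrite normr_eq0.
exists (`|<<p2, p1>>| / <<p2, p1>>); split.
- by rewrite mulf_neq0 ?invr_eq0.
- by rewrite !formE mulrA -normCK normf_div normr_id divff // expr1n mul1r.
- by rewrite formZl divfK.
Qed.

(** As tau is not 1, the component of the second center orthogonal to the first is nonisotropic, and
    orthogonal frames can be transported. *)
Lemma gram_pair_transport p1 p2 q1 q2 : <<p1, p1>> != 0 -> <<p2, p2>> != 0 ->
  <<q1, q1>> = <<p1, p1>> -> <<q2, q2>> = <<p2, p2>> -> <<q2, q1>> = <<p2, p1>> ->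
  tau J p1 p2 != 1 ->
  exists k c, [/\ SU J k, c != 0, k *m p1 = c *: q1 & k *m p2 = c *: q2].
Proof.
move=> p10 p20 q1E q2E qE t1.
have q10 : <<q1, q1>> != 0 by rewrite q1E.
have q20 : <<q2, q2>> != 0 by rewrite q2E.
have tE : tau J q1 q2 = tau J p1 p2.
  by rewrite /tau q1E q2E (formC q2 q1) (formC p2 p1) qE.
have n0 : <<reject J p1 p2, reject J p1 p2>> != 0.
  by rewrite (reject_square HJ p10 p20) mulf_neq0 // subr_eq0 eq_sym.
have nm : <<reject J q1 q2, reject J q1 q2>> = <<reject J p1 p2, reject J p1 p2>>.
  by rewrite (reject_square HJ p10 p20) (reject_square HJ q10 q20) tE q2E.
have [k [c [kS c0 kp kn]]] := orthogonal_transport HJ p10 n0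
  (formC0 (reject_orthogonal p2 p10)) (formC0 (reject_orthogonal q2 q10)) q1E nm.
exists k, c; split; [exact: kS | exact: c0 | exact: kp |].
have rE x y : y = reject J x y + (<<y, x>> / <<x, x>>) *: x by rewrite subrK.
rewrite [in LHS](rE p1 p2) [in RHS](rE q1 q2) mulmxDr kn -scalemxAr kp q1E qE.
by rewrite [RHS]scalerDr; congr (_ + _); rewrite !scalerA mulrC.
Qed.

Lemma neq0_of_sqr1 c : c ^+ 2 = 1 -> c != 0.
Proof. by apply: contra_eq_neq => ->; rewrite expr0n /= eq_sym oner_eq0. Qed.

Lemma rescale_transport k c a b x y : a != 0 -> k *m (a *: x) = c *: (b *: y) ->
  k *m x = (c * b / a) *: y.
Proof.
move=> a0 E; apply: (scalerI a0); rewrite scalemxAr E !scalerA.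
by rewrite mulrCA divff // mulr1.
Qed.

(** With squares scaled to 1 or -1 and the phase of the mixed product fixed, the Gram matrix depends
    only on the signs and on tau. *)
Lemma pair_transport p1 p2 q1 q2 : same_sign p1 q1 -> same_sign p2 q2 ->
  tau J p1 p2 = tau J q1 q2 -> tau J p1 p2 != 1 ->
  exists k c1 c2, [/\ SU J k, c1 != 0, c2 != 0, k *m p1 = c1 *: q1 & k *m p2 = c2 *: q2].
Proof.
move=> s1 s2 tE t1.
have [a1 [b1 [a10 b10 a1s b1E]]] := same_sign_normalize s1.
have [a2 [b2 [a20 b20 a2s b2E]]] := same_sign_normalize s2.
have [d [d0 dE dz]] := phase_normalize a1s a2s.
have b1s : << b1 *: q1, b1 *: q1 >> ^+ 2 = 1 by rewrite b1E.
have b2s : << b2 *: q2, b2 *: q2 >> ^+ 2 = 1 by rewrite b2E.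
have [f [f0 fE fz]] := phase_normalize b1s b2s.
have zE : << f *: (b2 *: q2), b1 *: q1 >> = << d *: (a2 *: p2), a1 *: p1 >>.
  by rewrite fz dz b1E b2E (tauZ _ _ b10 b20) (tauZ _ _ a10 a20) tE.
move: dE fE zE; rewrite !scalerA => dE fE zE.
have da0 : d * a2 != 0 by exact: mulf_neq0.
have fb0 : f * b2 != 0 by exact: mulf_neq0.
have P20 : << (d * a2) *: p2, (d * a2) *: p2 >> != 0 by rewrite dE; exact: neq0_of_sqr1.
have tP : tau J (a1 *: p1) ((d * a2) *: p2) != 1 by rewrite (tauZ _ _ a10 da0).
have [k [c [kS c0 k1 k2]]] := gram_pair_transport (neq0_of_sqr1 a1s) P20 b1E
  (etrans fE (etrans b2E (esym dE))) zE tP.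
exists k, (c * b1 / a1), (c * (f * b2) / (d * a2)); split.
- exact: kS.
- by rewrite !mulf_neq0 ?invr_eq0.
- by rewrite !mulf_neq0 ?invr_eq0.
- exact: rescale_transport a10 k1.
- exact: rescale_transport da0 k2.
Qed.

End Pairs.

(** * Degenerate pairs (tau = 1) and conjugacy of products *)

Section Tangent.
Context {R : realType}.
Variables (J : 'M[CC R]_3) (HJ : signature_ppm J).
Implicit Types (g k : 'M[CC R]_3) (x y p q u v e n m : 'cV[CC R]_3).
Implicit Types (a b c alpha : CC R).
Local Notation "<< x , y >>" := (form J x y).
Local Notation formC := (formC HJ).
Local Notation formC0 := (formC0 HJ).

(** A negative vector orthogonal to [x] is not orthogonal to the isotropic [n]. Scaled to product 1
    with [n], it becomes isotropic after subtraction of half its square times [n]. *)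
Lemma isotropic_partner x n : <<x, x>> = 1 -> <<x, n>> = 0 -> <<n, n>> = 0 -> n != 0 ->
  exists m, [/\ <<x, m>> = 0, <<m, m>> = 0 & <<n, m>> = 1].
Proof.
move=> xx xn nn n0; have [f f_lt] := negative_vector HJ.
have x_gt : 0 < <<x, x>> by rewrite xx ltr01.
have e_lt := negative_reject HJ x_gt f_lt.
have ex := reject_orthogonal f (lt0r_neq0 x_gt).
move: (reject J x f) e_lt ex => e e_lt ex.
have ne : <<n, e>> != 0.
  by apply/eqP => /(orthogonal_to_negative HJ e_lt) /(_ n0); rewrite nn ltxx.
pose m0 := (<<n, e>>^-1)^* *: e.
have xm0 : <<x, m0>> = 0 by rewrite formZr (formC0 ex) mulr0.
have nm0 : <<n, m0>> = 1 by rewrite formZr conjCK mulVf.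
move: m0 xm0 nm0 => m0 xm0 nm0; exists (m0 - (<<m0, m0>> / 2) *: n).
have mr : (<<m0, m0>> / 2)^* = <<m0, m0>> / 2.
  by rewrite fmorph_div /= -(formC m0 m0) conjC_nat.
split.
- by rewrite formDr formNr formZr xm0 xn mulr0 subrr.
- rewrite !formE (formC n m0) nm0 nn mr rmorph1.
  by move: <<m0, m0>> => h; field.
- by rewrite formDr formNr formZr nn mulr0 subr0.
Qed.

(** Here y - x is isotropic and orthogonal to [x]. The frame x, y - x and a hyperbolic partner of y
    - x always has the same Gram matrix; it replaces the orthogonal frame that a degenerate plane
    does not have. *)
Lemma tangent_transport x y x' y' : <<x, x>> = 1 -> <<y, y>> = 1 -> <<y, x>> = 1 ->
  y != x -> <<x', x'>> = 1 -> <<y', y'>> = 1 -> <<y', x'>> = 1 -> y' != x' ->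
  exists k c, [/\ SU J k, c != 0, k *m x = c *: x' & k *m y = c *: y'].
Proof.
have frame u v : <<u, u>> = 1 -> <<v, v>> = 1 -> <<v, u>> = 1 -> v != u ->
    exists m, cols3 u (v - u) m \in unitmx /\
    [/\ <<u, v - u>> = 0, <<v - u, v - u>> = 0, <<u, m>> = 0, <<m, m>> = 0 &
        <<v - u, m>> = 1].
  move=> uu vv vu vu0.
  have uv : <<u, v>> = 1 by rewrite (formC v u) vu rmorph1.
  have un : <<u, v - u>> = 0 by rewrite formDr formNr uv uu subrr.
  have nn : <<v - u, v - u>> = 0 by rewrite formDl formNl un formDr formNr vv vu subrr subr0.
  have n0 : v - u != 0 by rewrite subr_eq0.
  move: (v - u) un nn n0 => n un nn n0.
  have [m [um mm nm]] := isotropic_partner uu un nn n0.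
  exists m; split=> //; apply: cols3_unit => a b c E.
  have F x0 : a * <<u, x0>> + b * <<n, x0>> + c * <<m, x0>> = 0.
    by rewrite -!formZl -!formDl E form0l.
  have mn : <<m, n>> = 1 by rewrite (formC n m) nm rmorph1.
  move: (F u) (F n) (F m); rewrite uu un um (formC0 un) (formC0 um) nn mn mm nm.
  by rewrite !mulr0 !mulr1 !addr0 !add0r.
move=> xx yy yx xy xx' yy' yx' xy'.
have [m [Bu [xn nn xm mm nm]]] := frame _ _ xx yy yx xy.
have [m' [Bu' [xn' nn' xm' mm' nm']]] := frame _ _ xx' yy' yx' xy'.
have [B0 B1 B2] := col_cols3 x (y - x) m.
have [B0' B1' B2'] := col_cols3 x' (y' - x') m'.
have [k [c [kS c0 kB]]] : exists k c, [/\ SU J k, c != 0 &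
    k *m cols3 x (y - x) m = c *: cols3 x' (y' - x') m'].
  apply: (gram_transport HJ) => //.
  apply/matrixP => i j; rewrite !gramE.
  move: i j; apply: ord3P; apply: ord3P.
  - by rewrite B0 B0' xx xx'.
  - by rewrite B0 B0' B1 B1' (formC0 xn) (formC0 xn').
  - by rewrite B0 B0' B2 B2' (formC0 xm) (formC0 xm').
  - by rewrite B0 B0' B1 B1' xn xn'.
  - by rewrite B1 B1' nn nn'.
  - by rewrite B1 B1' B2 B2' (formC (y - x) m) (formC (y' - x') m') nm nm'.
  - by rewrite B0 B0' B2 B2' xm xm'.
  - by rewrite B1 B1' B2 B2' nm nm'.
  - by rewrite B2 B2' mm mm'.
have kx : k *m x = c *: x' by rewrite -{1}B0 colE mulmxA kB -scalemxAl -colE B0'.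
exists k, c; split=> //.
have kn : k *m (y - x) = c *: (y' - x').
  by rewrite -{1}B1 colE mulmxA kB -scalemxAl -colE B1'.
by rewrite -[y](subrK x) mulmxDr kn kx -scalerDr subrK.
Qed.

Lemma tangent_pair_transport p1 p2 q1 q2 :
  0 < <<p1, p1>> -> 0 < <<p2, p2>> -> 0 < <<q1, q1>> -> 0 < <<q2, q2>> ->
  tau J p1 p2 = 1 -> tau J q1 q2 = 1 ->
  reject J p1 p2 != 0 -> reject J q1 q2 != 0 ->
  exists k c1 c2, [/\ SU J k, c1 != 0, c2 != 0, k *m p1 = c1 *: q1 & k *m p2 = c2 *: q2].
Proof.
have normal u v : 0 < <<u, u>> -> 0 < <<v, v>> -> tau J u v = 1 -> reject J u v != 0 ->
    exists a b, [/\ a != 0, b != 0 & [/\ << a *: u, a *: u >> = 1,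
      << b *: v, b *: v >> = 1, << b *: v, a *: u >> = 1 & b *: v != a *: u]].
  move=> u_gt v_gt t1 r0.
  have [a a0 uu] := normalize_positive u_gt.
  have [b b0 vv] := normalize_positive v_gt.
  have us : << a *: u, a *: u >> ^+ 2 = 1 by rewrite uu expr1n.
  have vs : << b *: v, b *: v >> ^+ 2 = 1 by rewrite vv expr1n.
  have [d [d0 dE dz]] := phase_normalize HJ us vs.
  move: dE dz; rewrite scalerA uu vv (tauZ _ _ _ a0 b0) t1 !mulr1 sqrtC1 => dE dz.
  have db0 : d * b != 0 by exact: mulf_neq0.
  exists a, (d * b); split=> //; split=> //.
  apply: contra_neq r0 => E.
  have -> : v = (a / (d * b)) *: u.
    by apply: (scalerI db0); rewrite E scalerA mulrCA divff // mulr1.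
  by rewrite /reject formZl mulfK ?subrr // gt_eqF.
move=> p1_gt p2_gt q1_gt q2_gt tp tq rp rq.
have [a [b [a0 b0 [aa bb ab abn]]]] := normal _ _ p1_gt p2_gt tp rp.
have [a' [b' [a0' b0' [aa' bb' ab' abn']]]] := normal _ _ q1_gt q2_gt tq rq.
have [k [c [kS c0 k1 k2]]] := tangent_transport aa bb ab abn aa' bb' ab' abn'.
exists k, (c * a' / a), (c * b' / b); split.
- exact: kS.
- by rewrite !mulf_neq0 ?invr_eq0.
- by rewrite !mulf_neq0 ?invr_eq0.
- exact: rescale_transport a0 k1.
- exact: rescale_transport b0 k2.
Qed.

(** Each point is paired with an orthogonal vector of the opposite sign; then tau = 0 and
    [pair_transport] applies. *)
Lemma point_transport p q : same_sign J p q -> exists k c, [/\ SU J k, c != 0 & k *m p = c *: q].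
Proof.
have [f f_lt] := negative_vector HJ.
case=> [[p_gt q_gt]|[p_lt q_lt]].
  have t0 x : 0 < <<x, x>> -> tau J x (reject J x f) = 0.
    by move=> x_gt; rewrite /tau (reject_orthogonal f (lt0r_neq0 x_gt)) mulr0 mul0r.
  have s1 : same_sign J p q by left.
  have s2 : same_sign J (reject J p f) (reject J q f).
    by right; split; exact: negative_reject.
  have tE : tau J p (reject J p f) = tau J q (reject J q f) by rewrite (t0 p p_gt) (t0 q q_gt).
  have t1 : tau J p (reject J p f) != 1 by rewrite (t0 p p_gt) eq_sym oner_eq0.
  have [k [c1 [c2 [kS c10 _ k1 _]]]] := pair_transport HJ s1 s2 tE t1.
  by exists k, c1.
have [n n0 [np _]] := orthogonal_vector J p p.
have [m m0 [mq _]] := orthogonal_vector J q q.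
have s1 : same_sign J p q by right.
have s2 : same_sign J n m.
  by left; split; [exact: (orthogonal_to_negative HJ p_lt np n0) |
    exact: (orthogonal_to_negative HJ q_lt mq m0)].
have [k [c1 [c2 [kS c10 _ k1 _]]]] : exists k c1 c2, [/\ SU J k, c1 != 0, c2 != 0,
    k *m p = c1 *: q & k *m n = c2 *: m].
  by apply: (pair_transport HJ s1 s2); rewrite /tau np ?mq !mulr0 !mul0r // eq_sym oner_eq0.
by exists k, c1.
Qed.

Definition product alpha1 alpha2 p1 p2 : 'M[CC R]_3 :=
  complex_reflection J alpha2 p2 *m complex_reflection J alpha1 p1.

Lemma class_of_conj (g h : SU J) k : SU J k ->
  val h = k *m val g *m invmx k -> class_of g = class_of h.
Proof.
move=> kS hE; apply/eqmodP/asboolP; exists (SigSub (mem_set kS)), 1.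
  by rewrite /Omega /= expr1n.
by rewrite /= scale1r hE.
Qed.

Lemma product_class alpha1 alpha2 p1 p2 q1 q2 (g h : SU J) k c1 c2 :
  SU J k -> c1 != 0 -> c2 != 0 -> k *m p1 = c1 *: q1 -> k *m p2 = c2 *: q2 ->
  val g = product alpha1 alpha2 p1 p2 -> val h = product alpha1 alpha2 q1 q2 ->
  class_of g = class_of h.
Proof.
move=> kS c10 c20 k1 k2 gE hE; apply: (class_of_conj kS).
have ku := SU_unit kS.
rewrite hE gE /product -(reflectionZ _ alpha1 q1 c10).
rewrite -(reflectionZ _ alpha2 q2 c20) -k1 -k2.
rewrite -!(reflection_conj _ _ kS) !mulmxA; by rewrite mulmxKV.
Qed.

End Tangent.

(** * The product of two reflections *)

Section TrigIdentities.
Context {F : fieldType}.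
Implicit Types (u w h T X : F).

(** Here u = e^{i a1 / 4}, w = e^{i a2 / 4}, T = tau, and u^6 - u^{-6} = 2 i sin (3 a1 / 2). The
    hypothesis says that X is 2 kappa. *)
Lemma trace_identity u w T X : u != 0 -> w != 0 ->
  T * (u ^+ 6 - u ^- 6) * (w ^+ 6 - w ^- 6) = X - (u ^+ 6 * w ^- 6 + u ^- 6 * w ^+ 6) ->
  (u ^- 8 - u ^+ 4) * (w ^- 8 - w ^+ 4) * T + (u ^- 8 - u ^+ 4) * w ^+ 4 +
  (w ^- 8 - w ^+ 4) * u ^+ 4 + 3 * (u ^+ 4 * w ^+ 4) =
  u ^+ 4 * w ^+ 4 + u ^- 2 * w ^- 2 * X.
Proof.
move=> u0 w0 E.
have -> : X = T * (u ^+ 6 - u ^- 6) * (w ^+ 6 - w ^- 6) + (u ^+ 6 * w ^- 6 + u ^- 6 * w ^+ 6).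
  by rewrite E subrK.
by field; rewrite u0 w0.
Qed.

(** With h = e^{i psi / 2}, this is the characteristic equation, at [lam], of the product on the
    span of the centers. *)
Lemma characteristic_identity u w h T : u != 0 -> w != 0 -> h != 0 ->
  T * (u ^+ 6 - u ^- 6) * (w ^+ 6 - w ^- 6) = h ^+ 2 + h ^- 2 - (u ^+ 6 * w ^- 6 + u ^- 6 * w ^+ 6) ->
  let lam := u ^- 2 * w ^- 2 * h ^+ 2 in
  (u ^- 8 - u ^+ 4) * w ^+ 4 * u ^- 8 * (w ^- 8 - w ^+ 4) * T +
  (lam - u ^- 8 * w ^+ 4) * ((u ^- 8 - u ^+ 4) * (w ^- 8 - w ^+ 4) * T + u ^+ 4 * w ^- 8 - lam) = 0.
Proof.
move=> u0 w0 h0 E lam; rewrite /lam.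
have -> : (u ^- 8 - u ^+ 4) * w ^+ 4 * u ^- 8 * (w ^- 8 - w ^+ 4) * T +
  (u ^- 2 * w ^- 2 * h ^+ 2 - u ^- 8 * w ^+ 4) * ((u ^- 8 - u ^+ 4) * (w ^- 8 - w ^+ 4) * T + u ^+ 4 * w ^- 8 - u ^- 2 * w ^- 2 * h ^+ 2) =
  u ^- 4 * w ^- 4 * h ^+ 2 * (T * (u ^+ 6 - u ^- 6) * (w ^+ 6 - w ^- 6) - (h ^+ 2 + h ^- 2 - (u ^+ 6 * w ^- 6 + u ^- 6 * w ^+ 6))).
  by field; rewrite u0 w0 h0.
by rewrite E subrr mulr0.
Qed.

(** The first factor is the square of the explicit eigenvector divided by <p2, p2>, primes standing
    for conjugates. Each difference on the right is 2 i times a sine, so the sign becomes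
    readable. *)
Lemma norm_identity u w h T : u != 0 -> w != 0 -> h != 0 ->
  T * (u ^+ 6 - u ^- 6) * (w ^+ 6 - w ^- 6) = h ^+ 2 + h ^- 2 - (u ^+ 6 * w ^- 6 + u ^- 6 * w ^+ 6) ->
  let b := u ^- 8 - u ^+ 4 in let b' := u ^+ 8 - u ^- 4 in
  let y := u ^- 2 * w ^- 2 * h ^+ 2 - u ^- 8 * w ^+ 4 in
  let y' := u ^+ 2 * w ^+ 2 * h ^- 2 - u ^+ 8 * w ^- 4 in
  (b * b' * T + b * w ^+ 4 * y' * T + b' * w ^- 4 * y * T + y * y') * (w ^+ 6 - w ^- 6) =
  - ((h * u ^+ 3 * w ^- 3 - h^-1 * u ^- 3 * w ^+ 3) * (h ^+ 2 - h ^- 2) *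
     (u ^+ 3 * w ^+ 3 * h^-1 - u ^- 3 * w ^- 3 * h)).
Proof.
move=> u0 w0 h0 E b b' y y'.
have bE : b = - u ^- 2 * (u ^+ 6 - u ^- 6) by rewrite /b; field; rewrite u0.
have bE' : b' = u ^+ 2 * (u ^+ 6 - u ^- 6) by rewrite /b'; field; rewrite u0.
rewrite bE bE'.
transitivity (T * (u ^+ 6 - u ^- 6) * (w ^+ 6 - w ^- 6) *
   (- (u ^+ 6 - u ^- 6) - u ^- 2 * w ^+ 4 * y' + u ^+ 2 * w ^- 4 * y) +
   y * y' * (w ^+ 6 - w ^- 6)).
  by rewrite /y /y'; field; rewrite h0 w0 u0.
rewrite E /y /y'; by field; rewrite h0 w0 u0.
Qed.

(** An entrywise check, [P] and [Q] being entries of the centers: the two sides differ by [Q] times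
    the characteristic equation. *)
Lemma eigenvector_identity g1 g2 z z' lam i1 i2 e1 e2 c1 c2 P Q :
  g1 != 0 -> g2 != 0 ->
  c1 * e2 * i1 * c2 * (z' * z / (g1 * g2)) +
    (lam - i1 * e2) * (c1 * c2 * (z' * z / (g1 * g2)) + e1 * i2 - lam) = 0 ->
  c1 * e2 * (z / g1) * (i1 * (c2 * (z' / g2) * Q + e2 * P)) +
    (lam - i1 * e2) * (c1 * (z / g1) * (c2 * (z' / g2) * Q + e2 * P) + e1 * i2 * Q) =
  lam * (c1 * e2 * (z / g1) * P + (lam - i1 * e2) * Q) :> F.
Proof.
move=> g10 g20 E; apply/eqP; rewrite -subr_eq0; apply/eqP.
by rewrite -[RHS](mulr0 Q) -E; field; rewrite g10 g20.
Qed.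

Lemma norm_expansion g1 g2 z z' b b' v y y' : g1 != 0 -> g2 != 0 -> v != 0 ->
  let T := z' * z / (g1 * g2) in
  b * v * (z / g1) * (b' * v^-1 * (z' / g1) * g1 + y' * z') +
    y * (b' * v^-1 * (z' / g1) * z + y' * g2) =
  g2 * (b * b' * T + b * v * y' * T + b' * v^-1 * y * T + y * y') :> F.
Proof. by move=> g10 g20 v0 /=; field; rewrite v0 g10 g20. Qed.

Lemma triple_sine_identity (A B C I : F) : 2 != 0 :> F -> I ^+ 2 = -1 ->
  - (A * B * C) / (2 * I) = 4 * (A / (2 * I) * (B / (2 * I)) * (C / (2 * I))).
Proof.
move=> n2 I2; have I0 : I != 0.
  by apply: contra_eq_neq I2 => ->; rewrite expr0n /= eq_sym oppr_eq0 oner_eq0.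
transitivity (A * B * C * (I ^+ 2) / (2 * I)); first by rewrite I2 mulrN1.
transitivity (A * B * C / (2 * I) / (I ^+ 2)); first by rewrite I2 invrN invr1; ring.
by field; rewrite I0 n2.
Qed.

End TrigIdentities.

Section Product.
Context {R : realType}.
Variables (J : 'M[CC R]_3) (HJ : signature_ppm J) (a1 a2 : R).
Hypotheses (Ha1 : 0 < a1 < 2 * pi / 3) (Ha2 : 0 < a2 < 2 * pi / 3).
Implicit Types (g : 'M[CC R]_3) (x y z p v e n m : 'cV[CC R]_3).
Implicit Types (psi t : R).
Local Notation "<< x , y >>" := (form J x y).
Local Notation formC := (formC HJ).
Local Notation F p1 p2 := (product J (expi a1) (expi a2) p1 p2).
Local Notation S := (3 * (a1 + a2) / 2).
Local Notation delta := (3 * (a1 - a2) / 2).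

(* The eigenvalues of the product other than e^{i(a1 + a2)} are
   e^{- i (a1 + a2) / 2} times the roots of X^2 - 2 kappa X + 1. *)
Definition kappa t : R :=
  cos delta - 2 * sin (3 * a1 / 2) * sin (3 * a2 / 2) * t.

Lemma expiX (x : R) (n : nat) : expi x ^+ n = expi (x *+ n).
Proof. by elim: n => [|n IH]; rewrite ?expr0 ?mulr0n ?expi0 // exprS IH mulrS expiD. Qed.

Lemma sin_half_gt0 (a : R) : 0 < a < 2 * pi / 3 -> 0 < sin (3 * a / 2).
Proof. by move=> /andP[a0 api]; apply: sin_gt0_pi; lra. Qed.

(* Quarter angles make the exponentials below integral powers of u and w. *)
Let u : CC R := expi (a1 / 4).
Let w : CC R := expi (a2 / 4).

Lemma expi_a1 : expi a1 = u ^+ 4.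
Proof. by rewrite expiX; congr expi; rewrite -mulr_natr; lra. Qed.

Lemma expi_a2 : expi a2 = w ^+ 4.
Proof. by rewrite expiX; congr expi; rewrite -mulr_natr; lra. Qed.

Lemma expi_a12 : expi (- (a1 + a2) / 2) = u ^- 2 * w ^- 2.
Proof.
rewrite !expiX -(expiN (_ *+ 2)) -(expiN (a2 / 4 *+ 2)) -expiD.
by congr expi; rewrite -(mulr_natr (a1 / 4)) -(mulr_natr (a2 / 4)); lra.
Qed.

Lemma expi_b1 : expi (3 * a1 / 2) = u ^+ 6.
Proof. by rewrite expiX; congr expi; rewrite -mulr_natr; lra. Qed.

Lemma expi_b2 : expi (3 * a2 / 2) = w ^+ 6.
Proof. by rewrite expiX; congr expi; rewrite -mulr_natr; lra. Qed.

Lemma expi_delta : expi delta = u ^+ 6 * w ^- 6.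
Proof.
by rewrite -expi_b1 -expi_b2 -(expiN (3 * a2 / 2)) -expiD; congr expi; lra.
Qed.

Let u0 : u != 0. Proof. exact: expi_neq0. Qed.
Let w0 : w != 0. Proof. exact: expi_neq0. Qed.

Lemma kappa_equation t (X : CC R) : (kappa t)%:C%C = X / 2 ->
  t%:C%C * (u ^+ 6 - u ^- 6) * (w ^+ 6 - w ^- 6) = X - (u ^+ 6 * w ^- 6 + u ^- 6 * w ^+ 6).
Proof.
move=> E; have I2 := @expi_pihalf_sqr R.
have -> : X = 2 * (kappa t)%:C%C by rewrite E mulrC divfK // pnatr_eq0.
rewrite /kappa rmorphB !rmorphM /= expi_cos !expi_sin !expiN.
rewrite expi_delta expi_b1 expi_b2.
have I0 := @expi_neq0 R (pi / 2).
move: (expi (pi / 2)) I0 I2 => I I0 I2.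
have -> : (2%:C)%C = 2 :> CC R by rewrite rmorph_nat.
move: (t%:C%C : CC R) => T; move: (u) (w) u0 w0 => u' w' u0' w0'.
transitivity (- (T * (u' ^+ 6 - u' ^- 6) * (w' ^+ 6 - w' ^- 6)) / I ^+ 2).
  by rewrite I2 invrN invr1 mulrN1 opprK.
by field; rewrite I0 w0' u0'.
Qed.

Lemma product_trace_kappa p1 p2 t : <<p1, p1>> != 0 -> <<p2, p2>> != 0 ->
  tau J p1 p2 = t%:C%C ->
  \tr (F p1 p2) = expi (a1 + a2) + expi (- (a1 + a2) / 2) * (2 * (kappa t)%:C%C).
Proof.
move=> p10 p20 tE; rewrite /product product_trace // tE expiD expi_a12 expi_a1 expi_a2.
rewrite -!exprM.
apply: trace_identity => //; apply: kappa_equation.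
by rewrite mulrC mulKf // pnatr_eq0.
Qed.

Lemma sin6_neq0 : u ^+ 6 - u ^- 6 != 0 /\ w ^+ 6 - w ^- 6 != 0.
Proof.
have nz (a : R) : 0 < a < 2 * pi / 3 -> expi (3 * a / 2) - (expi (3 * a / 2))^-1 != 0.
  move=> Ha; apply/eqP => E; have := sin_half_gt0 Ha.
  have /eqP := @expi_sin R (3 * a / 2); rewrite expiN E mul0r fmorph_eq0 => /eqP ->.
  by rewrite ltxx.
by move: (nz _ Ha1) (nz _ Ha2); rewrite expi_b1 expi_b2.
Qed.

Let b1 : CC R := expi a1 ^- 2 - expi a1.
Let b2 : CC R := expi a2 ^- 2 - expi a2.

Lemma b1E : b1 = u ^- 8 - u ^+ 4.
Proof. by rewrite /b1 expi_a1 -exprM. Qed.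

Lemma b2E : b2 = w ^- 8 - w ^+ 4.
Proof. by rewrite /b2 expi_a2 -exprM. Qed.

Lemma b1_neq0 : b1 != 0.
Proof.
have -> : b1 = - u ^- 2 * (u ^+ 6 - u ^- 6) by rewrite b1E; move: u u0 => v v0; field.
by rewrite mulf_neq0 ?(sin6_neq0).1 // oppr_eq0 invr_eq0 expf_neq0.
Qed.

Lemma b2_neq0 : b2 != 0.
Proof.
have -> : b2 = - w ^- 2 * (w ^+ 6 - w ^- 6) by rewrite b2E; move: w w0 => v v0; field.
by rewrite mulf_neq0 ?(sin6_neq0).2 // oppr_eq0 invr_eq0 expf_neq0.
Qed.

Lemma product_p1 p1 p2 : <<p1, p1>> != 0 -> F p1 p2 *m p1 =
  expi a1 ^- 2 *: ((b2 * (<<p1, p2>> / <<p2, p2>>)) *: p2 + expi a2 *: p1).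
Proof.
move=> p10; rewrite /product -mulmxA reflection_center // -scalemxAr.
by rewrite complex_reflectionE.
Qed.

Lemma product_p2 p1 p2 : <<p2, p2>> != 0 -> F p1 p2 *m p2 =
  (b1 * (<<p2, p1>> / <<p1, p1>>)) *:
    ((b2 * (<<p1, p2>> / <<p2, p2>>)) *: p2 + expi a2 *: p1) +
  (expi a1 * expi a2 ^- 2) *: p2.
Proof.
move=> p20; rewrite /product -mulmxA [complex_reflection J (expi a1) p1 *m p2]complex_reflectionE.
rewrite mulmxDr -!scalemxAr reflection_center // complex_reflectionE.
by rewrite scalerA.
Qed.

Lemma product_orthogonal p1 p2 x : <<x, p1>> = 0 -> <<x, p2>> = 0 ->
  F p1 p2 *m x = expi (a1 + a2) *: x.
Proof.
move=> x1 x2; rewrite /product -mulmxA (reflection_orthogonal _ x1) -scalemxAr.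
by rewrite (reflection_orthogonal _ x2) scalerA expiD.
Qed.

(** These coordinates solve the [p1]-row of (F - lam) v = 0 with lam = e^{i (psi - (a1 + a2) / 2)};
    the [p2]-row is then the characteristic equation. *)
Definition eigenvector_of psi p1 p2 : 'cV[CC R]_3 :=
  (b1 * expi a2 * (<<p2, p1>> / <<p1, p1>>)) *: p1 +
  (expi (psi - (a1 + a2) / 2) - expi a1 ^- 2 * expi a2) *: p2.

Lemma expi_lam psi : expi (psi - (a1 + a2) / 2) = u ^- 2 * w ^- 2 * expi (psi / 2) ^+ 2.
Proof.
rewrite -expi_a12 expiX -expiD; congr expi; rewrite -(mulr_natr (psi / 2)); lra.
Qed.

Lemma cos_half psi : (cos psi)%:C%C =
  (expi (psi / 2) ^+ 2 + expi (psi / 2) ^- 2) / 2 :> CC R.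
Proof.
rewrite expi_cos expiN.
have -> : expi psi = expi (psi / 2) ^+ 2 :> CC R by rewrite expr2 -expiD -splitr.
by [].
Qed.

Lemma eigenvector_ofP psi p1 p2 t : <<p1, p1>> != 0 -> <<p2, p2>> != 0 ->
  tau J p1 p2 = t%:C%C -> cos psi = kappa t ->
  F p1 p2 *m eigenvector_of psi p1 p2 =
  expi (psi - (a1 + a2) / 2) *: eigenvector_of psi p1 p2.
Proof.
move=> p10 p20 tE ck.
have E : t%:C%C * (u ^+ 6 - u ^- 6) * (w ^+ 6 - w ^- 6) =
    expi (psi / 2) ^+ 2 + expi (psi / 2) ^- 2 - (u ^+ 6 * w ^- 6 + u ^- 6 * w ^+ 6).
  by apply: kappa_equation; rewrite -ck cos_half.
have h0 := @expi_neq0 R (psi / 2).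
have := characteristic_identity u0 w0 h0 E; rewrite /= -expi_lam.
have -> : u ^- 8 = expi a1 ^- 2 by rewrite expi_a1 -exprM.
have -> : w ^- 8 = expi a2 ^- 2 by rewrite expi_a2 -exprM.
rewrite -expi_a1 -expi_a2 -/b1 -/b2 -tE /tau => E2.
rewrite /eigenvector_of mulmxDr -!scalemxAr product_p1 // product_p2 //.
move: E2; move: <<p1, p1>> <<p2, p2>> <<p1, p2>> <<p2, p1>> p10 p20 => g1 g2 z z' g10 g20.
move: (expi (psi - _)) (expi a1 ^- 2) (expi a2 ^- 2) (expi a2) (expi a1) b1 b2 =>
  lam i1 i2 e2 e1 c1 c2 E2.
apply/matrixP => i j; rewrite !mxE.
exact: eigenvector_identity.
Qed.

(** Up to the positive factor 4 / sin (3 a2 / 2), the square of the eigenvector divided by <p2,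
    p2>. *)
Definition eigenvector_sign psi : R :=
  sin ((psi + delta) / 2) * sin psi * sin ((S - psi) / 2).

Lemma eigenvector_of_norm psi p1 p2 t : <<p1, p1>> != 0 -> <<p2, p2>> != 0 ->
  tau J p1 p2 = t%:C%C -> cos psi = kappa t ->
  <<eigenvector_of psi p1 p2, eigenvector_of psi p1 p2>> * (sin (3 * a2 / 2))%:C%C =
  <<p2, p2>> * (4 * (eigenvector_sign psi)%:C%C).
Proof.
move=> p10 p20 tE ck.
have E : t%:C%C * (u ^+ 6 - u ^- 6) * (w ^+ 6 - w ^- 6) =
    expi (psi / 2) ^+ 2 + expi (psi / 2) ^- 2 - (u ^+ 6 * w ^- 6 + u ^- 6 * w ^+ 6).
  by apply: kappa_equation; rewrite -ck cos_half.
have h0 := @expi_neq0 R (psi / 2).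
set h : CC R := expi (psi / 2) in E h0.
have := norm_identity u0 w0 h0 E; rewrite /=.
have c1 : <<p1, p1>>^* = <<p1, p1>> by rewrite -(formC p1 p1).
have e1c : (expi a1)^* = u ^- 4 by rewrite conj_expi expiN expi_a1.
have e2c : (expi a2)^* = w ^- 4 by rewrite conj_expi expiN expi_a2.
have bc : b1^* = u ^+ 8 - u ^- 4.
  rewrite /b1 rmorphB /= e1c; congr (_ - _).
  by rewrite fmorphV /= rmorphXn /= e1c exprVn invrK -exprM.
have yc : (expi (psi - (a1 + a2) / 2) - expi a1 ^- 2 * expi a2)^* =
    u ^+ 2 * w ^+ 2 * h ^- 2 - u ^+ 8 * w ^- 4.
  rewrite rmorphB rmorphM /= conj_expi e2c fmorphV /= rmorphXn /= e1c exprVn invrK -exprM.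
  by rewrite expiN expi_lam !invfM !invrK.
have yE : expi (psi - (a1 + a2) / 2) - expi a1 ^- 2 * expi a2 =
    u ^- 2 * w ^- 2 * h ^+ 2 - u ^- 8 * w ^+ 4.
  by rewrite expi_lam expi_a1 expi_a2 -exprM.
move=> NI.
have -> : <<eigenvector_of psi p1 p2, eigenvector_of psi p1 p2>> = <<p2, p2>> *
  ((u ^- 8 - u ^+ 4) * (u ^+ 8 - u ^- 4) * t%:C%C +
   (u ^- 8 - u ^+ 4) * w ^+ 4 * (u ^+ 2 * w ^+ 2 * h ^- 2 - u ^+ 8 * w ^- 4) * t%:C%C +
   (u ^+ 8 - u ^- 4) * w ^- 4 * (u ^- 2 * w ^- 2 * h ^+ 2 - u ^- 8 * w ^+ 4) * t%:C%C +
   (u ^- 2 * w ^- 2 * h ^+ 2 - u ^- 8 * w ^+ 4) * (u ^+ 2 * w ^+ 2 * h ^- 2 - u ^+ 8 * w ^- 4)).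
  rewrite /eigenvector_of !formE yc yE -tE /tau.
  have -> : (b1 * expi a2 * (<<p2, p1>> / <<p1, p1>>))^* =
      (u ^+ 8 - u ^- 4) * w ^- 4 * (<<p1, p2>> / <<p1, p1>>).
    by rewrite rmorphM rmorphM /= bc e2c fmorph_div /= c1 -(formC p2 p1).
  rewrite b1E expi_a2.
  exact: (norm_expansion _ _ _ _ _ _ p10 p20 (expf_neq0 4 w0)).
rewrite -mulrA; congr (_ * _).
rewrite /eigenvector_sign !rmorphM /= !expi_sin !expiN expi_b2 mulrA NI.
have -> : expi psi = h ^+ 2 :> CC R by rewrite expr2 -expiD -splitr.
have -> : expi ((psi + delta) / 2) = h * u ^+ 3 * w ^- 3.
  rewrite /h !expiX -(expiN (_ *+ 3)) -!expiD; congr expi.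
  by rewrite -(mulr_natr (a1 / 4)) -(mulr_natr (a2 / 4)); lra.
have -> : expi ((S - psi) / 2) = u ^+ 3 * w ^+ 3 * h^-1.
  rewrite /h !expiX -(expiN (psi / 2)) -!expiD; congr expi.
  by rewrite -(mulr_natr (a1 / 4)) -(mulr_natr (a2 / 4)); lra.
have -> : (h * u ^+ 3 * w ^- 3)^-1 = h^-1 * u ^- 3 * w ^+ 3.
  by rewrite (invfM (h * u ^+ 3)) (invfM h) invrK.
have -> : (u ^+ 3 * w ^+ 3 * h^-1)^-1 = u ^- 3 * w ^- 3 * h.
  by rewrite (invfM (u ^+ 3 * w ^+ 3)) (invfM (u ^+ 3)) invrK.
have n2 : 2 != 0 :> CC R by rewrite pnatr_eq0.
exact: triple_sine_identity n2 (@expi_pihalf_sqr R).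
Qed.

End Product.

(** An unordered interval, because S may lie on either side of pi and delta on either side of 0. *)
Definition between {R : realType} (x y z : R) : Prop :=
  x <= z <= y \/ y <= z <= x.

(** * Angles of a product as functions of psi *)

Section ProductAngles.
Context {R : realType}.
Variables (J : 'M[CC R]_3) (HJ : signature_ppm J) (a1 a2 : R).
Hypotheses (Ha1 : 0 < a1 < 2 * pi / 3) (Ha2 : 0 < a2 < 2 * pi / 3).
Implicit Types (x y z p n : 'cV[CC R]_3).
Implicit Types (psi t : R).
Local Notation "<< x , y >>" := (form J x y).
Local Notation formC := (formC HJ).
Local Notation F p1 p2 := (product J (expi a1) (expi a2) p1 p2).
Local Notation S := (3 * (a1 + a2) / 2).
Local Notation delta := (3 * (a1 - a2) / 2).
Local Notation kap := (kappa a1 a2).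

Lemma product_SU p1 p2 : <<p1, p1>> != 0 -> <<p2, p2>> != 0 -> SU J (F p1 p2).
Proof. by move=> p10 p20; apply: SUM; apply: reflection_SU => //; exact: norm_expi. Qed.

Lemma S_bounds : 0 < S < 2 * pi.
Proof. by move: Ha1 Ha2 => /andP[? ?] /andP[? ?]; apply/andP; split; lra. Qed.

Lemma kappa0 : kap 0 = cos delta.
Proof. by rewrite /kappa mulr0 subr0. Qed.

Lemma kappa1 : kap 1 = cos S.
Proof.
rewrite /kappa mulr1.
have -> : delta = 3 * a1 / 2 - 3 * a2 / 2 by lra.
have -> : S = 3 * a1 / 2 + 3 * a2 / 2 by lra.
by rewrite cosB cosD; lra.
Qed.

Lemma kappa_mono : {mono kap : t t' /~ t < t'}.
Proof.
have s0 : 0 < 2 * sin (3 * a1 / 2) * sin (3 * a2 / 2).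
  by rewrite !mulr_gt0 // sin_half_gt0.
by move=> t t'; rewrite /kappa ltrD2l ltrN2 ltr_pM2l.
Qed.

Lemma kappa_le t t' : (kap t <= kap t') = (t' <= t).
Proof. by rewrite !leNgt kappa_mono. Qed.

Lemma kappa_inj t t' : kap t = kap t' -> t = t'.
Proof. by move=> E; apply/eqP; rewrite eq_le -(kappa_le t t') -(kappa_le t' t) E lexx. Qed.

Lemma cos2piB psi : cos (2 * pi - psi) = cos psi.
Proof. by rewrite mulr_natl cosB cos2pi sin2pi mul1r mul0r addr0. Qed.

Lemma cos_between_inj psi psi' : between S pi psi -> between S pi psi' ->
  cos psi = cos psi' -> psi = psi'.
Proof.
have /andP[S0 S2] := S_bounds; have pi0 := pi_gt0 R.
case=> [/andP[h1 h2]|/andP[h1 h2]]; case=> [/andP[h3 h4]|/andP[h3 h4]] E.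
- by apply: (@cos_inj R) => //; rewrite in_itv /=; lra.
- by lra.
- by lra.
suff : 2 * pi - psi = 2 * pi - psi' by lra.
by apply: (@cos_inj R); rewrite ?cos2piB // in_itv /=; lra.
Qed.

Lemma between_exists c : -1 <= c <= cos S -> exists2 psi, between S pi psi & cos psi = c.
Proof.
move=> hc; have /andP[S0 S2] := S_bounds; have pi0 := pi_gt0 R.
have [Spi|/ltW Spi] := leP S pi.
  rewrite -(cospi R) in hc; have [psi h E] := cos_interval (ltW S0) Spi (lexx _) hc.
  by exists psi => //; left.
have S0' : 0 <= 2 * pi - S by lra.
have Spi' : 2 * pi - S <= pi by lra.
rewrite -(cospi R) -(cos2piB S) in hc.
have [psi /andP[h1 h2] E] := cos_interval S0' Spi' (lexx _) hc.
by exists (2 * pi - psi); [right; apply/andP; split; lra | rewrite cos2piB].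
Qed.

(** The component of [p2] orthogonal to the negative [p1] is zero or positive, while its square is
    <p2, p2> (1 - tau). *)
Lemma negative_pair_tau p1 p2 t : <<p1, p1>> < 0 -> <<p2, p2>> < 0 ->
  tau J p1 p2 = t%:C%C -> t = 1 /\ reject J p1 p2 = 0 \/ 1 < t.
Proof.
move=> p1_lt p2_lt tE.
have [p10 p20] : <<p1, p1>> != 0 /\ <<p2, p2>> != 0 by rewrite !lt_eqF.
have := reject_square HJ p10 p20; rewrite tE -(rmorph1 (real_complex R)) -rmorphB.
have [->|n0] := eqVneq (reject J p1 p2) 0.
  rewrite form0l => /esym/eqP; rewrite mulf_eq0 (negPf p20) /= fmorph_eq0 subr_eq0.
  by move=> /eqP <-; left.
have np := reject_orthogonal p2 p10.
have n_gt := orthogonal_to_negative HJ p1_lt np n0.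
move=> E; right; move: n_gt; rewrite E nmulr_rgt0 // ltcE /= eqxx /= subr_lt0.
by [].
Qed.

Lemma positive_pair_tau p1 p2 t : 0 < <<p1, p1>> -> 0 < <<p2, p2>> ->
  tau J p1 p2 = t%:C%C -> 0 <= t.
Proof.
move=> p1_gt p2_gt tE; have : 0 <= tau J p1 p2.
  by rewrite /tau (formC p1 p2) -normCK divr_ge0 ?exprn_ge0 // mulr_ge0 // ltW.
by rewrite tE lecE /= eqxx.
Qed.

Lemma mixed_pair_tau p1 p2 t : 0 < <<p1, p1>> -> <<p2, p2>> < 0 ->
  tau J p1 p2 = t%:C%C -> t <= 0.
Proof.
move=> p1_gt p2_lt tE; have : tau J p1 p2 <= 0.
  rewrite /tau (formC p1 p2) -normCK mulr_ge0_le0 ?exprn_ge0 //.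
  by rewrite invr_le0 mulr_ge0_le0 // ltW.
by rewrite tE lecE /= eqxx.
Qed.

(** As tau is not 0, the coefficient of [p1] is nonzero; a vanishing combination would make the
    centers proportional and tau equal to 1. *)
Lemma eigenvector_neq0 psi p1 p2 t : <<p1, p1>> != 0 -> <<p2, p2>> != 0 ->
  tau J p1 p2 = t%:C%C -> t != 0 -> t != 1 -> eigenvector_of J a1 a2 psi p1 p2 != 0.
Proof.
move=> p10 p20 tE t0 t1; apply/eqP; rewrite /eigenvector_of.
set x := _ * (_ / _); set y := _ - _ => E.
have x0 : x != 0.
  have z0 : <<p2, p1>> != 0.
    apply: contra_neq t0 => z0; move: tE; rewrite /tau z0 mulr0 mul0r.
    by move=> /esym/eqP; rewrite fmorph_eq0 => /eqP.
  have b0 := b1_neq0 Ha1 Ha2.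
  exact: (mulf_neq0 (mulf_neq0 b0 (expi_neq0 _)) (mulf_neq0 z0 (invr_neq0 p10))).
have p1E : p1 = (- y / x) *: p2.
  apply: (scalerI x0); rewrite scalerA mulrCA divff // mulr1 scaleNr.
  by apply/eqP; rewrite -addr_eq0 E.
have c0 : - y / x != 0.
  by apply: contra_neq p10 => c0; rewrite p1E c0 scale0r form0l.
move: tE; rewrite p1E -[p2 in X in tau J _ X]scale1r (tauZ _ _ _ c0 (oner_neq0 _)).
rewrite /tau divff ?mulf_neq0 // -(rmorph1 (real_complex R)) => /(fmorph_inj _) E1.
by rewrite -E1 eqxx in t1.
Qed.

Lemma eigenvector_phase psi p1 p2 t : <<p1, p1>> != 0 -> <<p2, p2>> != 0 ->
  tau J p1 p2 = t%:C%C -> t != 0 -> t != 1 -> cos psi = kap t ->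
  (<<p2, p2>> < 0 /\ 0 <= eigenvector_sign a1 a2 psi) \/
  (0 < <<p2, p2>> /\ eigenvector_sign a1 a2 psi <= 0) ->
  phase J (F p1 p2) (expi (psi - (a1 + a2) / 2)).
Proof.
move=> p10 p20 tE t0 t1 ck sgn.
apply: (@unit_eigenvector_phase _ _ _ _ (eigenvector_of J a1 a2 psi p1 p2)).
- exact: product_SU.
- exact: eigenvector_neq0 p10 p20 tE t0 t1.
- have s_gt : 0 < (sin (3 * a2 / 2))%:C%C :> CC R by rewrite ltcE /= eqxx sin_half_gt0.
  rewrite -(pmulr_lle0 _ s_gt) (eigenvector_of_norm HJ p10 p20 tE ck).
  case: sgn => -[p2s r].
    by rewrite nmulr_rle0 // mulr_ge0 ?ler0n // lecE /= eqxx.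
  by rewrite pmulr_rle0 // mulr_ge0_le0 ?ler0n // lecE /= eqxx.
- exact: norm_expi.
- exact: eigenvector_ofP p10 p20 tE ck.
Qed.

(** The other eigenvalues e^{i (- psi - (a1 + a2) / 2)} and e^{i (a1 + a2)} are divided by the
    phase. The other eigenvector in the span of the centers corresponds to -psi. *)
Lemma eigenvector_angles psi p1 p2 t : <<p1, p1>> != 0 -> <<p2, p2>> != 0 ->
  tau J p1 p2 = t%:C%C -> cos psi = kap t ->
  phase J (F p1 p2) (expi (psi - (a1 + a2) / 2)) ->
  has_angles J (F p1 p2) (- 2 * psi, S - psi).
Proof.
move=> p10 p20 tE ck ph; exists (expi (psi - (a1 + a2) / 2)); split=> //.
- rewrite (product_trace_kappa a1 a2 p10 p20 tE) -ck expi_cos.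
  rewrite [2 * _]mulrC divfK ?pnatr_eq0 // !mulrDr mulr1 -!expiD /=.
  by rewrite addrC; congr (_ + _ + _); congr expi; lra.
- rewrite /= expiX -expiD -[RHS]expi0; congr expi.
  by rewrite -(mulr_natr (psi - (a1 + a2) / 2)); lra.
Qed.

Lemma axis_angles psi p1 p2 t : <<p1, p1>> != 0 -> <<p2, p2>> != 0 ->
  tau J p1 p2 = t%:C%C -> cos psi = kap t ->
  phase J (F p1 p2) (expi (a1 + a2)) ->
  has_angles J (F p1 p2) (psi - S, - psi - S).
Proof.
move=> p10 p20 tE ck ph; exists (expi (a1 + a2)); split=> //.
- rewrite (product_trace_kappa a1 a2 p10 p20 tE) -ck expi_cos.
  rewrite [2 * _]mulrC divfK ?pnatr_eq0 // !mulrDr mulr1 -!expiD /=.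
  by rewrite addrA; congr (_ + _ + _); congr expi; lra.
- rewrite /= expiX -expiD -[RHS]expi0; congr expi.
  by rewrite -(mulr_natr (a1 + a2)); lra.
Qed.

(** Once e^{i (a1 + a2)} is removed from the trace, 2 kappa is, up to a unit factor, a sum of two
    numbers of modulus 1. *)
Lemma has_angles_kappa s p1 p2 t : <<p1, p1>> != 0 -> <<p2, p2>> != 0 ->
  tau J p1 p2 = t%:C%C -> has_angles J (F p1 p2) s -> -1 <= kap t <= 1.
Proof.
move=> p10 p20 tE hs; have FS := product_SU p10 p20.
have [mu [ph gE _]] := has_angles_char_poly HJ FS hs.
have [c c0 [cp1 cp2]] := orthogonal_vector J p1 p2.
have := eigenvector_root c0 (product_orthogonal a1 a2 cp1 cp2).
have trE := char_poly_cubic_trace gE.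
move: trE; rewrite gE root_cubic (product_trace_kappa a1 a2 p10 p20 tE).
have n1 : `|mu| = 1 := ph.1.
have n2 : `|mu * expi s.1| = 1 by rewrite normrM n1 norm_expi mulr1.
have n3 : `|mu * expi s.2| = 1 by rewrite normrM n1 norm_expi mulr1.
move: (mu * expi s.1) (mu * expi s.2) n2 n3 => nu nu' n2 n3 trE root.
have [x [y [x1 y1 xy]]] : exists x y : CC R, [/\ `|x| = 1, `|y| = 1 &
    expi (- (a1 + a2) / 2) * (2 * (kap t)%:C%C) = x + y].
  case/or3P: root => /eqP E; move: trE; rewrite E.
  - by rewrite -addrA => /addrI ->; exists nu, nu'.
  - by rewrite [mu + nu]addrC -addrA => /addrI ->; exists mu, nu'.
  - by rewrite [_ + nu']addrC => /addrI ->; exists mu, nu.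
have : `|expi (- (a1 + a2) / 2) * (2 * (kap t)%:C%C : CC R)| <= 1 + 1.
  by rewrite xy (le_trans (ler_normD _ _)) // x1 y1.
rewrite normrM norm_expi mul1r normrM normr_nat -mulr2n -[X in _ <= X]mulr1.
rewrite mulr_natl -mulr_natl ler_pM2l ?ltr0n // normc_def /= expr0n addr0 sqrtr_sqr.
by rewrite lecE /= eqxx /= ler_norml.
Qed.

End ProductAngles.

Section SignedAngles.
Context {R : realType}.
Variables (J : 'M[CC R]_3) (HJ : signature_ppm J) (a1 a2 : R).
Hypotheses (Ha1 : 0 < a1 < 2 * pi / 3) (Ha2 : 0 < a2 < 2 * pi / 3).
Implicit Types (x y p e n : 'cV[CC R]_3).
Implicit Types (psi t : R).
Local Notation "<< x , y >>" := (form J x y).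
Local Notation formC := (formC HJ).
Local Notation formC0 := (formC0 HJ).
Local Notation F p1 p2 := (product J (expi a1) (expi a2) p1 p2).
Local Notation S := (3 * (a1 + a2) / 2).
Local Notation delta := (3 * (a1 - a2) / 2).
Local Notation kap := (kappa a1 a2).

Lemma sin_le0 (x : R) : pi <= x <= 2 * pi -> sin x <= 0.
Proof.
move=> /andP[x1 x2]; have -> : x = (x - pi) + pi by rewrite subrK.
by rewrite sinDpi oppr_le0 sin_ge0_pi //; lra.
Qed.

(** For two negative centers the eigenvector of nonpositive type is the one at -psi. On the two
    sides of pi, sin psi and sin ((S + psi) / 2) change sign together. *)
Lemma sin_sign_ge0 psi : between S pi psi -> 0 <= eigenvector_sign a1 a2 (- psi).
Proof.
move: Ha1 Ha2 => /andP[h1 h2] /andP[h3 h4] hpsi; have pi0 := pi_gt0 R.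
rewrite /eigenvector_sign sinN.
have -> : (- psi + delta) / 2 = - ((psi - delta) / 2) by lra.
rewrite sinN mulrNN.
have s1 : 0 <= sin ((psi - delta) / 2).
  by apply: sin_ge0_pi; case: hpsi => /andP[? ?]; lra.
case: hpsi => /andP[h5 h6].
  by rewrite !mulr_ge0 ?sin_ge0_pi //; lra.
by apply: mulr_le0; [apply: mulr_ge0_le0 => //; apply: sin_le0 | apply: sin_le0]; lra.
Qed.

Lemma sin_sign_le0 psi : between S pi psi -> eigenvector_sign a1 a2 psi <= 0.
Proof.
move: Ha1 Ha2 => /andP[h1 h2] /andP[h3 h4] hpsi; have pi0 := pi_gt0 R.
rewrite /eigenvector_sign.
have s1 : 0 <= sin ((psi + delta) / 2).
  by apply: sin_ge0_pi; case: hpsi => /andP[? ?]; lra.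
case: hpsi => /andP[h5 h6].
  apply: mulr_ge0_le0; first by rewrite mulr_ge0 // sin_ge0_pi //; lra.
  have -> : (S - psi) / 2 = - ((psi - S) / 2) by lra.
  by rewrite sinN oppr_le0 sin_ge0_pi //; lra.
apply: mulr_le0_ge0; last by rewrite sin_ge0_pi //; lra.
by apply: mulr_ge0_le0 => //; apply: sin_le0; lra.
Qed.

Lemma sin_sign_mixed psi : between 0 delta psi -> 0 <= eigenvector_sign a1 a2 psi.
Proof.
move: Ha1 Ha2 => /andP[h1 h2] /andP[h3 h4] hpsi; have pi0 := pi_gt0 R.
rewrite /eigenvector_sign; apply: mulr_ge0; last first.
  by apply: sin_ge0_pi; case: hpsi => /andP[? ?]; lra.
case: hpsi => /andP[h5 h6]; first by rewrite mulr_ge0 // sin_ge0_pi //; lra.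
have -> : (psi + delta) / 2 = - ((- psi - delta) / 2) by lra.
have -> : sin psi = - sin (- psi) by rewrite sinN opprK.
rewrite mulrN -mulNr -sinN opprK.
by rewrite mulr_ge0 // sin_ge0_pi //; lra.
Qed.

Lemma proportional_neq0 p1 p2 c : <<p2, p2>> != 0 -> p2 = c *: p1 -> c != 0.
Proof. by move=> p20 E; apply: contra_neq p20 => c0; rewrite E c0 scale0r form0l. Qed.

Lemma negative_negative_angles p1 p2 t psi : <<p1, p1>> < 0 -> <<p2, p2>> < 0 ->
  tau J p1 p2 = t%:C%C -> between S pi psi -> cos psi = kap t ->
  has_angles J (F p1 p2) (2 * psi, S + psi).
Proof.
move=> p1_lt p2_lt tE hpsi ck.
have [p10 p20] : <<p1, p1>> != 0 /\ <<p2, p2>> != 0 by rewrite !lt_eqF.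
have ckN : cos (- psi) = kap t by rewrite cosN.
have -> : (2 * psi, S + psi) = (- 2 * - psi, S - - psi) by congr (_, _); lra.
apply: (eigenvector_angles p10 p20 tE ckN).
have [[t1 r0]|t1] := negative_pair_tau HJ p1_lt p2_lt tE; last first.
  apply: (eigenvector_phase HJ Ha1 Ha2 p10 p20 tE _ _ ckN).
  - by rewrite gt_eqF // (lt_trans ltr01).
  - by rewrite gt_eqF.
  - by left; split=> //; exact: sin_sign_ge0.
(* The centers coincide, and F acts on [p1] by e^{- 2 i (a1 + a2)}, which is the claimed phase for
   psi = S. *)
have psiE : psi = S.
  apply: (cos_between_inj Ha1 Ha2 hpsi); last by rewrite ck t1 kappa1.
  by have := pi_gt0 R; have /andP[S0 S2] := S_bounds Ha1 Ha2 => pi0;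
    have [Spi|Spi] := leP S pi; [left|right]; apply/andP; split; lra.
have p2E := reject_eq0 r0; set c := _ / _ in p2E.
have c0 := proportional_neq0 p20 p2E.
have -> : F p1 p2 = F p1 p1 by rewrite /product p2E (reflectionZ _ _ _ c0).
apply: (negative_eigenvector_phase (product_SU HJ _ _ p10 p10) p1_lt).
rewrite /product -mulmxA reflection_center // -scalemxAr reflection_center // scalerA.
by congr (_ *: _); rewrite !expiX -!expiN -expiD; congr expi;
  rewrite -(mulr_natr a1) -(mulr_natr a2); lra.
Qed.

(** Coinciding centers leave any negative vector orthogonal to [p1]; a degenerate plane is
    orthogonal to its own isotropic direction; a positive definite plane has a negative
    complement. *)
Lemma positive_pair_axis p1 p2 t : 0 < <<p1, p1>> -> 0 < <<p2, p2>> ->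
  tau J p1 p2 = t%:C%C -> t <= 1 ->
  exists c, [/\ c != 0, <<c, c>> <= 0, <<c, p1>> = 0 & <<c, p2>> = 0].
Proof.
move=> p1_gt p2_gt tE t1.
have [p10 p20] : <<p1, p1>> != 0 /\ <<p2, p2>> != 0 by rewrite !gt_eqF.
have np := reject_orthogonal p2 p10.
have p2E : p2 = reject J p1 p2 + (<<p2, p1>> / <<p1, p1>>) *: p1 by rewrite subrK.
have orth c : <<c, p1>> = 0 -> <<c, reject J p1 p2>> = 0 -> <<c, p2>> = 0.
  by move=> c1 cn; rewrite p2E formDr cn formZr c1 mulr0 addr0.
have nn := reject_square HJ p10 p20; rewrite tE in nn.
have [n0|n0] := eqVneq (reject J p1 p2) 0.
  have [f f_lt] := negative_vector HJ.
  have e_lt := negative_reject HJ p1_gt f_lt.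
  exists (reject J p1 f); split.
  - by apply: (@form_neq0 _ J); rewrite lt_eqF.
  - exact: ltW.
  - exact: reject_orthogonal.
  - by apply: orth; [exact: reject_orthogonal | rewrite n0 form0r].
move: t1; rewrite le_eqVlt => /orP[/eqP t1|t1].
  have nn0 : <<reject J p1 p2, reject J p1 p2>> = 0 by rewrite nn t1 subrr mulr0.
  by exists (reject J p1 p2); split; [exact: n0 | rewrite nn0 | exact: np | exact: orth].
have n_gt : 0 < <<reject J p1 p2, reject J p1 p2>>.
  by rewrite nn mulr_gt0 // subr_gt0 ltcE /= eqxx.
have [e [e_lt ep en _]] := positive_plane_complement HJ p1_gt n_gt (formC0 np).
exists e; split; [|exact: ltW|by []|exact: orth].
by apply: (@form_neq0 _ J); rewrite lt_eqF.
Qed.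

Lemma positive_positive_axis_angles p1 p2 t psi : 0 < <<p1, p1>> -> 0 < <<p2, p2>> ->
  tau J p1 p2 = t%:C%C -> t <= 1 -> cos psi = kap t ->
  has_angles J (F p1 p2) (psi - S, - psi - S).
Proof.
move=> p1_gt p2_gt tE t1 ck.
have [p10 p20] : <<p1, p1>> != 0 /\ <<p2, p2>> != 0 by rewrite !gt_eqF.
apply: (axis_angles p10 p20 tE ck).
have [c [c0 c_le c1 c2]] := positive_pair_axis p1_gt p2_gt tE t1.
apply: (unit_eigenvector_phase (product_SU HJ _ _ p10 p20) c0 c_le (norm_expi _)).
exact: product_orthogonal.
Qed.

Lemma between_S : between S pi S.
Proof.
have pi0 := pi_gt0 R; have /andP[S0 S2] := S_bounds Ha1 Ha2.
by have [Spi|Spi] := leP S pi; [left|right]; apply/andP; split; lra.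
Qed.

Lemma positive_positive_angles p1 p2 t psi : 0 < <<p1, p1>> -> 0 < <<p2, p2>> ->
  tau J p1 p2 = t%:C%C -> 1 <= t -> between S pi psi -> cos psi = kap t ->
  has_angles J (F p1 p2) (- 2 * psi, S - psi).
Proof.
move=> p1_gt p2_gt tE t1 hpsi ck.
have [p10 p20] : <<p1, p1>> != 0 /\ <<p2, p2>> != 0 by rewrite !gt_eqF.
move: t1; rewrite le_eqVlt => /orP[/eqP t1|t1].
  (* At tau = 1 the axis formula applies; its angles 0 and -2 S are those claimed here,
     exchanged. *)
  have psiE : psi = S.
    by apply: (cos_between_inj Ha1 Ha2 hpsi between_S); rewrite ck -t1 kappa1.
  have t_le : t <= 1 by rewrite -t1.
  have := positive_positive_axis_angles p1_gt p2_gt tE t_le ck.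
  apply: same_angles_has_angles; right => /=; rewrite psiE; split; congr expi; lra.
apply: (eigenvector_angles p10 p20 tE ck).
apply: (eigenvector_phase HJ Ha1 Ha2 p10 p20 tE _ _ ck).
- by rewrite gt_eqF // (lt_trans ltr01).
- by rewrite gt_eqF.
- by right; split=> //; exact: sin_sign_le0.
Qed.

Lemma cos_mixed_inj psi : between 0 delta psi -> cos psi = cos delta -> psi = delta.
Proof.
move: Ha1 Ha2 => /andP[h1 h2] /andP[h3 h4] hpsi E; have pi0 := pi_gt0 R.
case: hpsi => /andP[h5 h6]; first by apply: (@cos_inj R) => //; rewrite in_itv /=; lra.
apply: oppr_inj; apply: (@cos_inj R); rewrite ?cosN // in_itv /=; lra.
Qed.

Lemma tau0_orthogonal p1 p2 : <<p1, p1>> != 0 -> <<p2, p2>> != 0 ->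
  tau J p1 p2 = 0 -> <<p2, p1>> = 0.
Proof.
move=> p10 p20 E; have gg := mulf_neq0 p10 p20.
have /eqP : <<p1, p2>> * <<p2, p1>> = 0 by rewrite -(divfK gg (_ * _)) -/(tau J p1 p2) E mul0r.
rewrite (formC p2 p1) -normCKC => /eqP/eqP.
by rewrite expf_eq0 normr_eq0 => /andP[_ /eqP].
Qed.

Lemma positive_negative_angles p1 p2 t psi : 0 < <<p1, p1>> -> <<p2, p2>> < 0 ->
  tau J p1 p2 = t%:C%C -> between 0 delta psi -> cos psi = kap t ->
  has_angles J (F p1 p2) (- 2 * psi, S - psi).
Proof.
move=> p1_gt p2_lt tE hpsi ck.
have [p10 p20] : <<p1, p1>> != 0 /\ <<p2, p2>> != 0 by rewrite gt_eqF ?lt_eqF.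
apply: (eigenvector_angles p10 p20 tE ck).
have [t0|t0] := eqVneq t 0; last first.
  apply: (eigenvector_phase HJ Ha1 Ha2 p10 p20 tE t0 _ ck).
    by rewrite lt_eqF // (le_lt_trans (mixed_pair_tau HJ p1_gt p2_lt tE)).
  by left; split=> //; exact: sin_sign_mixed.
(* For orthogonal centers [p2] itself is a negative eigenvector, and its eigenvalue alpha1
   alpha2^{-2} is the phase at psi = delta. *)
have psiE : psi = delta by apply: cos_mixed_inj => //; rewrite ck t0 kappa0.
have p21 : <<p2, p1>> = 0 by apply: tau0_orthogonal; rewrite // tE t0 rmorph0.
apply: (negative_eigenvector_phase (product_SU HJ _ _ p10 p20) p2_lt).
rewrite product_p2 // p21 mul0r mulr0 scale0r add0r; congr (_ *: _).
by rewrite expiX -expiN -expiD; congr expi; rewrite -(mulr_natr a2) psiE; lra.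
Qed.

End SignedAngles.

(** * The triangle and its identification *)

Section TrianglePoints.
Context {R : realType}.
Implicit Types (s t : R * R).

Lemma same_angles_refl s : same_angles s s.
Proof. by left. Qed.

Lemma same_angles_sym s t : same_angles s t -> same_angles t s.
Proof. by case=> -[e1 e2]; [left | right]; rewrite e1 e2. Qed.

Lemma same_angles_trans s t r : same_angles s t -> same_angles t r -> same_angles s r.
Proof.
by case=> -[e1 e2]; case=> -[e3 e4]; rewrite /same_angles ?e1 ?e2 ?e3 ?e4; auto.
Qed.

Lemma expi2pi : expi (2 * pi) = expi 0 :> CC R.
Proof. by rewrite expi_2pi expi0. Qed.

Lemma tpoint_same_angles s t : tpoint s = tpoint t -> same_angles s t.
Proof.
move=> /eqmodP /asboolP; elim=> [x y [th [_ -> ->]]|x|x y _|x y z _ xy _ yz].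
- by right; rewrite /= expi2pi.
- exact: same_angles_refl.
- exact: same_angles_sym.
- exact: same_angles_trans xy yz.
Qed.

(** Numbers in [0, 2 pi] with equal exponentials differ only as 0 and 2 pi; the order of the
    coordinates leaves the side gluing and the two diagonal vertices. *)
Lemma same_angles_cases s t : triangle s -> triangle t -> same_angles s t ->
  [\/ s = t, [/\ s.2 = 0, t.1 = 2 * pi & t.2 = s.1],
      [/\ t.2 = 0, s.1 = 2 * pi & s.2 = t.1] |
      (s = (0, 0) /\ t = (2 * pi, 2 * pi)) \/ (s = (2 * pi, 2 * pi) /\ t = (0, 0))].
Proof.
case: s t => s1 s2 [t1 t2] [/= s20 [s21 s12]] [/= t20 [t21 t12]].
have pi0 := pi_gt0 R.
have [hs1 hs2] : 0 <= s1 <= 2 * pi /\ 0 <= s2 <= 2 * pi by split; lra.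
have [ht1 ht2] : 0 <= t1 <= 2 * pi /\ 0 <= t2 <= 2 * pi by split; lra.
case=> /= -[].
- move=> /(expi_inj hs1 ht1) e1 /(expi_inj hs2 ht2) e2.
  case: e1 => [e1|[e1 e1']|[e1 e1']]; case: e2 => [e2|[e2 e2']|[e2 e2']].
  + by constructor 1; rewrite e1 e2.
  + by constructor 2; split=> //=; lra.
  + by constructor 3; split=> //=; lra.
  + by constructor 2; split=> //=; lra.
  + by constructor 4; left; rewrite e1 e1' e2 e2'.
  + by exfalso; lra.
  + by constructor 3; split=> //=; lra.
  + by exfalso; lra.
  + by constructor 4; right; rewrite e1 e1' e2 e2'.
- move=> /(expi_inj hs1 ht2) e1 /(expi_inj hs2 ht1) e2.
  case: e1 => [e1|[e1 e1']|[e1 e1']]; case: e2 => [e2|[e2 e2']|[e2 e2']].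
  + by constructor 1; congr (_, _); lra.
  + by constructor 2; split=> //=; lra.
  + by exfalso; lra.
  + by exfalso; lra.
  + by constructor 4; left; split; congr (_, _); lra.
  + by exfalso; lra.
  + by constructor 3; split=> //=; lra.
  + by constructor 1; congr (_, _); lra.
  + by constructor 4; right; split; congr (_, _); lra.
Qed.

Lemma tpoint_side (th : R) : 0 <= th <= 2 * pi -> tpoint (th, 0) = tpoint (2 * pi, th).
Proof. by move=> h; apply/eqmodP/asboolP; apply: Relation_Operators.rst_step; exists th. Qed.

Lemma tpointP s t : triangle s -> triangle t -> (tpoint s = tpoint t <-> same_angles s t).
Proof.
move=> hs ht; split; first exact: tpoint_same_angles.
have pi0 := pi_gt0 R.
(* The two vertices are glued through (2 pi, 0). *)
have v : tpoint (0, 0) = tpoint (2 * pi, 2 * pi :> R).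
  by rewrite (@tpoint_side 0) ?(@tpoint_side (2 * pi)) //; lra.
case/(same_angles_cases hs ht) => [->|[e1 e2 e3]|[e1 e2 e3]|[[-> ->]|[-> ->]]] //.
- case: s t hs ht e1 e2 e3 => s1 s2 [t1 t2] /= hs ht -> -> ->.
  by apply: tpoint_side; case: hs => /=; lra.
- case: s t hs ht e1 e2 e3 => s1 s2 [t1 t2] /= hs ht -> -> ->.
  by apply/esym/tpoint_side; case: ht => /=; lra.
Qed.

End TrianglePoints.

(** * Elimination of the quotient map *)

Section Reduction.
Context {R : realType}.
Variables (J : 'M[CC R]_3) (HJ : signature_ppm J) (a1 a2 : R).
Implicit Types (p : 'cV[CC R]_3) (s t z : R * R) (P : set 'cV[CC R]_3).
Local Notation F p1 p2 := (product J (expi a1) (expi a2) p1 p2).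

Lemma angle_point_has_angles (g : SU J) z : triangle z ->
  elliptic_or_boundary_classes J (class_of g) -> angle_point J (class_of g) (tpoint z) ->
  has_angles J (val g) z.
Proof.
move=> hz _ [h [t [gh ht] [s [hs st] sz]]].
have hS := set_mem (valP h).
have := angle_pair_has_angles HJ hS ht => /(rho_has_angles HJ) => /(_ g).
rewrite gh => /(_ erefl); apply: same_angles_has_angles.
apply: same_angles_sym; apply: same_angles_trans st; apply: same_angles_sym.
exact: tpoint_same_angles.
Qed.

Lemma has_angles_angle_point (g : SU J) z : triangle z -> has_angles J (val g) z ->
  elliptic_or_boundary_classes J (class_of g) /\ angle_point J (class_of g) (tpoint z).
Proof.
move=> hz gz; have gS := set_mem (valP g).
have [eb [t gt]] := has_angles_angle_pair HJ gS gz.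
split; first by exists g.
exists g, t; first by [].
exists z => //; split=> //.
exact: (has_angles_same HJ gS gz (angle_pair_has_angles HJ gS gt)).
Qed.

(** Angles pass along a fiber by [rho_has_angles]; conversely a product with angles [s] witnesses
    its own membership. *)
Lemma EtriP P1 P2 q :
  Etri J (expi a1) (expi a2) P1 P2 q <->
  exists p1 p2 s, [/\ SU J (F p1 p2), P1 p1 /\ P2 p2, triangle s, q = tpoint s &
    has_angles J (F p1 p2) s].
Proof.
split.
- move=> [c [ebc [d [ebd [h [p1 [p2 [h1 h2 hE]]] hd]] dc] [g [t [cg gt] [s [hs st] sq]]]]].
  exists p1, p2, s; rewrite /product -hE; split=> //.
    exact: set_mem (valP h).
  have gz := same_angles_has_angles (same_angles_sym st)
    (angle_pair_has_angles HJ (set_mem (valP g)) gt).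
  by apply: (rho_has_angles HJ (g := g)) gz; rewrite -cg -dc -hd.
- move=> [p1 [p2 [s [FS [h1 h2] hs -> Fs]]]].
  pose h : SU J := SigSub (mem_set FS).
  have [eb ap] := @has_angles_angle_point h s hs Fs.
  exists (class_of h); split=> //; exists (class_of h) => //; split=> //.
  by exists h => //; exists p1, p2.
Qed.

Lemma correspondingP P1 P2 z c : triangle z ->
  corresponding J (expi a1) (expi a2) P1 P2 (tpoint z) c <->
  exists (g : SU J) p1 p2, [/\ c = class_of g, val g = F p1 p2, P1 p1, P2 p2 &
    has_angles J (val g) z].
Proof.
move=> hz; split.
- move=> [[d [ebd dq cd]] [g [p1 [p2 [h1 h2 gE]]] gc]].
  exists g, p1, p2; split=> //.
  case: ebd => h hb hd; apply: (rho_has_angles HJ (g := h)); first by rewrite hd gc cd.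
  by apply: angle_point_has_angles; rewrite ?hd //; exists h.
- move=> [g [p1 [p2 [-> gE h1 h2 gz]]]].
  have [eb ap] := has_angles_angle_point hz gz.
  by split; [exists (class_of g) | exists g => //; exists p1, p2].
Qed.

Lemma Etri_image P1 P2 (L : set (R * R)) : (forall z, L z -> triangle z) ->
  (forall p1 p2 s, P1 p1 -> P2 p2 -> SU J (F p1 p2) -> has_angles J (F p1 p2) s ->
    exists2 z, L z & same_angles s z) ->
  (forall z, L z -> exists p1 p2, [/\ P1 p1, P2 p2, SU J (F p1 p2) &
    has_angles J (F p1 p2) z]) ->
  Etri J (expi a1) (expi a2) P1 P2 = @tpoint R @` L.
Proof.
move=> LT H1 H2; apply/seteqP; split=> q.
- move=> /EtriP[p1 [p2 [s [FS [h1 h2] hs -> Fs]]]].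
  have [z Lz sz] := H1 _ _ _ h1 h2 FS Fs.
  by exists z => //; apply/esym/tpointP => //; exact: LT.
- move=> [z Lz <-]; have [p1 [p2 [h1 h2 FS Fz]]] := H2 z Lz.
  by apply/EtriP; exists p1, p2, z; split=> //; exact: LT.
Qed.

End Reduction.

(** * Pairs of centers with prescribed tau, and their classes *)

Section Realization.
Context {R : realType}.
Variables (J : 'M[CC R]_3) (HJ : signature_ppm J).
Implicit Types (p q e f : 'cV[CC R]_3) (a b t : R).
Local Notation "<< x , y >>" := (form J x y).

(** The combination [p] has square r, and its tau with [e] is a^2 / (eps r), which the last
    hypothesis prescribes. *)
Lemma pair_with_tau e f (eps eta t : R) : <<e, e>> = eps%:C%C -> <<f, f>> = eta%:C%C ->
  <<e, f>> = 0 -> eps ^+ 2 = 1 -> forall a b r, a ^+ 2 * eps + b ^+ 2 * eta = r ->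
  r != 0 -> a ^+ 2 = t * eps * r ->
  let p := a%:C%C *: e + b%:C%C *: f in
  <<p, p>> = r%:C%C /\ tau J e p = t%:C%C.
Proof.
move=> ee ff ef eps1 a b r rE; rewrite -rE => n0 tE p.
have cr (x : R) : (x%:C%C : CC R)^* = x%:C%C by apply/CrealP; rewrite complex_real.
have pp : <<p, p>> = (a ^+ 2 * eps + b ^+ 2 * eta)%:C%C.
  rewrite /p !formE !cr ee ff ef (formC0 HJ ef) !mulr0 addr0 add0r.
  by rewrite -!rmorphM -rmorphD /= !mulrA -!expr2.
split=> //; rewrite /tau pp ee.
have -> : <<e, p>> = (a * eps)%:C%C by rewrite /p !formE !cr ee ef mulr0 addr0 -rmorphM.
have -> : <<p, e>> = (a * eps)%:C%C by rewrite /p !formE ee (formC0 HJ ef) mulr0 addr0 -rmorphM.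
rewrite -!rmorphM -fmorphV -rmorphM /=; congr (_%:C)%C.
have eps0 : eps != 0 by apply: contra_eq_neq eps1 => ->; rewrite expr0n /= eq_sym oner_eq0.
apply: (@mulIf _ (eps * (a ^+ 2 * eps + b ^+ 2 * eta))); first by rewrite mulf_neq0.
rewrite divfK ?mulf_neq0 // mulrACA -!expr2 eps1 mulr1 mulrA.
exact: tE.
Qed.

Lemma real_signs (x : R) : ((0 : CC R) < x%:C%C) = (0 < x) /\ (x%:C%C < (0 : CC R)) = (x < 0).
Proof. by rewrite !ltcE /= eqxx. Qed.

Lemma negative_pair t : 1 <= t -> exists p1 p2,
  [/\ <<p1, p1>> < 0, <<p2, p2>> < 0 & tau J p1 p2 = t%:C%C].
Proof.
move=> t1; have [e1 [e2 [e3 [[e11 e22 e33] [e12 e13 e23] _]]]] := signature_basis HJ.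
have e33' : <<e3, e3>> = (-1)%:C%C by rewrite e33 rmorphN1.
have e11' : <<e1, e1>> = 1%:C%C by rewrite e11 rmorph1.
have s1 : Num.sqrt t ^+ 2 = t by rewrite sqr_sqrtr //; lra.
have s2 : Num.sqrt (t - 1) ^+ 2 = t - 1 by rewrite sqr_sqrtr //; lra.
have c1 : (-1 : R) ^+ 2 = 1 by rewrite sqrrN expr1n.
have c2 : Num.sqrt t ^+ 2 * -1 + Num.sqrt (t - 1) ^+ 2 * 1 = -1 by rewrite s1 s2; lra.
have [||pp tE] := pair_with_tau (t := t) e33' e11' (formC0 HJ e13) c1 c2.
- by rewrite oppr_eq0 oner_eq0.
- by rewrite s1; lra.
exists e3; eexists; split; [| |exact: tE].
  by rewrite e33' (real_signs _).2; lra.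
by rewrite pp (real_signs _).2; lra.
Qed.

(** The second center is taken in a positive plane for t <= 1 and in a hyperbolic one for t > 1. At
    t = 1 this gives coinciding centers, as the last clause records; the degenerate pair is built in
    [tangent_pair]. *)
Lemma positive_pair t : 0 <= t -> exists p1 p2,
  [/\ 0 < <<p1, p1>>, 0 < <<p2, p2>>, tau J p1 p2 = t%:C%C & t = 1 -> reject J p1 p2 = 0].
Proof.
move=> t0; have [e1 [e2 [e3 [[e11 e22 e33] [e12 e13 e23] _]]]] := signature_basis HJ.
have e33' : <<e3, e3>> = (-1)%:C%C by rewrite e33 rmorphN1.
have e11' : <<e1, e1>> = 1%:C%C by rewrite e11 rmorph1.
have e22' : <<e2, e2>> = 1%:C%C by rewrite e22 rmorph1.
have s1 : Num.sqrt t ^+ 2 = t by rewrite sqr_sqrtr.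
have [t1|t1] := leP t 1.
  have s2 : Num.sqrt (1 - t) ^+ 2 = 1 - t by rewrite sqr_sqrtr //; lra.
  have c1 : (1 : R) ^+ 2 = 1 by rewrite expr1n.
  have c2 : Num.sqrt t ^+ 2 * 1 + Num.sqrt (1 - t) ^+ 2 * 1 = 1 by rewrite s1 s2; lra.
  have [||pp tE] := pair_with_tau (t := t) e11' e22' e12 c1 c2.
  - by rewrite oner_eq0.
  - by rewrite s1; lra.
  exists e1; eexists; split; [| |exact: tE|].
  - by rewrite e11' (real_signs _).1; lra.
  - by rewrite pp (real_signs _).1; lra.
  - move=> ->; rewrite subrr sqrtr0 sqrtr1 rmorph0 rmorph1 scale0r addr0 scale1r.
    by rewrite /reject divff ?scale1r ?subrr // e11 oner_eq0.
have s2 : Num.sqrt (t - 1) ^+ 2 = t - 1 by rewrite sqr_sqrtr //; lra.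
have c1 : (1 : R) ^+ 2 = 1 by rewrite expr1n.
have c2 : Num.sqrt t ^+ 2 * 1 + Num.sqrt (t - 1) ^+ 2 * -1 = 1 by rewrite s1 s2; lra.
have [||pp tE] := pair_with_tau (t := t) e11' e33' e13 c1 c2.
- by rewrite oner_eq0.
- by rewrite s1; lra.
exists e1; eexists; split; [| |exact: tE|].
- by rewrite e11' (real_signs _).1; lra.
- by rewrite pp (real_signs _).1; lra.
- by move=> t1'; move: t1; rewrite t1' ltxx.
Qed.

Lemma tangent_pair : exists p1 p2,
  [/\ 0 < <<p1, p1>>, 0 < <<p2, p2>>, tau J p1 p2 = 1 & reject J p1 p2 != 0].
Proof.
have [e1 [e2 [e3 [[e11 e22 e33] [e12 e13 e23] _]]]] := signature_basis HJ.
have nE : reject J e1 (e1 + (e2 + e3)) = e2 + e3.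
  rewrite /reject !formDl e11 (formC0 HJ e12) (formC0 HJ e13) !addr0 divr1 scale1r.
  by rewrite addrAC subrr add0r.
have pp : <<e1 + (e2 + e3), e1 + (e2 + e3)>> = 1.
  rewrite !formE e11 e22 e33 e12 e13 e23 (formC0 HJ e12) (formC0 HJ e13) (formC0 HJ e23).
  by rewrite !addr0 !add0r; ring.
exists e1, (e1 + (e2 + e3)); split.
- by rewrite e11 ltr01.
- by rewrite pp ltr01.
- rewrite /tau pp e11 !formDl !formDr e11 e12 e13 (formC0 HJ e12) (formC0 HJ e13).
  by rewrite !addr0 !mulr1 divr1.
- rewrite nE; apply/eqP => E; have : <<e2 + e3, e2>> = 1.
    by rewrite formDl e22 (formC0 HJ e23) addr0.
  by rewrite E form0l => /eqP; rewrite eq_sym oner_eq0.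
Qed.

Lemma mixed_pair t : t <= 0 -> exists p1 p2,
  [/\ 0 < <<p1, p1>>, <<p2, p2>> < 0 & tau J p1 p2 = t%:C%C].
Proof.
move=> t0; have [e1 [e2 [e3 [[e11 e22 e33] [e12 e13 e23] _]]]] := signature_basis HJ.
have e33' : <<e3, e3>> = (-1)%:C%C by rewrite e33 rmorphN1.
have e11' : <<e1, e1>> = 1%:C%C by rewrite e11 rmorph1.
have s1 : Num.sqrt (- t) ^+ 2 = - t by rewrite sqr_sqrtr //; lra.
have s2 : Num.sqrt (1 - t) ^+ 2 = 1 - t by rewrite sqr_sqrtr //; lra.
have c1 : (1 : R) ^+ 2 = 1 by rewrite expr1n.
have c2 : Num.sqrt (- t) ^+ 2 * 1 + Num.sqrt (1 - t) ^+ 2 * -1 = -1 by rewrite s1 s2; lra.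
have [||pp tE] := pair_with_tau (t := t) e11' e33' e13 c1 c2.
- by rewrite oppr_eq0 oner_eq0.
- by rewrite s1; lra.
exists e1; eexists; split; [| |exact: tE].
- by rewrite e11' (real_signs _).1; lra.
- by rewrite pp (real_signs _).2; lra.
Qed.

Variables (a1 a2 : R).
Local Notation F p1 p2 := (product J (expi a1) (expi a2) p1 p2).

Lemma same_tau_class p1 p2 q1 q2 (g h : SU J) (t : R) :
  same_sign J p1 q1 -> same_sign J p2 q2 -> tau J p1 p2 = t%:C%C ->
  tau J q1 q2 = t%:C%C -> t != 1 -> val g = F p1 p2 -> val h = F q1 q2 ->
  class_of g = class_of h.
Proof.
move=> s1 s2 tp tq t1 gE hE.
have tE : tau J p1 p2 = tau J q1 q2 by rewrite tp tq.
have tn : tau J p1 p2 != 1.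
  by rewrite tp -(rmorph1 (real_complex R)) (inj_eq (fmorph_inj _)).
have [k [c1 [c2 [kS c10 c20 k1 k2]]]] := pair_transport HJ s1 s2 tE tn.
exact: (product_class kS c10 c20 k1 k2 gE hE).
Qed.

Lemma same_point_class p1 p2 q1 q2 (g h : SU J) : same_sign J p1 q1 ->
  <<p2, p2>> != 0 -> <<q2, q2>> != 0 -> reject J p1 p2 = 0 -> reject J q1 q2 = 0 ->
  val g = F p1 p2 -> val h = F q1 q2 -> class_of g = class_of h.
Proof.
move=> s1 p20 q20 /reject_eq0 p2E /reject_eq0 q2E gE hE.
have [k [c [kS c0 k1]]] := point_transport HJ s1.
have a0 := proportional_neq0 p20 p2E; have b0 := proportional_neq0 q20 q2E.
move: (_ / _) (_ / _) a0 b0 p2E q2E => b a a0 b0 p2E q2E.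
have ac0 : a * c / b != 0 by rewrite !mulf_neq0 ?invr_eq0.
apply: (product_class kS c0 ac0 k1 _ gE hE).
by rewrite p2E q2E -scalemxAr k1 !scalerA divfK.
Qed.

Lemma tangent_class p1 p2 q1 q2 (g h : SU J) :
  0 < <<p1, p1>> -> 0 < <<p2, p2>> -> 0 < <<q1, q1>> -> 0 < <<q2, q2>> ->
  tau J p1 p2 = 1 -> tau J q1 q2 = 1 -> reject J p1 p2 != 0 -> reject J q1 q2 != 0 ->
  val g = F p1 p2 -> val h = F q1 q2 -> class_of g = class_of h.
Proof.
move=> h1 h2 h3 h4 t1 t2 r1 r2 gE hE.
have [k [c1 [c2 [kS c10 c20 k1 k2]]]] := tangent_pair_transport HJ h1 h2 h3 h4 t1 t2 r1 r2.
exact: (product_class kS c10 c20 k1 k2 gE hE).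
Qed.

End Realization.

(** * Kinds of isometries *)

Section Kinds.
Context {R : realType}.
Variables (J : 'M[CC R]_3) (HJ : signature_ppm J).
Implicit Types (g : 'M[CC R]_3) (x y p q v e n m : 'cV[CC R]_3).
Implicit Types (alpha : CC R) (s : R * R).
Local Notation "<< x , y >>" := (form J x y).

(** P = p p^* J satisfies P^2 = <p, p> P, so reflections with one center multiply like their
    parameters. *)
Lemma reflection_mul alpha1 alpha2 p : <<p, p>> != 0 -> alpha1 != 0 -> alpha2 != 0 ->
  complex_reflection J alpha2 p *m complex_reflection J alpha1 p =
  complex_reflection J (alpha1 * alpha2) p.
Proof.
move=> p0 n1 n2; rewrite /complex_reflection; set P := p *m adj p *m J.
have PP : P *m P = <<p, p>> *: P.
  have -> : P *m P = p *m (adj p *m J *m p) *m (adj p *m J) by rewrite !mulmxA.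
  by rewrite (mx11_scalar (adj p *m J *m p)) mul_mx_scalar -scalemxAl mulmxA.
move: P PP => P PP; rewrite mulmxDl !mulmxDr -scalemxAl -scalemxAr PP.
rewrite mul_mx_scalar mul_scalar_mx -scalar_mxM [alpha2 * _]mulrC !scalerA addrA.
rewrite -!scalerDl; congr (_ *: _ + _).
by move: <<p, p>> p0 => d d0; field; rewrite d0 n1 n2.
Qed.

Lemma reflection_special_elliptic alpha p : parameter alpha -> <<p, p>> != 0 ->
  special_elliptic J (complex_reflection J alpha p).
Proof.
move=> [a1 a3] p0; have a0 := unit_neq0 a1.
have ne : alpha ^- 2 != alpha.
  apply/eqP => E; apply: a3; rewrite /Omega /=.
  by rewrite exprS -{1}E mulVf // expf_neq0.
split.
  split.
    move=> [c _ gE]; have [x x0 [xp _]] := orthogonal_vector J p p.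
    have := reflection_orthogonal alpha xp; rewrite gE mul_scalar_mx => /(scaler_inj x0) ca.
    have := reflection_center alpha p0; rewrite gE mul_scalar_mx ca.
    by move=> /(scaler_inj (form_neq0 p0)) E; rewrite -E eqxx in ne.
  have [p_le|p_gt] := orP (form_le0Vgt0 HJ p).
    by exists p; [rewrite /negative /= lt_neqAle p0 | exists (alpha ^- 2); exact: reflection_center].
  have [f f_lt] := negative_vector HJ.
  exists (reject J p f); first exact: negative_reject.
  by exists alpha; apply: reflection_orthogonal; exact: reject_orthogonal.
move=> [_ [s [s3 us es]]].
(* An eigenvector is orthogonal to [p], with eigenvalue [alpha], or pairing it with [p] shows that
   its eigenvalue is [alpha ^- 2]. *)
have : {subset s <= [:: alpha; alpha ^- 2]}.
  move=> a /(allP es); rewrite eigenvalue_root_char => /root_eigenvector[x x0 gx].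
  rewrite !inE; have [xp|xp] := eqVneq <<x, p>> 0.
    by move: gx; rewrite (reflection_orthogonal _ xp) => /(scaler_inj x0) ->; rewrite eqxx.
  have := congr1 (fun y => <<y, p>>) gx; rewrite complex_reflectionE !formE => E.
  apply/orP; right; apply/eqP; apply: (mulIf xp); rewrite -E.
  by move: <<p, p>> <<x, p>> p0 => d e d0; field; rewrite a0 d0.
by move=> /(uniq_leq_size us); rewrite s3.
Qed.

Lemma reflection_special_center (P : set 'cV[CC R]_3) alpha p : parameter alpha -> <<p, p>> != 0 ->
  P p -> special_elliptic_center J P (complex_reflection J alpha p).
Proof.
move=> ha p0 Pp; split; first exact: reflection_special_elliptic.
by exists alpha, p, 1; split=> //; rewrite ?scale1r // /Omega /= expr1n.
Qed.

Lemma reflection_identical alpha p : Omega alpha -> identical (complex_reflection J alpha p).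
Proof.
move=> a3; exists alpha => //; rewrite /complex_reflection.
have a0 : alpha != 0 by apply: unit_neq0; exact: Omega_norm1.
have -> : alpha ^- 2 = alpha.
  by apply: (mulfI (expf_neq0 2 a0)); rewrite mulfV ?expf_neq0 // -exprSr a3.
by rewrite subrr mul0r scale0r add0r.
Qed.

Lemma ellipto_parabolic_of_angles g s : SU J g -> has_angles J g s ->
  ~ same_angles s (0, 0) -> (forall p, <<p, p>> < 0 -> ~ fixes g p) ->
  ellipto_parabolic J g.
Proof.
move=> gS gs s0 noneg; split; first exact: (parabolic_of_angles HJ gS gs noneg).
by move=> /(unipotent_angles HJ gS)/(has_angles_same HJ gS gs)/s0.
Qed.

(** Without a negative fixed point, the phase would be a multiple eigenvalue by
    [isotropic_eigenvalue_multiple]. *)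
Lemma regular_elliptic_of_angles g s : SU J g -> has_angles J g s ->
  expi s.1 != 1 :> CC R -> expi s.2 != 1 :> CC R -> expi s.1 != expi s.2 :> CC R ->
  regular_elliptic J g.
Proof.
move=> gS gs n1 n2 n12.
have [mu [ph gE [v [v0 v_le gv]]]] := has_angles_char_poly HJ gS gs.
have m0 := unit_neq0 ph.1.
have e1 : mu != mu * expi s.1 by rewrite -{1}[mu]mulr1 (inj_eq (mulfI m0)) eq_sym.
have e2 : mu != mu * expi s.2 by rewrite -{1}[mu]mulr1 (inj_eq (mulfI m0)) eq_sym.
have e12 : mu * expi s.1 != mu * expi s.2 by rewrite (inj_eq (mulfI m0)).
split; last first.
  exists [:: mu; mu * expi s.1; mu * expi s.2]; split=> //.
    by rewrite /= !inE negb_or e1 e2 e12.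
  by rewrite /= !eigenvalue_root_char gE !root_cubic !eqxx !orbT.
split.
  move=> [c _ gc]; have rt a : root (char_poly g) a -> a = c.
    by move=> /root_eigenvector[x x0]; rewrite gc mul_scalar_mx => /(scaler_inj x0).
  by case/eqP: e1; rewrite [LHS]rt ?[RHS]rt // gE root_cubic !eqxx ?orbT.
apply: contrapT => noneg.
have {}noneg p : <<p, p>> < 0 -> ~ fixes g p by move=> ? ?; apply: noneg; exists p.
have [E|E] := isotropic_eigenvalue_multiple HJ gS gE ph.1 v0 v_le gv noneg.
  by case/eqP: e1.
by case/eqP: e2.
Qed.

(* An eigenvector in the image of [g - lam] is orthogonal to every eigenvector
   for lam. *)
Lemma jordan_no_negative g lam x v : SU J g -> `|lam| = 1 ->
  g *m x = lam *: x + v -> g *m v = lam *: v -> v != 0 ->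
  forall p, <<p, p>> < 0 -> ~ fixes g p.
Proof.
move=> gS l1 gx gv v0 p p_lt [nu gp].
have orth y : g *m y = lam *: y -> <<v, y>> = 0.
  move=> gy; have := SU_form x y gS; rewrite gx gy !formE => /eqP.
  rewrite mulrA -normCK l1 expr1n mul1r.
  rewrite -subr_eq0 addrAC subrr add0r mulf_eq0 conjC_eq0 (negPf (unit_neq0 l1)) /=.
  by move=> /eqP.
have vv := orth v gv.
have v_le : <<v, v>> <= 0 by rewrite vv.
have nuE := phase_unique HJ gS (negative_eigenvector_phase gS p_lt gp)
  (unit_eigenvector_phase gS v0 v_le l1 gv).
rewrite nuE in gp; have := orthogonal_to_negative HJ p_lt (orth p gp) v0.
by rewrite vv ltxx.
Qed.

(** Cayley-Hamilton for the 2 by 2 matrix of [g] on [p] and [q], whose characteristic polynomial is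
    (X - lam)^2. *)
Lemma double_root_image g p q (a b c d lam : CC R) : g *m p = a *: p + b *: q ->
  g *m q = c *: p + d *: q -> a + d = 2 * lam -> a * d - b * c = lam ^+ 2 ->
  g *m (g *m p - lam *: p) = lam *: (g *m p - lam *: p).
Proof.
move=> gp gq tr det.
have -> : g *m p - lam *: p = (a - lam) *: p + b *: q by rewrite gp scalerBl addrAC.
rewrite mulmxDr -!scalemxAr gp gq.
apply/matrixP => i j; rewrite !mxE; apply/eqP; rewrite -subr_eq0; apply/eqP.
move: (p i j) (q i j) => x y.
transitivity ((a * x + b * y) * (a + d - 2 * lam) - (a * d - b * c - lam ^+ 2) * x); first ring.
by rewrite tr det !subrr mulr0 mul0r subr0.
Qed.

End Kinds.

Section ProductKinds.
Context {R : realType}.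
Variables (J : 'M[CC R]_3) (HJ : signature_ppm J) (a1 a2 : R).
Hypotheses (Ha1 : 0 < a1 < 2 * pi / 3) (Ha2 : 0 < a2 < 2 * pi / 3).
Implicit Types (g k : 'M[CC R]_3) (x y z p v e n m : 'cV[CC R]_3).
Implicit Types (psi t : R).
Local Notation "<< x , y >>" := (form J x y).
Local Notation formC0 := (formC0 HJ).
Local Notation F p1 p2 := (product J (expi a1) (expi a2) p1 p2).
Local Notation S := (3 * (a1 + a2) / 2).
Local Notation kap := (kappa a1 a2).

Lemma reject_independent p1 p2 (c d : CC R) : <<p1, p1>> != 0 -> reject J p1 p2 != 0 ->
  c *: p2 + d *: p1 = 0 -> c = 0 /\ d = 0.
Proof.
move=> p10 n0 E; have c0 : c = 0.
  apply/eqP/negPn; apply/negP => c0; case/eqP: n0.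
  have p2E : p2 = (- d / c) *: p1.
    by apply: (scalerI c0); rewrite scalerA mulrCA divff // mulr1 scaleNr; apply/eqP; rewrite -addr_eq0 E.
  by rewrite /reject p2E formZl mulfK // subrr.
split=> //; move: E; rewrite c0 scale0r add0r => /eqP.
by rewrite scaler_eq0 (negPf (form_neq0 p10)) orbF => /eqP.
Qed.

Lemma reject_neq0 p1 p2 : <<p1, p1>> != 0 -> <<p2, p2>> != 0 -> tau J p1 p2 != 1 ->
  reject J p1 p2 != 0.
Proof.
move=> p10 p20; apply: contra_neq => n0; have := reject_square HJ p10 p20.
rewrite n0 form0l => /esym/eqP; rewrite mulf_eq0 (negPf p20) /= subr_eq0.
by move=> /eqP.
Qed.

(** F x - e^{i (a1 + a2)} x is a combination of the centers, with coefficients proportional to <y,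
    p2> and <x, p1>, where y is the image of [x] under the first reflection; independence kills
    both. *)
Lemma axis_orthogonal p1 p2 x : <<p1, p1>> != 0 -> <<p2, p2>> != 0 ->
  reject J p1 p2 != 0 -> F p1 p2 *m x = expi (a1 + a2) *: x ->
  <<x, p1>> = 0 /\ <<x, p2>> = 0.
Proof.
move=> p10 p20 n0; rewrite /product -mulmxA complex_reflectionE.
have [b1 b2] := (b1_neq0 Ha1 Ha2, b2_neq0 Ha1 Ha2).
have [e1 e2] := (@expi_neq0 R a1, @expi_neq0 R a2).
set y := complex_reflection J (expi a1) p1 *m x => E.
have yE : y = (expi a1 ^- 2 - expi a1) * (<<x, p1>> / <<p1, p1>>) *: p1 + expi a1 *: x.
  by rewrite /y complex_reflectionE.
have := E; rewrite {2}yE scalerDr !scalerA -expiD [a2 + a1]addrC addrA => /eqP.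
rewrite -subr_eq0 addrK => /eqP /(reject_independent p10 n0)[].
move: <<p1, p1>> <<p2, p2>> p10 p20 => g1 g2 p10 p20 /eqP c0 /eqP d0.
have x1 : <<x, p1>> = 0.
  move: d0; rewrite mulf_eq0 (negPf e2) /= mulf_eq0 (negPf b1) /=.
  by rewrite mulf_eq0 invr_eq0 (negPf p10) orbF => /eqP.
split; [exact: x1 | move: c0]; rewrite mulf_eq0 (negPf b2) /= mulf_eq0 invr_eq0 (negPf p20) orbF.
by rewrite yE x1 mul0r mulr0 scale0r add0r formZl mulf_eq0 (negPf e1) /= => /eqP.
Qed.

Lemma tangent_axis p1 p2 : <<p1, p1>> != 0 -> <<p2, p2>> != 0 -> tau J p1 p2 = 1 ->
  [/\ <<reject J p1 p2, reject J p1 p2>> = 0, <<reject J p1 p2, p1>> = 0,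
      <<reject J p1 p2, p2>> = 0 &
      F p1 p2 *m reject J p1 p2 = expi (a1 + a2) *: reject J p1 p2].
Proof.
move=> p10 p20 t1; have np := reject_orthogonal p2 p10.
have nn : <<reject J p1 p2, reject J p1 p2>> = 0.
  by rewrite reject_square // t1 subrr mulr0.
have n2 : <<reject J p1 p2, p2>> = 0.
  have {2}-> : p2 = reject J p1 p2 + (<<p2, p1>> / <<p1, p1>>) *: p1 by rewrite subrK.
  by rewrite formDr nn formZr np mulr0 addr0.
by split=> //; exact: product_orthogonal.
Qed.

Lemma orthogonal_reject p1 p2 x : <<x, p1>> = 0 -> <<x, p2>> = 0 -> <<x, reject J p1 p2>> = 0.
Proof. by move=> x1 x2; rewrite /reject formDr formNr formZr x1 x2 mulr0 subr0. Qed.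

Lemma tangent_phase p1 p2 : <<p1, p1>> != 0 -> <<p2, p2>> != 0 ->
  tau J p1 p2 = 1 -> reject J p1 p2 != 0 -> phase J (F p1 p2) (expi (a1 + a2)).
Proof.
move=> p10 p20 t1 n0; have [nn _ _ gn] := tangent_axis p10 p20 t1.
have n_le : <<reject J p1 p2, reject J p1 p2>> <= 0 by rewrite nn.
exact: (unit_eigenvector_phase (product_SU HJ _ _ p10 p20) n0 n_le (norm_expi _) gn).
Qed.

(** A negative fixed vector would have the phase e^{i (a1 + a2)} as eigenvalue, hence be orthogonal
    to both centers and to the isotropic [reject J p1 p2], which is impossible. *)
Lemma tangent_no_negative p1 p2 : <<p1, p1>> != 0 -> <<p2, p2>> != 0 ->
  tau J p1 p2 = 1 -> reject J p1 p2 != 0 ->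
  forall e, <<e, e>> < 0 -> ~ fixes (F p1 p2) e.
Proof.
move=> p10 p20 t1 n0 e e_lt [nu ge]; have [nn _ _ gn] := tangent_axis p10 p20 t1.
have FS := product_SU HJ a1 a2 p10 p20.
have nuE := phase_unique HJ FS (negative_eigenvector_phase FS e_lt ge) (tangent_phase p10 p20 t1 n0).
rewrite nuE in ge; have [x1 x2] := axis_orthogonal p10 p20 n0 ge.
have := orthogonal_to_negative HJ e_lt (formC0 (orthogonal_reject x1 x2)) n0.
by rewrite nn ltxx.
Qed.

(** The hypothesis on [psi] makes the two eigenvalues on the span of the centers coincide. Then F p1
    - lam p1 is an eigenvector, nonzero because its [p2]-coefficient contains <p1, p2>; so [p1]
    starts a Jordan block. *)
Lemma double_eigenvalue_no_negative p1 p2 t psi : <<p1, p1>> != 0 -> <<p2, p2>> != 0 ->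
  tau J p1 p2 = t%:C%C -> t != 0 -> t != 1 -> cos psi = kap t ->
  expi psi = expi (- psi) :> CC R ->
  forall e, <<e, e>> < 0 -> ~ fixes (F p1 p2) e.
Proof.
move=> p10 p20 tE t0 t1 ck dbl; have FS := product_SU HJ a1 a2 p10 p20.
have n0 : reject J p1 p2 != 0.
  by apply: reject_neq0 => //; rewrite tE -(rmorph1 (real_complex R)) (inj_eq (@complexI _)).
pose lam : CC R := expi (psi - (a1 + a2) / 2).
have lam2 : lam ^+ 2 = (expi a1 * expi a2)^-1.
  rewrite -expiD -expiN expiX mulr2n.
  have -> : psi - (a1 + a2) / 2 + (psi - (a1 + a2) / 2) = psi + psi - (a1 + a2) by lra.
  by rewrite 2!expiD {2}dbl -expiD subrr expi0 mul1r.
have trE := product_trace_kappa a1 a2 p10 p20 tE.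
rewrite -ck expi_cos [2 * _]mulrC divfK ?pnatr_eq0 // -dbl mulrDr -expiD in trE.
have lamE : - (a1 + a2) / 2 + psi = psi - (a1 + a2) / 2 by lra.
rewrite lamE -/lam /product (product_trace _ _ p10 p20) tE expiD in trE.
have z0 : <<p1, p2>> != 0.
  apply: contra_neq t0 => z0; move: tE; rewrite /tau z0 2!mul0r.
  by move=> /esym/eqP; rewrite fmorph_eq0 => /eqP.
have Fp1 := product_p1 a1 a2 p2 p10.
have Fp2 := product_p2 a1 a2 p1 p20.
have [b1 b2] := (b1_neq0 Ha1 Ha2, b2_neq0 Ha1 Ha2).
have [e1 e2] := (@expi_neq0 R a1, @expi_neq0 R a2).
rewrite scalerDr !scalerA addrC in Fp1.
rewrite scalerDr !scalerA addrAC -scalerDl addrC in Fp2.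
have B0 : (expi a1 ^- 2) * ((expi a2 ^- 2 - expi a2) * (<<p1, p2>> / <<p2, p2>>)) != 0.
  have i1 : (expi a1 ^- 2 : CC R) != 0 by rewrite invr_eq0 expf_neq0.
  exact: (mulf_neq0 i1 (mulf_neq0 b2 (mulf_neq0 z0 (invr_neq0 p20)))).
apply: (@jordan_no_negative _ _ HJ _ lam p1 (F p1 p2 *m p1 - lam *: p1) FS).
- exact: norm_expi.
- by rewrite addrC subrK.
- apply: (double_root_image Fp1 Fp2).
    have -> : 2 * lam = lam + lam by rewrite mulr_natl mulr2n.
    apply: (addrI (expi a1 * expi a2)); rewrite -trE -tE /tau.
    move: <<p1, p1>> <<p2, p2>> <<p1, p2>> <<p2, p1>> (expi a1 : CC R) (expi a2 : CC R) p10 p20 e1 e2.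
    by move=> g1 g2 z z' u w g10 g20 u0 w0; field; rewrite g10 g20 u0 w0.
  rewrite lam2.
  move: <<p1, p1>> <<p2, p2>> <<p1, p2>> <<p2, p1>> (expi a1 : CC R) (expi a2 : CC R) p10 p20 e1 e2.
  by move=> g1 g2 z z' u w g10 g20 u0 w0; field; rewrite g10 g20 u0 w0.
- apply/eqP => v0; case/eqP: B0; move: v0; rewrite Fp1 -addrA addrC -addrA -scaleNr -scalerDl => v0.
  exact: (reject_independent p10 n0 v0).1.
Qed.

Lemma product_same_point p1 p2 : <<p1, p1>> != 0 -> <<p2, p2>> != 0 -> reject J p1 p2 = 0 ->
  F p1 p2 = complex_reflection J (expi (a1 + a2)) p1.
Proof.
move=> p10 p20 /reject_eq0 E; have c0 := proportional_neq0 p20 E.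
by rewrite /product E reflectionZ // reflection_mul ?expi_neq0 // expiD.
Qed.

(** The product is not scalar: it is alpha1^{-2} alpha2 on [p1] and alpha1 alpha2 on the negative
    axis. *)
Lemma orthogonal_elliptic p1 p2 : 0 < <<p1, p1>> -> 0 < <<p2, p2>> -> <<p1, p2>> = 0 ->
  elliptic J (F p1 p2).
Proof.
move=> p1_gt p2_gt z0; have [p10 p20] : <<p1, p1>> != 0 /\ <<p2, p2>> != 0 by rewrite !gt_eqF.
have [e [e_lt e1 e2 _]] := positive_plane_complement HJ p1_gt p2_gt z0.
have Fe := product_orthogonal a1 a2 e1 e2.
split; last by exists e => //; exists (expi (a1 + a2)).
move=> [c _ FE]; have ce : c = expi (a1 + a2).
  have e0 : e != 0 by apply: (@form_neq0 _ J); rewrite lt_eqF.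
  by move: Fe; rewrite FE mul_scalar_mx => /(scaler_inj e0).
have := product_p1 a1 a2 p2 p10; rewrite FE mul_scalar_mx z0 mul0r mulr0 scale0r add0r.
rewrite scalerA ce expiD => /(scaler_inj (form_neq0 p10))/(mulIf (expi_neq0 a2)) E.
by case/eqP: (b1_neq0 Ha1 Ha2); apply/eqP; rewrite subr_eq0 -E.
Qed.

Lemma eq_mx_basis (A B : 'M[CC R]_3) x y z : cols3 x y z \in unitmx ->
  A *m x = B *m x -> A *m y = B *m y -> A *m z = B *m z -> A = B.
Proof.
move=> M0 Ax Ay Az; apply/matrixP => i j.
have [a [b [c E]]] := cols3_span (delta_mx j 0) M0.
have : A *m delta_mx j 0 = B *m delta_mx j 0 :> 'cV[CC R]_3.
  by rewrite E !mulmxDr -!scalemxAr Ax Ay Az.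
by rewrite -!colE => /(congr1 (fun v : 'cV[CC R]_3 => v i 0)); rewrite !mxE.
Qed.

Lemma expi_parameter (a : R) : 0 < a < 2 * pi / 3 -> parameter (expi a).
Proof.
move=> /andP[h1 h2]; split; first exact: norm_expi.
rewrite /Omega /= expiX => /expi_eq1; rewrite -(mulr_natr a).
by case=> [|E|E]; lra.
Qed.

Lemma parameterV (alpha : CC R) : parameter alpha -> parameter alpha^-1.
Proof.
move=> [n1 no]; split; first by rewrite normfV n1 invr1.
by rewrite /Omega /= exprVn => E; apply: no; rewrite /Omega /= -[LHS]invrK E invr1.
Qed.

(** With alpha1 = alpha2 = alpha, the product is alpha^{-1} on both centers and alpha^2 on the
    vector [c] orthogonal to them, so it is the reflection of parameter alpha^{-1} with center
    [c]. *)
Lemma orthogonal_special_center p1 p2 : a1 = a2 -> <<p1, p1>> != 0 -> <<p2, p2>> < 0 ->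
  <<p1, p2>> = 0 -> special_elliptic_center J (positive J) (F p1 p2).
Proof.
move=> a12 p10 p2_lt z0; have p20 : <<p2, p2>> != 0 by rewrite lt_eqF.
have [c c0 [c1 c2]] := orthogonal_vector J p1 p2.
have c_gt := orthogonal_to_negative HJ p2_lt c2 c0.
have cc0 : <<c, c>> != 0 by rewrite gt_eqF.
have e0 := @expi_neq0 R a2.
have -> : F p1 p2 = complex_reflection J (expi a2)^-1 c.
  apply: (eq_mx_basis (orthogonal_frame_unit HJ p10 p20 cc0 z0 (formC0 c1) (formC0 c2))).
  - rewrite product_p1 // z0 mul0r mulr0 scale0r add0r reflection_orthogonal ?(formC0 c1) //.
    by rewrite scalerA a12; congr (_ *: _); move: (expi a2) e0 => u u0; field.
  - rewrite product_p2 // (formC0 z0) mul0r mulr0 scale0r add0r reflection_orthogonal ?(formC0 c2) //.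
    by rewrite a12; congr (_ *: _); move: (expi a2) e0 => u u0; field.
  - rewrite (product_orthogonal a1 a2 c1 c2) reflection_center // a12 expiD.
    by congr (_ *: _); move: (expi a2) e0 => u u0; field.
by apply: reflection_special_center => //; apply: parameterV; exact: expi_parameter.
Qed.

(** All eigenvalues equal one cube root of unity, and by [axis_orthogonal] every eigenvector lies on
    the isotropic line orthogonal to the centers. *)
Lemma tangent_three_step p1 p2 : 0 < <<p1, p1>> -> 0 < <<p2, p2>> -> tau J p1 p2 = 1 ->
  reject J p1 p2 != 0 -> a1 + a2 = 2 * pi / 3 -> three_step_unipotent J (F p1 p2).
Proof.
move=> p1_gt p2_gt t1 n0 Aeq.
have [p10 p20] : <<p1, p1>> != 0 /\ <<p2, p2>> != 0 by rewrite !gt_eqF.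
have FS := product_SU HJ a1 a2 p10 p20.
have [nn n1 n2 gn] := tangent_axis p10 p20 t1.
have ph := tangent_phase p10 p20 t1 n0.
have noneg := tangent_no_negative p10 p20 t1 n0.
have Spi : S = pi by rewrite Aeq; lra.
have F0 : has_angles J (F p1 p2) (0, 0).
  have t1' : tau J p1 p2 = 1%:C%C by rewrite t1 rmorph1.
  have ck : cos (S : R) = kap 1 by rewrite kappa1.
  have := positive_positive_axis_angles HJ p1_gt p2_gt t1' (lexx _) ck.
  apply: same_angles_has_angles; left => /=; split; first by congr expi; lra.
  have -> : - S - S = - (2 * pi) by lra.
  by rewrite expiN expi2pi expi0 invr1.
have [mu [ph' gE _]] := has_angles_char_poly HJ FS F0.
have muE := phase_unique HJ FS ph' ph.
rewrite /= expi0 mulr1 muE in gE.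
have par := parabolic_of_angles HJ FS F0 noneg.
set w : CC R := expi (a1 + a2) in ph ph' gE gn muE.
have w3 : w ^+ 3 = 1.
  rewrite expiX Aeq.
  have -> : 2 * pi / 3 *+ 3 = 2 * pi :> R by rewrite -(mulr_natr (2 * pi / 3)); lra.
  by rewrite expi2pi expi0.
have w0 : w != 0 by exact: expi_neq0.
split; [split=> // | exists (reject J p1 p2); split].
- exists w^-1; first by rewrite /Omega /= exprVn w3 invr1.
  exists 3.
  have -> : w^-1 *: F p1 p2 - 1%:M = w^-1 *: (F p1 p2 - w%:M).
    by rewrite scalerBr scale_scalar_mx mulVf.
  rewrite exprZn; have -> : (F p1 p2 - w%:M) ^+ 3 = 0; last by rewrite scaler0.
  by rewrite -[RHS](cubic_annihilates gE) exprS expr2 mulrA.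
- by split; [exact: n0 | exact: nn].
- by exists w.
- move=> x x0 [nu gx]; have := eigenvector_root x0 gx.
  rewrite gE root_cubic !orbb => /eqP nuE; rewrite nuE in gx.
  have [x1 x2] := axis_orthogonal p10 p20 n0 gx.
  have xn := orthogonal_reject x1 x2.
  have n_le : <<reject J p1 p2, reject J p1 p2>> <= 0 by rewrite nn.
  have [x_le|x_gt] := orP (form_le0Vgt0 HJ x).
    by have [k ->] := nonpositive_orthogonal HJ n0 n_le x_le (formC0 xn); exists k.
  (* A positive [x] would put the isotropic direction on the negative line orthogonal to [p1] and
     [x]. *)
  have [e [e_lt _ _ ek]] := positive_plane_complement HJ p1_gt x_gt (formC0 x1).
  have [k kE] := ek _ n1 (formC0 xn).
  case/eqP: n0; rewrite kE.
  move: nn; rewrite kE formZl formZr => /eqP; rewrite !mulf_eq0 conjC_eq0.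
  by rewrite (lt_eqF e_lt) orbF orbb => /eqP ->; rewrite scale0r.
Qed.

End ProductKinds.

(** * Segments *)

Section Families.
Context {R : realType}.
Variables (J : 'M[CC R]_3) (HJ : signature_ppm J) (a1 a2 : R).
Hypotheses (Ha1 : 0 < a1 < 2 * pi / 3) (Ha2 : 0 < a2 < 2 * pi / 3).
Implicit Types (x y z p q v e n m : 'cV[CC R]_3) (P : set 'cV[CC R]_3).
Implicit Types (psi t : R).
Local Notation "<< x , y >>" := (form J x y).
Local Notation F p1 p2 := (product J (expi a1) (expi a2) p1 p2).
Local Notation S := (3 * (a1 + a2) / 2).
Local Notation delta := (3 * (a1 - a2) / 2).
Local Notation kap := (kappa a1 a2).
Local Notation cor := (corresponding J (expi a1) (expi a2)).
Local Notation cor_to := (corresponds_to J (expi a1) (expi a2)).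
Local Notation alpha1 := (expi a1).
Local Notation alpha2 := (expi a2).

(* The point [Z i] is the angle pair of the products with [kappa = c i]. *)
Definition angle_family {I : Type} P1 P2 (L : set I) (c : I -> R) (Z : I -> R * R) : Prop :=
  [/\ (forall p q, P1 p -> P1 q -> same_sign J p q) /\
      (forall p q, P2 p -> P2 q -> same_sign J p q),
      forall i, L i -> triangle (Z i) /\
        exists p1 p2 t, [/\ P1 p1, P2 p2, tau J p1 p2 = t%:C%C & kap t = c i],
      forall p1 p2 t, P1 p1 -> P2 p2 -> tau J p1 p2 = t%:C%C -> -1 <= kap t <= 1 ->
        exists2 i, L i & kap t = c i
    & forall p1 p2 t i, P1 p1 -> P2 p2 -> tau J p1 p2 = t%:C%C -> L i -> kap t = c i ->
        has_angles J (F p1 p2) (Z i)].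

Lemma same_sign_neq0 p q : same_sign J p q -> <<p, p>> != 0 /\ <<q, q>> != 0.
Proof. by case=> -[p0 q0]; [rewrite !gt_eqF|rewrite !lt_eqF]. Qed.

Section Family.
Variables (I : Type) (P1 P2 : set 'cV[CC R]_3) (L : set I) (c : I -> R) (Z : I -> R * R).
Hypothesis fam : angle_family P1 P2 L c Z.

Lemma family_neq0 p1 p2 : P1 p1 -> P2 p2 -> <<p1, p1>> != 0 /\ <<p2, p2>> != 0.
Proof.
case: fam => -[s1 s2] _ _ _ h1 h2.
by split; [exact: (same_sign_neq0 (s1 _ _ h1 h1)).1|exact: (same_sign_neq0 (s2 _ _ h2 h2)).1].
Qed.

Lemma Etri_family : Etri J alpha1 alpha2 P1 P2 = @tpoint R @` (Z @` L).
Proof.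
case: (fam) => _ LT H1 H2; apply: Etri_image => //.
- by move=> _ [i Li <-]; have [] := LT i Li.
- move=> p1 p2 s h1 h2 _ hs; have [t tE] := tau_real HJ p1 p2.
  have [p10 p20] := family_neq0 h1 h2.
  have [i Li ci] := H1 _ _ _ h1 h2 tE (has_angles_kappa HJ p10 p20 tE hs).
  exists (Z i); first by exists i.
  exact: (has_angles_same HJ (product_SU HJ _ _ p10 p20) hs (H2 _ _ _ _ h1 h2 tE Li ci)).
- move=> _ [i Li <-]; have [_ [p1 [p2 [t [h1 h2 tE ci]]]]] := LT i Li.
  have [p10 p20] := family_neq0 h1 h2.
  exists p1, p2; split=> //; first exact: product_SU.
  exact: H2 tE Li ci.
Qed.

Lemma family_corresponding w c0 : triangle w ->
  cor P1 P2 (tpoint w) c0 <-> exists (g : SU J) p1 p2 t i,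
    [/\ c0 = class_of g, val g = F p1 p2, P1 p1 /\ P2 p2, tau J p1 p2 = t%:C%C &
        [/\ L i, kap t = c i & same_angles (Z i) w]].
Proof.
case: (fam) => _ LT H1 H2 hw; split.
- move=> /(correspondingP HJ _ _ _ _ _ hw)[g [p1 [p2 [cE gE h1 h2 gw]]]].
  have [t tE] := tau_real HJ p1 p2; have [p10 p20] := family_neq0 h1 h2.
  rewrite gE in gw; have [i Li ci] := H1 _ _ _ h1 h2 tE (has_angles_kappa HJ p10 p20 tE gw).
  exists g, p1, p2, t, i; split=> //; split=> //.
  exact: (has_angles_same HJ (product_SU HJ _ _ p10 p20) (H2 _ _ _ _ h1 h2 tE Li ci) gw).
- move=> [g [p1 [p2 [t [i [cE gE [h1 h2] tE [Li ci iw]]]]]]].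
  apply/(correspondingP HJ _ _ _ _ _ hw); exists g, p1, p2; split=> //; rewrite gE.
  exact: (same_angles_has_angles iw (H2 _ _ _ _ h1 h2 tE Li ci)).
Qed.

Lemma family_element i : L i -> exists (g : SU J) p1 p2 t,
  [/\ val g = F p1 p2, P1 p1, P2 p2, tau J p1 p2 = t%:C%C & kap t = c i].
Proof.
case: (fam) => _ LT _ _ Li; have [_ [p1 [p2 [t [h1 h2 tE ci]]]]] := LT i Li.
have [p10 p20] := family_neq0 h1 h2.
by exists (SigSub (mem_set (product_SU HJ a1 a2 p10 p20))), p1, p2, t.
Qed.

(** A single class over a point follows from three facts: these angles force the value of kappa,
    hence of tau; centers with that tau give one class; the class has kind [K]. *)
Lemma family_corresponds_to i0 (K : 'M[CC R]_3 -> Prop) : L i0 ->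
  (forall i, L i -> same_angles (Z i) (Z i0) -> c i = c i0) ->
  (forall p1 p2 q1 q2 t (g h : SU J), P1 p1 -> P2 p2 -> P1 q1 -> P2 q2 ->
     tau J p1 p2 = t%:C%C -> tau J q1 q2 = t%:C%C -> kap t = c i0 ->
     val g = F p1 p2 -> val h = F q1 q2 -> class_of g = class_of h) ->
  (forall p1 p2 t, P1 p1 -> P2 p2 -> tau J p1 p2 = t%:C%C -> kap t = c i0 -> K (F p1 p2)) ->
  cor_to P1 P2 (tpoint (Z i0)) K.
Proof.
move=> Li0 inj uniq_class kind; have hT : triangle (Z i0) by case: (fam) => _ /(_ i0 Li0)[].
have [g [p1 [p2 [t [gE h1 h2 tE ci0]]]]] := family_element Li0.
exists g; first by rewrite gE; exact: kind tE ci0.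
apply/seteqP; split=> d.
- move=> /(family_corresponding _ hT)[h [q1 [q2 [s [i [-> hE [k1 k2] sE [Li ci ii0]]]]]]].
  have st : s = t by apply: (kappa_inj Ha1 Ha2); rewrite ci ci0; exact: inj.
  by rewrite st in sE; exact: (uniq_class q1 q2 p1 p2 t).
- move=> ->; apply/(family_corresponding _ hT); exists g, p1, p2, t, i0; split=> //.
  by split=> //; exact: same_angles_refl.
Qed.

Lemma family_generic_class i0 p1 p2 q1 q2 t (g h : SU J) : c i0 != kap 1 ->
  P1 p1 -> P2 p2 -> P1 q1 -> P2 q2 ->
  tau J p1 p2 = t%:C%C -> tau J q1 q2 = t%:C%C -> kap t = c i0 ->
  val g = F p1 p2 -> val h = F q1 q2 -> class_of g = class_of h.
Proof.
case: (fam) => -[s1 s2] _ _ _ c1 h1 h2 k1 k2 tE sE ci.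
have t1 : t != 1 by apply: contra_neq c1 => <-.
exact: (same_tau_class HJ (s1 _ _ h1 k1) (s2 _ _ h2 k2) tE sE t1).
Qed.

Lemma family_not_single i j : L i -> L j -> ~ same_angles (Z i) (Z j) ->
  ~ single_point (Etri J alpha1 alpha2 P1 P2).
Proof.
move=> Li Lj nij [q Eq]; apply: nij.
have LT : forall k, L k -> tpoint (Z k) = q.
  move=> k Lk; have : Etri J alpha1 alpha2 P1 P2 (tpoint (Z k)).
    by rewrite Etri_family; exists (Z k) => //; exists k.
  by rewrite Eq.
by apply: tpoint_same_angles; rewrite !LT.
Qed.

End Family.

Definition tau_of (c : R) : R := (cos delta - c) / (2 * sin (3 * a1 / 2) * sin (3 * a2 / 2)).

Lemma kappa_tau_of c : kap (tau_of c) = c.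
Proof.
have s1 := sin_half_gt0 Ha1; have s2 := sin_half_gt0 Ha2.
rewrite /kappa /tau_of; field; by rewrite !gt_eqF.
Qed.

Lemma segment_image (I : Type) (L : set I) (Z : I -> R * R) (f : I -> R) (x y : R * R) :
  (forall l, 0 <= l <= 1 -> exists2 i, L i & f i = l) ->
  (forall i, L i -> 0 <= f i <= 1) ->
  (forall i, L i -> Z i = ((1 - f i) * x.1 + f i * y.1, (1 - f i) * x.2 + f i * y.2)) ->
  @tpoint R @` (Z @` L) = segment x y.
Proof.
move=> H1 H2 H3; congr (_ @` _); apply/seteqP; split=> z.
- by move=> [i Li <-]; exists (f i); [exact: H2 | exact: H3].
- by move=> [l hl ->]; have [i Li <-] := H1 l hl; exists i => //; rewrite H3.
Qed.

Lemma between_linear (b d l : R) : 0 <= l <= 1 -> between b d (b + l * (d - b)).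
Proof.
move=> /andP[l0 l1]; have [bd|db] := leP b d; [left|right]; apply/andP; split; nra.
Qed.

(** The segment parameter is (psi - b) / (d - b), hence the separate case b = d. *)
Lemma segment_between (Z : R -> R * R) (b d : R) (x y u v : R * R) : x = Z b -> y = Z d ->
  (forall psi, Z psi = (u.1 + psi * v.1, u.2 + psi * v.2)) ->
  @tpoint R @` (Z @` between b d) = segment x y.
Proof.
move=> xE yE aff; have [bd|bd] := eqVneq b d.
  subst d; congr (_ @` _); apply/seteqP; split=> z.
    move=> [psi hpsi <-]; have -> : psi = b by case: hpsi => /andP[]; lra.
    by exists 0; rewrite ?lexx ?ler01 // yE xE !subr0 !mul1r !mul0r !addr0; case: (Z b).
  move=> [l _ ->]; exists b; first by left; rewrite lexx.
  by rewrite yE xE -!mulrDl subrK !mul1r; case: (Z b).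
have bd0 : d - b != 0 by rewrite subr_eq0 eq_sym.
apply: (segment_image (f := fun psi => (psi - b) / (d - b))).
- move=> l hl; exists (b + l * (d - b)); first exact: between_linear.
  by rewrite addrAC subrr add0r mulfK.
- move=> psi hpsi; rewrite /=.
  have [h|h] := ltP b d.
    by rewrite divr_ge0 ?ler_pdivrMr //=; case: hpsi => /andP[]; lra.
  have {}h : d < b by rewrite lt_neqAle eq_sym bd.
  rewrite -mulrNN -invrN divr_ge0 ?ler_pdivrMr //=; case: hpsi => /andP[]; lra.
- move=> psi _; rewrite yE xE (aff psi) (aff d) (aff b) /=.
  by congr (_, _); field.
Qed.

End Families.

Section Shapes.
Context {R : realType}.
Variables (J : 'M[CC R]_3) (HJ : signature_ppm J) (a1 a2 : R).
Hypotheses (Ha1 : 0 < a1 < 2 * pi / 3) (Ha2 : 0 < a2 < 2 * pi / 3).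
Implicit Types (x y z p q v e n m : 'cV[CC R]_3) (P : set 'cV[CC R]_3).
Implicit Types (psi t : R).
Local Notation "<< x , y >>" := (form J x y).
Local Notation F p1 p2 := (product J (expi a1) (expi a2) p1 p2).
Local Notation S := (3 * (a1 + a2) / 2).
Local Notation delta := (3 * (a1 - a2) / 2).
Local Notation kap := (kappa a1 a2).
Local Notation alpha1 := (expi a1).
Local Notation alpha2 := (expi a2).

Lemma segment_point (x : R * R) : segment x x = [set tpoint x].
Proof.
apply/seteqP; split=> q; last first.
  move=> ->; exists x => //; exists 0; rewrite ?lexx ?ler01 //.
  by rewrite subr0 !mul1r !mul0r !addr0; case: x.
by move=> [_ [l _ ->] <-]; rewrite -!mulrDl subrK !mul1r; case: x.
Qed.

Lemma between_S_cos_le psi : between S pi psi -> cos psi <= cos S.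
Proof.
have /andP[S0 S2] := S_bounds Ha1 Ha2; have pi0 := pi_gt0 R.
case=> /andP[h1 h2]; first by rewrite ler_cos_pi //; lra.
by rewrite -(cos2piB psi) -(cos2piB S) ler_cos_pi; lra.
Qed.

Lemma tau_of_ge1 c : (1 <= tau_of a1 a2 c) = (c <= cos S).
Proof. by rewrite -(kappa_le Ha1 Ha2 _ 1) (kappa_tau_of Ha1 Ha2) kappa1. Qed.

Lemma tau_of_le0 c : (tau_of a1 a2 c <= 0) = (cos delta <= c).
Proof. by rewrite -(kappa_le Ha1 Ha2 0) (kappa_tau_of Ha1 Ha2) kappa0. Qed.

(** The cube of e^{i (a1 + a2)} is e^{2 i S} with 2 S in (0, 4 pi); it is 1 only for S = pi. *)
Lemma parameter_product : S != pi -> parameter (expi (a1 + a2)).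
Proof.
move=> Spi; split; first exact: norm_expi.
have /andP[S0 S2] := S_bounds Ha1 Ha2; have pi0 := pi_gt0 R.
rewrite /Omega /= expiX -(mulr_natr (a1 + a2)).
have [h|h] := ltP S pi; first by move=> /expi_eq1[|E|E]; lra.
have {}h : pi < S by rewrite lt_neqAle eq_sym Spi.
have -> : (a1 + a2) * 3%:R = 2 * S - 2 * pi + 2 * pi by lra.
rewrite expiD expi2pi expi0 mulr1 => /expi_eq1[|E|E]; lra.
Qed.

Lemma Omega_product : S = pi -> Omega (expi (a1 + a2)).
Proof.
move=> Spi; rewrite /Omega /= expiX -(mulr_natr (a1 + a2)).
have -> : (a1 + a2) * 3%:R = 2 * pi by lra.
by rewrite expi2pi expi0.
Qed.

Lemma same_angles_0 (s : R * R) : same_angles s (0, 0) -> expi s.1 = 1 :> CC R /\ expi s.2 = 1 :> CC R.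
Proof. by rewrite /same_angles /= expi0; case=> -[-> ->]. Qed.

Lemma expi_pi_pi : expi pi = expi (- pi) :> CC R.
Proof. by rewrite expiN expi_pi invrN invr1. Qed.

Lemma expi_S_pi : S != pi -> expi (S + pi) != 1 :> CC R.
Proof.
move=> Spi; have /andP[S0 S2] := S_bounds Ha1 Ha2; have pi0 := pi_gt0 R.
apply/eqP; rewrite expiD expi_pi_pi -expiD => E.
have [h|h] := ltP S pi.
  have : expi (pi - S) = 1 :> CC R by rewrite -[pi - S]opprB expiN E invr1.
  move=> /expi_eq1[|{}E|{}E]; lra.
have {}h : pi < S by rewrite lt_neqAle eq_sym Spi.
move: E => /expi_eq1[|E|E]; lra.
Qed.

Lemma expi_S : expi S != 1 :> CC R.
Proof.
have /andP[S0 S2] := S_bounds Ha1 Ha2.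
by apply/eqP => /expi_eq1[|E|E]; lra.
Qed.

Lemma double_ellipto_parabolic p1 p2 t psi s : <<p1, p1>> != 0 -> <<p2, p2>> != 0 ->
  tau J p1 p2 = t%:C%C -> t != 0 -> t != 1 -> cos psi = kap t ->
  expi psi = expi (- psi) :> CC R -> has_angles J (F p1 p2) s -> expi s.2 != 1 :> CC R ->
  ellipto_parabolic J (F p1 p2).
Proof.
move=> p10 p20 tE t0 t1 ck dbl hs s1.
apply: (ellipto_parabolic_of_angles HJ (product_SU HJ _ _ p10 p20) hs).
  by move=> /same_angles_0[_ /eqP]; apply/negP.
exact: (double_eigenvalue_no_negative HJ Ha1 Ha2 p10 p20 tE t0 t1 ck dbl).
Qed.

(** * Two negative centers *)

Section NegativeNegative.
(** [Z] picks representatives in the triangle, a choice that depends on the side of pi on which S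
    lies. The end psi = S is tau = 1; the end psi = pi is a double eigenvalue. *)
Variables (Z : R -> R * R) (u v : R * R).
Hypothesis Z_affine : forall psi, Z psi = (u.1 + psi * v.1, u.2 + psi * v.2).
Hypothesis Z_triangle : forall psi, between S pi psi -> triangle (Z psi).
Hypothesis Z_angles : forall psi, same_angles (2 * psi, S + psi) (Z psi).
Hypothesis Z_inj : forall psi psi', between S pi psi -> between S pi psi' ->
  same_angles (Z psi) (Z psi') -> psi = psi'.
Hypothesis Z_diagonal : S != pi -> diagonal_side (tpoint (Z S)).
Hypothesis Z_nondiagonal : S != pi -> nondiagonal_side (tpoint (Z pi)).

Lemma negative_negative_family :
  angle_family J a1 a2 (negative J) (negative J) (between S pi) cos Z.
Proof.
split.
- by split=> p q h h'; right.
- move=> psi hpsi; split; first exact: Z_triangle.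
  have t1 : 1 <= tau_of a1 a2 (cos psi) by rewrite tau_of_ge1 between_S_cos_le.
  have [p1 [p2 [h1 h2 tE]]] := negative_pair HJ t1.
  by exists p1, p2, (tau_of a1 a2 (cos psi)); split=> //; exact: kappa_tau_of.
- move=> p1 p2 t h1 h2 tE /andP[k1 _].
  have t1 : 1 <= t by case: (negative_pair_tau HJ h1 h2 tE) => [[-> _]|/ltW].
  have hk : -1 <= kap t <= cos S by rewrite k1 -(kappa1 a1 a2) (kappa_le Ha1 Ha2).
  by have [psi hpsi E] := between_exists Ha1 Ha2 hk; exists psi.
- move=> p1 p2 t psi h1 h2 tE hpsi E.
  exact: (same_angles_has_angles (Z_angles psi)
    (negative_negative_angles HJ Ha1 Ha2 h1 h2 tE hpsi (esym E))).
Qed.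

Lemma negative_negative_shape : shape_mm J alpha1 alpha2 (Z S) (Z pi).
Proof.
have fam := negative_negative_family; have bS := between_S Ha1 Ha2.
have bpi : between S pi pi by have [h|/ltW h] := leP S pi; [left|right]; rewrite h lexx.
have EE : Etri J alpha1 alpha2 (negative J) (negative J) = segment (Z S) (Z pi).
  by rewrite (Etri_family HJ fam); exact: (segment_between _ _ Z_affine).
have tau1 p1 p2 t : negative J p1 -> negative J p2 -> tau J p1 p2 = t%:C%C ->
    kap t = cos S -> reject J p1 p2 = 0.
  move=> h1 h2 tE; rewrite -(kappa1 a1 a2) => /(kappa_inj Ha1 Ha2) t1.
  by case: (negative_pair_tau HJ h1 h2 tE) => [[]//|]; rewrite t1 ltxx.
have neg0 p : negative J p -> <<p, p>> != 0 by move=> h; rewrite lt_eqF.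
have atS (K : 'M[CC R]_3 -> Prop) : (forall p, negative J p -> K (complex_reflection J (expi (a1 + a2)) p)) ->
    corresponds_to J alpha1 alpha2 (negative J) (negative J) (tpoint (Z S)) K.
  move=> HK; apply: (family_corresponds_to HJ Ha1 Ha2 fam bS).
  - by move=> psi hpsi E; rewrite (Z_inj hpsi bS E).
  - move=> p1 p2 q1 q2 t g h h1 h2 k1 k2 tE sE ct gE hE.
    apply: (same_point_class HJ _ (neg0 _ h2) (neg0 _ k2) (tau1 _ _ _ h1 h2 tE ct) (tau1 _ _ _ k1 k2 sE ct) gE hE).
    by right.
  - move=> p1 p2 t h1 h2 tE ct.
    rewrite (product_same_point a1 a2 (neg0 _ h1) (neg0 _ h2) (tau1 _ _ _ h1 h2 tE ct)).
    exact: HK.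
have single : S != pi -> ~ single_point (Etri J alpha1 alpha2 (negative J) (negative J)).
  move=> Spi; apply: (family_not_single HJ fam bS bpi) => /(Z_inj bS bpi) E.
  by rewrite E eqxx in Spi.
split; first exact: EE.
- move=> q Eq; have Spi : S = pi.
    by apply/eqP/negPn; apply/negP => /single; apply; exists q.
  have -> : q = tpoint (Z S).
    have : [set q] q by [].
    by rewrite -Eq EE -Spi segment_point.
  by apply: atS => p _; apply: reflection_identical; exact: Omega_product.
- move=> nsingle; have Spi : S != pi.
    apply/eqP => Spi; apply: nsingle; exists (tpoint (Z S)).
    by rewrite EE -Spi segment_point.
  split; [exact: Z_diagonal| |exact: Z_nondiagonal|].
    apply: atS => p hp; apply: reflection_special_center => //; last exact: neg0.
    exact: parameter_product.
  have cpi : cos pi != kap 1.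
    rewrite kappa1; apply: contra_neq Spi => E.
    by apply: (cos_between_inj Ha1 Ha2 bS bpi).
  apply: (family_corresponds_to HJ Ha1 Ha2 fam bpi).
  + by move=> psi hpsi E; rewrite (Z_inj hpsi bpi E).
  + move=> p1 p2 q1 q2 t g h h1 h2 k1 k2 tE sE ct.
    exact: (family_generic_class HJ fam cpi h1 h2 k1 k2 tE sE ct).
  + move=> p1 p2 t h1 h2 tE ct.
    have t1 : t != 1 by apply: contra_neq cpi => <-.
    have t0 : t != 0.
      case: (negative_pair_tau HJ h1 h2 tE) => [[-> _]|h]; first exact: oner_neq0.
      by rewrite gt_eqF // (lt_trans ltr01).
    apply: (double_ellipto_parabolic (neg0 _ h1) (neg0 _ h2) tE t0 t1 (esym ct) expi_pi_pi
      (negative_negative_angles HJ Ha1 Ha2 h1 h2 tE bpi (esym ct))).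
    exact: expi_S_pi.
Qed.

End NegativeNegative.

(** * A positive and a negative center *)

Section PositiveNegative.
Variables (Z : R -> R * R) (u v : R * R).
Hypothesis Z_affine : forall psi, Z psi = (u.1 + psi * v.1, u.2 + psi * v.2).
Hypothesis Z_triangle : forall psi, between 0 delta psi -> triangle (Z psi).
Hypothesis Z_angles : forall psi, same_angles (- 2 * psi, S - psi) (Z psi).
Hypothesis Z_inj : forall psi psi', between 0 delta psi -> between 0 delta psi' ->
  same_angles (Z psi) (Z psi') -> psi = psi'.

Lemma between_delta_cos_ge psi : between 0 delta psi -> cos delta <= cos psi.
Proof.
move: Ha1 Ha2 (pi_gt0 R) => /andP[? ?] /andP[? ?] pi0; case=> /andP[? ?].
  by rewrite ler_cos_pi //; lra.
by rewrite -(cosN psi) -(cosN delta) ler_cos_pi //; lra.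
Qed.

Lemma between_delta_exists c : cos delta <= c <= 1 ->
  exists2 psi, between 0 delta psi & cos psi = c.
Proof.
move: Ha1 Ha2 (pi_gt0 R) => /andP[? ?] /andP[? ?] pi0 hc.
have [d0|d0] := leP 0 delta.
  have dpi : delta <= pi by lra.
  have hc' : cos delta <= c <= cos 0 by rewrite cos0.
  by have [psi hpsi E] := cos_interval (lexx 0) d0 dpi hc'; exists psi => //; left.
have d0' : 0 <= - delta by lra.
have dpi : - delta <= pi by lra.
have hc' : cos (- delta) <= c <= cos 0 by rewrite cosN cos0.
have [psi /andP[h1 h2] E] := cos_interval (lexx 0) d0' dpi hc'.
by exists (- psi); [right; apply/andP; split; lra | rewrite cosN].
Qed.

Lemma positive_negative_family :
  angle_family J a1 a2 (positive J) (negative J) (between 0 delta) cos Z.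
Proof.
split.
- by split=> p q h h'; [left|right].
- move=> psi hpsi; split; first exact: Z_triangle.
  have t0 : tau_of a1 a2 (cos psi) <= 0 by rewrite tau_of_le0 between_delta_cos_ge.
  have [p1 [p2 [h1 h2 tE]]] := mixed_pair HJ t0.
  by exists p1, p2, (tau_of a1 a2 (cos psi)); split=> //; exact: kappa_tau_of.
- move=> p1 p2 t h1 h2 tE /andP[_ k1].
  have t0 := mixed_pair_tau HJ h1 h2 tE.
  have hk : cos delta <= kap t <= 1 by rewrite k1 -(kappa0 a1 a2) (kappa_le Ha1 Ha2) t0.
  by have [psi hpsi E] := between_delta_exists hk; exists psi.
- move=> p1 p2 t psi h1 h2 tE hpsi E.
  exact: (same_angles_has_angles (Z_angles psi)
    (positive_negative_angles HJ Ha1 Ha2 h1 h2 tE hpsi (esym E))).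
Qed.

Lemma alpha_eq : alpha1 = alpha2 -> a1 = a2.
Proof.
move: Ha1 Ha2 (pi_gt0 R) => /andP[? ?] /andP[? ?] pi0.
by move=> /expi_inj[||//|[] |[]]; lra.
Qed.

Lemma expi_neq1 (b : R) : 0 < b < 2 * pi -> expi b != 1 :> CC R /\ expi (- b) != 1 :> CC R.
Proof.
move=> hb; rewrite expiN invr_eq1.
have hb' : expi b != 1 :> CC R by apply/eqP => /expi_eq1[|E|E]; lra.
by [].
Qed.

(** At psi = delta the angles are 3 (a2 - a1) and 3 a2, with difference -3 a1; none is a multiple of
    2 pi when a1 != a2. *)
Lemma mixed_angles_distinct : a1 != a2 -> [/\ expi (- 2 * delta) != 1 :> CC R,
  expi (S - delta) != 1 :> CC R & expi (- 2 * delta) != expi (S - delta) :> CC R].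
Proof.
move: Ha1 Ha2 (pi_gt0 R) => /andP[? ?] /andP[? ?] pi0 a12.
have e2 : S - delta = 3 * a2 by lra.
have E : - 2 * delta = S - delta + - (3 * a1) by lra.
split.
- have [h|h] := ltP a2 a1.
    by rewrite mulNr; apply: (expi_neq1 _).2; lra.
  have {}h : a1 < a2 by rewrite lt_neqAle a12.
  by apply: (expi_neq1 _).1; lra.
- by apply: (expi_neq1 _).1; lra.
- rewrite E expiD -[X in _ != X]mulr1 (inj_eq (mulfI (expi_neq0 _))).
  by apply: (expi_neq1 _).2; lra.
Qed.

Lemma positive_negative_shape : shape_pm J alpha1 alpha2 (positive J) (negative J) (Z delta) (Z 0).
Proof.
have fam := positive_negative_family.
have bd : between 0 delta delta by have [h|/ltW h] := leP 0 delta; [left|right]; rewrite h lexx.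
have b0 : between 0 delta 0 by have [h|/ltW h] := leP 0 delta; [left|right]; rewrite h lexx.
have EE : Etri J alpha1 alpha2 (positive J) (negative J) = segment (Z delta) (Z 0).
  rewrite (Etri_family HJ fam) -(segment_between (erefl (Z delta)) (erefl (Z 0)) Z_affine).
  by congr (_ @` (_ @` _)); apply/seteqP; split=> psi [] h; [right|left|right|left].
have sgn p1 p2 : positive J p1 -> negative J p2 -> <<p1, p1>> != 0 /\ <<p2, p2>> != 0.
  by move=> h1 h2; rewrite gt_eqF ?lt_eqF.
have single : a1 != a2 -> ~ single_point (Etri J alpha1 alpha2 (positive J) (negative J)).
  move=> a12; apply: (family_not_single HJ fam b0 bd) => /(Z_inj b0 bd) E.
  by case/eqP: a12; lra.
have cd : cos delta != kap 1.
  rewrite -(kappa0 a1 a2); apply/eqP => /(kappa_inj Ha1 Ha2)/eqP.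
  by rewrite eq_sym oner_eq0.
have orth p1 p2 t : positive J p1 -> negative J p2 -> tau J p1 p2 = t%:C%C ->
    kap t = cos delta -> <<p1, p2>> = 0.
  move=> h1 h2 tE; rewrite -(kappa0 a1 a2) => /(kappa_inj Ha1 Ha2) t0.
  have [p10 p20] := sgn _ _ h1 h2; apply: (formC0 HJ).
  by apply: (tau0_orthogonal HJ p10 p20); rewrite tE t0 rmorph0.
split; first exact: EE.
- split=> [[q Eq _]|E].
    have [<-//|/single[]] := eqVneq a1 a2; by exists q.
  have a12 := alpha_eq E.
  exists (tpoint (Z delta)).
    have -> : Z delta = Z 0 by congr Z; rewrite a12; lra.
    by rewrite EE; have -> : Z delta = Z 0; [congr Z; rewrite a12; lra|exact: segment_point].
  apply: (family_corresponds_to HJ Ha1 Ha2 fam bd).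
  + by move=> psi hpsi E'; rewrite (Z_inj hpsi bd E').
  + move=> p1 p2 q1 q2 t g h h1 h2 k1 k2 tE sE ct.
    exact: (family_generic_class HJ fam cd h1 h2 k1 k2 tE sE ct).
  + move=> p1 p2 t h1 h2 tE ct; have [p10 p20] := sgn _ _ h1 h2.
    exact: (orthogonal_special_center HJ Ha2 a12 p10 h2 (orth _ _ _ h1 h2 tE ct)).
- move=> nE; have a12 : a1 != a2 by apply: contra_notN nE => /eqP ->.
  have d0 : delta != 0 by apply: contra_neq a12; lra.
  split.
    have [g [p1 [p2 [t [gE h1 h2 tE ct]]]]] := family_element HJ fam bd.
    have hs : has_angles J (val g) (Z delta).
      by rewrite gE; case: fam => _ _ _ H; exact: (H _ _ _ _ h1 h2 tE bd ct).
    have [eb ap] := has_angles_angle_point HJ (Z_triangle bd) hs.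
    exists (class_of g); split=> //; exists (class_of g) => //; exists g => //=.
    have hs' := same_angles_has_angles (same_angles_sym (Z_angles delta)) hs.
    have [n1 n2 n12] := mixed_angles_distinct a12.
    exact: (regular_elliptic_of_angles HJ (set_mem (valP g)) hs').
  have c0 : cos 0 != kap 1.
    rewrite kappa1 cos0; apply/eqP => E; have /andP[S0 S2] := S_bounds Ha1 Ha2.
    have := expi_S; rewrite eq_complex /= -E eqxx /=.
    have : sin S ^+ 2 = 0 by have := cos2Dsin2 S; rewrite -E; lra.
    by move=> /eqP; rewrite expf_eq0 /= => ->.
  apply: (family_corresponds_to HJ Ha1 Ha2 fam b0).
  + by move=> psi hpsi E'; rewrite (Z_inj hpsi b0 E').
  + move=> p1 p2 q1 q2 t g h h1 h2 k1 k2 tE sE ct.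
    exact: (family_generic_class HJ fam c0 h1 h2 k1 k2 tE sE ct).
  + move=> p1 p2 t h1 h2 tE ct; have [p10 p20] := sgn _ _ h1 h2.
    have t1 : t != 1 by apply: contra_neq c0 => <-.
    have t0 : t != 0.
      apply: contra_neq d0 => t0; apply/esym; apply: (cos_mixed_inj Ha1 Ha2 b0).
      by rewrite -ct t0 kappa0.
    apply: (double_ellipto_parabolic p10 p20 tE t0 t1 (esym ct) _
      (positive_negative_angles HJ Ha1 Ha2 h1 h2 tE b0 (esym ct))); first by rewrite oppr0.
    by rewrite /= subr0; exact: expi_S.
Qed.

End PositiveNegative.

End Shapes.

(** * Two positive centers *)

Section PositivePositive.
Context {R : realType}.
Variables (J : 'M[CC R]_3) (HJ : signature_ppm J) (a1 a2 : R).
Hypotheses (Ha1 : 0 < a1 < 2 * pi / 3) (Ha2 : 0 < a2 < 2 * pi / 3).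
Implicit Types (x y z p q n m : 'cV[CC R]_3).
Implicit Types (psi t : R).
Local Notation "<< x , y >>" := (form J x y).
Local Notation F p1 p2 := (product J (expi a1) (expi a2) p1 p2).
Local Notation S := (3 * (a1 + a2) / 2).
Local Notation delta := (3 * (a1 - a2) / 2).
Local Notation kap := (kappa a1 a2).
Local Notation alpha1 := (expi a1).
Local Notation alpha2 := (expi a2).
Local Notation cor := (corresponding J alpha1 alpha2 (positive J) (positive J)).

(* [Za] is for tau <= 1 and [Zb] for tau >= 1.  They meet at tau = 1, which is
   reached both when p1 = p2 and when p1 and p2 span a degenerate plane. *)
Variables (Za Zb : R -> R * R) (ua va ub vb : R * R) (d d' slope_b : R).
Hypothesis Za_affine : forall psi, Za psi = (ua.1 + psi * va.1, ua.2 + psi * va.2).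
Hypothesis Zb_affine : forall psi, Zb psi = (ub.1 + psi * vb.1, ub.2 + psi * vb.2).
Hypothesis d_delta : cos d = cos delta.
Hypothesis d'_S : cos d' = cos S.
Hypothesis dd' : 0 <= d /\ d < d' /\ d' <= pi.
Hypothesis Za_triangle : forall psi, d <= psi <= d' -> triangle (Za psi).
Hypothesis Zb_triangle : forall psi, between S pi psi -> triangle (Zb psi).
Hypothesis Za_angles : forall psi, same_angles (psi - S, - psi - S) (Za psi).
Hypothesis Zb_angles : forall psi, same_angles (- 2 * psi, S - psi) (Zb psi).
Hypothesis Z_common : Za d' = Zb S.
Hypothesis Za_inj : forall psi psi', d <= psi <= d' -> d <= psi' <= d' ->
  same_angles (Za psi) (Za psi') -> psi = psi'.
Hypothesis Zb_inj : forall psi psi', between S pi psi -> between S pi psi' ->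
  same_angles (Zb psi) (Zb psi') ->
  [\/ psi = psi', psi = S /\ psi' = pi | psi = pi /\ psi' = S].
Hypothesis Zab_inj : forall psi psi', d <= psi <= d' -> between S pi psi' ->
  same_angles (Za psi) (Zb psi') -> psi = d' /\ (psi' = S \/ psi' = pi).
Hypothesis Za_slope : slope (Za d) (Za d') (-1).
Hypothesis Zb_slope : S != pi -> slope (Zb S) (Zb pi) slope_b.

(** The two ranges of psi form a disjoint union tagged by a boolean, so that the general lemmas on
    families treat both segments at once. *)
Let L : set (bool * R) := [set i | if i.1 then is_true (d <= i.2 <= d') else between S pi i.2].
Let Z (i : bool * R) := if i.1 then Za i.2 else Zb i.2.
Let c (i : bool * R) := cos i.2.

Lemma positive_positive_family : angle_family J a1 a2 (positive J) (positive J) L c Z.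
Proof.
have [d0 [dlt dpi]] := dd'; split.
- by split=> p q h h'; left.
- move=> i Li; split; first by move: Li; rewrite /L /Z /=; case: i => -[] psi /=; auto.
  have t0 : 0 <= tau_of a1 a2 (c i).
    rewrite -(kappa_le Ha1 Ha2 _ 0) (kappa_tau_of Ha1 Ha2) kappa0.
    move: Li; rewrite /L /c /=; case: i => -[] psi /=.
      by move=> /andP[? ?]; rewrite -d_delta ler_cos_pi //; lra.
    move=> /(between_S_cos_le Ha1 Ha2) h; apply: (le_trans h).
    by rewrite -d'_S -d_delta ler_cos_pi //; lra.
  have [p1 [p2 [h1 h2 tE _]]] := positive_pair HJ t0.
  by exists p1, p2, (tau_of a1 a2 (c i)); split=> //; exact: kappa_tau_of.
- move=> p1 p2 t h1 h2 tE /andP[k1 _].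
  have t0 := positive_pair_tau HJ h1 h2 tE.
  have [t1|t1] := leP 1 t.
    have hk : -1 <= kap t <= cos S by rewrite k1 -(kappa1 a1 a2) (kappa_le Ha1 Ha2).
    by have [psi hpsi E] := between_exists Ha1 Ha2 hk; exists (false, psi).
  have hk : cos d' <= kap t <= cos d.
    by rewrite d'_S d_delta -(kappa1 a1 a2) -(kappa0 a1 a2) !(kappa_le Ha1 Ha2) t0 ltW.
  by have [psi hpsi E] := cos_interval d0 (ltW dlt) dpi hk; exists (true, psi).
- move=> p1 p2 t [[] psi] h1 h2 tE hpsi E.
    have t1 : t <= 1.
      rewrite -(kappa_le Ha1 Ha2 1) kappa1 E -d'_S /c /=.
      by move: hpsi; rewrite /L /= => /andP[? ?]; rewrite ler_cos_pi //; lra.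
    exact: (same_angles_has_angles (Za_angles psi)
      (positive_positive_axis_angles HJ h1 h2 tE t1 (esym E))).
  have t1 : 1 <= t by rewrite -(kappa_le Ha1 Ha2 _ 1) kappa1 E; exact: between_S_cos_le.
  exact: (same_angles_has_angles (Zb_angles psi)
    (positive_positive_angles HJ Ha1 Ha2 h1 h2 tE t1 hpsi (esym E))).
Qed.

Let fam := positive_positive_family.
Let bS : between S pi S := between_S Ha1 Ha2.
Let bpi : between S pi pi.
Proof. by have [h|/ltW h] := leP S pi; [left|right]; rewrite h lexx. Qed.

Let pos0 p : positive J p -> <<p, p>> != 0.
Proof. by move=> h; rewrite gt_eqF. Qed.

Let pos_element p1 p2 : positive J p1 -> positive J p2 -> exists g : SU J, val g = F p1 p2.
Proof. by move=> h1 h2; exists (SigSub (mem_set (product_SU HJ a1 a2 (pos0 h1) (pos0 h2)))). Qed.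

(** Only psi = S and psi = pi contribute at these points, and both do when the points are glued. An
    index psi = d' of the first segment is replaced by psi = S of the second. *)
Lemma positive_positive_corresponding w c0 : w = Zb S \/ w = Zb pi ->
  cor (tpoint w) c0 <-> exists (g : SU J) p1 p2 t psi,
    [/\ c0 = class_of g, val g = F p1 p2, positive J p1 /\ positive J p2, tau J p1 p2 = t%:C%C &
        [/\ psi = S \/ psi = pi, kap t = cos psi & same_angles (Zb psi) w]].
Proof.
move=> hw; have Tw : triangle w by case: hw => ->; exact: Zb_triangle.
split.
- move=> /(family_corresponding HJ fam _ Tw)[g [p1 [p2 [t [[[] psi] [cE gE h tE [Li ci iw]]]]]]].
    have E : psi = d' by case: hw => wE; rewrite wE in iw; have [] := Zab_inj Li _ iw.
    exists g, p1, p2, t, S; split=> //; split; [by left | by rewrite ci /c /= E | ].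
    by rewrite -Z_common -E.
  exists g, p1, p2, t, psi; split=> //; split=> //.
  by case: hw => wE; rewrite wE in iw; case: (Zb_inj Li _ iw) => //;
    [by left|case; left|case; right|by right|case; left|case; right].
- move=> [g [p1 [p2 [t [psi [cE gE h tE [hpsi ci iw]]]]]]].
  apply/(family_corresponding HJ fam _ Tw); exists g, p1, p2, t, (false, psi).
  by split=> //; split=> //; case: hpsi => ->.
Qed.

Lemma positive_positive_image :
  Etri J alpha1 alpha2 (positive J) (positive J) =
  segment (Za d) (Za d') `|` segment (Za d') (Zb pi).
Proof.
have [d0 [dlt dpi]] := dd'.
rewrite (Etri_family HJ fam) {2}Z_common.
rewrite -(segment_between (erefl (Za d)) (erefl (Za d')) Za_affine).
rewrite -(segment_between (erefl (Zb S)) (erefl (Zb pi)) Zb_affine).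
rewrite -!image_setU; congr (_ @` _); apply/seteqP; split=> z.
- by move=> [[[] psi] Li <-]; [left|right]; exists psi => //; left.
- move=> [] [psi hpsi <-]; [exists (true, psi)|exists (false, psi)] => //.
  by rewrite /L /=; case: hpsi => // /andP[? ?]; lra.
Qed.

(** The ends of a nondegenerate segment may be glued, so an end is compared with the midpoint. *)
Lemma single_segment : single_point (segment (Za d') (Zb pi)) -> S = pi.
Proof.
move=> [q Eq]; apply/eqP/negPn; apply/negP => /eqP Spi.
pose mid := (S + pi) / 2.
have bm : between S pi mid.
  by have [h|h] := leP S pi; [left|right]; rewrite /mid; apply/andP; split; lra.
have inq psi : between S pi psi -> tpoint (Zb psi) = q.
  move=> hpsi; have : segment (Za d') (Zb pi) (tpoint (Zb psi)).
    rewrite Z_common -(segment_between (erefl (Zb S)) (erefl (Zb pi)) Zb_affine).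
    by exists (Zb psi) => //; exists psi.
  by rewrite Eq.
have /tpoint_same_angles/(Zb_inj bS bm) : tpoint (Zb S) = tpoint (Zb mid) by rewrite !inq.
by rewrite /mid => -[|[]|[]]; lra.
Qed.

Lemma positive_positive_shape :
  shape_pp J alpha1 alpha2 (Za d) (Za d') (Zb pi) slope_b.
Proof.
have [d0 [dlt dpi]] := dd'.
have [p1 [p2 [h1 h2 tp pn]]] := positive_pair HJ ler01.
have {}pn := pn erefl.
have [q1 [q2 [k1 k2 tq qn]]] := tangent_pair HJ.
have tq' : tau J q1 q2 = 1%:C%C by rewrite tq rmorph1.
have [gy1 gy1E] : exists g : SU J, val g = F p1 p2.
  exact: pos_element.
have [gy2 gy2E] : exists g : SU J, val g = F q1 q2.
  exact: pos_element.
have ct1 : kap 1 = cos S by exact: kappa1.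
(* The two orbits at tau = 1: coinciding centers give [gy1], a degenerate plane gives [gy2]. *)
have class_y m1 m2 t (h : SU J) : positive J m1 -> positive J m2 -> tau J m1 m2 = t%:C%C ->
    kap t = cos S -> val h = F m1 m2 -> class_of h = class_of gy1 \/ class_of h = class_of gy2.
  move=> l1 l2 tE ct hE; have t1 : t = 1 by apply: (kappa_inj Ha1 Ha2); rewrite ct.
  rewrite t1 rmorph1 in tE; have [r0|r0] := eqVneq (reject J m1 m2) 0; [left|right].
    have ss : same_sign J m1 p1 by left.
    exact: (same_point_class HJ ss (pos0 l2) (pos0 h2) r0 pn hE gy1E).
  exact: (tangent_class HJ l1 l2 k1 k2 tE tq r0 qn hE gy2E).
have in_y w : w = Zb S \/ w = Zb pi -> same_angles (Zb S) w ->
    cor (tpoint w) (class_of gy1) /\ cor (tpoint w) (class_of gy2).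
  move=> hw E; split; apply/(positive_positive_corresponding _ hw).
    by exists gy1, p1, p2, 1, S; split=> //; split=> //; left.
  by exists gy2, q1, q2, 1, S; split=> //; split=> //; left.
split; [exact: positive_positive_image|exact: Za_slope| | |].
- rewrite Z_common; have [->|Spi] := eqVneq S pi; first by left.
  by right; exact: Zb_slope.
- move=> /single_segment Spi; exists gy1, gy2; split.
  + rewrite gy1E (product_same_point a1 a2 (pos0 h1) (pos0 h2) pn).
    by apply: reflection_identical; exact: Omega_product.
  + rewrite gy2E; apply: (tangent_three_step HJ Ha1 Ha2 k1 k2 tq qn); lra.
  + rewrite Z_common; apply/seteqP; split=> c0.
      move=> /(positive_positive_corresponding _ (or_introl erefl)).
      move=> [g [m1 [m2 [t [psi [-> gE [l1 l2] tE [hpsi ct _]]]]]]].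
      apply: (class_y m1 m2 t g l1 l2 tE _ gE).
      by rewrite ct; case: hpsi => ->; rewrite ?Spi.
    have [i1 i2] := in_y (Zb S) (or_introl erefl) (same_angles_refl _).
    by case=> ->.
- move=> nsingle; have Spi : S != pi.
    apply/eqP => Spi; apply: nsingle; exists (tpoint (Zb S)).
    by rewrite Z_common -Spi segment_point.
  have cpi : cos pi != kap 1.
    rewrite kappa1; apply: contra_neq Spi => E.
    by apply: (cos_between_inj Ha1 Ha2 bS bpi).
  split.
    have cd : cos d != kap 1.
      rewrite d_delta -(kappa0 a1 a2); apply/eqP => /(kappa_inj Ha1 Ha2)/eqP.
      by rewrite eq_sym oner_eq0.
    have Ld : L (true, d) by rewrite /L /= lexx ltW.
    apply: (family_corresponds_to HJ Ha1 Ha2 fam Ld).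
    + move=> [[] psi] Li E; first by have /= -> := Za_inj Li Ld E.
      have [dE _] := Zab_inj Ld Li (same_angles_sym E).
      by rewrite -dE ltxx in dlt.
    + move=> m1 m2 n1 n2 t g h l1 l2 l3 l4 tE sE ct.
      exact: (family_generic_class HJ fam (i0 := (true, d)) cd l1 l2 l3 l4 tE sE ct).
    + move=> m1 m2 t l1 l2 tE; rewrite /c /= d_delta -(kappa0 a1 a2) => /(kappa_inj Ha1 Ha2) t0.
      apply: (orthogonal_elliptic HJ Ha1 Ha2 l1 l2); apply: (formC0 HJ).
      by apply: (tau0_orthogonal HJ (pos0 l1) (pos0 l2)); rewrite tE t0 rmorph0.
  have Lpi : L (false, pi) by [].
  have [gz [m1 [m2 [t [gzE l1 l2 tE ct]]]]] := family_element HJ fam Lpi.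
  rewrite /c /= in ct.
  have t1 : t != 1 by apply: contra_neq cpi => <-.
  have t1' : 1 <= t by rewrite -(kappa_le Ha1 Ha2 _ 1) kappa1 ct; exact: between_S_cos_le.
  have class_z n1 n2 s (h : SU J) : positive J n1 -> positive J n2 -> tau J n1 n2 = s%:C%C ->
      kap s = cos pi -> val h = F n1 n2 -> class_of h = class_of gz.
    move=> l3 l4 sE cs hE; have st : s = t by apply: (kappa_inj Ha1 Ha2); rewrite cs ct.
    rewrite st in sE.
    exact: (family_generic_class HJ fam (i0 := (false, pi)) cpi l3 l4 l1 l2 sE tE ct hE gzE).
  have in_z w : w = Zb S \/ w = Zb pi -> same_angles (Zb pi) w -> cor (tpoint w) (class_of gz).
    move=> hw E; apply/(positive_positive_corresponding _ hw).
    by exists gz, m1, m2, t, pi; split=> //; split=> //; right.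
  exists gy1, gy2, gz; split.
  + rewrite gy1E (product_same_point a1 a2 (pos0 h1) (pos0 h2) pn).
    by apply: reflection_special_center => //; [exact: parameter_product|exact: pos0].
  + have hs := positive_positive_angles HJ Ha1 Ha2 k1 k2 tq' (lexx 1) bS (esym ct1).
    rewrite gy2E; apply: (ellipto_parabolic_of_angles HJ (product_SU HJ a1 a2 (pos0 k1) (pos0 k2)) hs).
      move=> /same_angles_0[/= E _]; apply: (parameter_product Ha1 Ha2 Spi).2.
      rewrite /Omega /= expiX -(mulr_natr (a1 + a2)) -[RHS]invr1 -[in RHS]E -expiN.
      by congr expi; lra.
    exact: (tangent_no_negative HJ Ha1 Ha2 (pos0 k1) (pos0 k2) tq qn).
  + have t0 : t != 0 by rewrite gt_eqF // (lt_le_trans ltr01).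
    rewrite gzE.
    apply: (double_ellipto_parabolic HJ Ha1 Ha2 (pos0 l1) (pos0 l2) tE t0 t1 (esym ct) (@expi_pi_pi R)
      (positive_positive_angles HJ Ha1 Ha2 l1 l2 tE t1' bpi (esym ct))).
    by rewrite /= expiD -expi_pi_pi -expiD; exact: expi_S_pi.
  + rewrite Z_common => nyz; split; apply/seteqP; split=> c0.
    * move=> /(positive_positive_corresponding _ (or_introl erefl)).
      move=> [g [n1 [n2 [s [psi [-> gE [l3 l4] sE [[]-> cs E]]]]]]].
        exact: (class_y n1 n2 s g l3 l4 sE cs gE).
      by case: nyz; apply/tpointP; [exact: Zb_triangle|exact: Zb_triangle|exact: same_angles_sym].
    * have [i1 i2] := in_y (Zb S) (or_introl erefl) (same_angles_refl _).
      by case=> ->.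
    * move=> /(positive_positive_corresponding _ (or_intror erefl)).
      move=> [g [n1 [n2 [s [psi [-> gE [l3 l4] sE [[]-> cs E]]]]]]].
        by case: nyz; apply/tpointP; [exact: Zb_triangle|exact: Zb_triangle|exact: E].
      exact: (class_z n1 n2 s g l3 l4 sE cs gE).
    * by move=> ->; apply: in_z; [right|exact: same_angles_refl].
  + rewrite Z_common => yz; apply/seteqP; split=> c0.
    * move=> /(positive_positive_corresponding _ (or_introl erefl)).
      move=> [g [n1 [n2 [s [psi [-> gE [l3 l4] sE [[]-> cs E]]]]]]].
        by left; exact: (class_y n1 n2 s g l3 l4 sE cs gE).
      by right; exact: (class_z n1 n2 s g l3 l4 sE cs gE).
    * have [i1 i2] := in_y (Zb S) (or_introl erefl) (same_angles_refl _).
      move=> [[]->//|->]; apply: in_z; first by left.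
      by apply: same_angles_sym; exact: tpoint_same_angles.
Qed.

End PositivePositive.

(** * Exchange of the factors, and decomposition by signs *)

Section Swap.
Context {R : realType}.
Variables (J : 'M[CC R]_3) (HJ : signature_ppm J) (alpha1 alpha2 : CC R).
Hypotheses (n1 : `|alpha1| = 1) (n2 : `|alpha2| = 1).
Implicit Types (P : set 'cV[CC R]_3).

(* [R1 R2 = R1 (R2 R1) R1^-1]. *)
Lemma decomposable_swap_sub (b1 b2 : CC R) P1 P2 : `|b1| = 1 -> `|b2| = 1 ->
  P1 `<=` nonisotropic J -> P2 `<=` nonisotropic J ->
  decomposable J b1 b2 P1 P2 `<=` decomposable J b2 b1 P2 P1.
Proof.
move=> m1 m2 P10 P20 c [g [p1 [p2 [h1 h2 gE]]] <-].
have k1 := reflection_SU HJ m1 (P10 _ h1); have k2 := reflection_SU HJ m2 (P20 _ h2).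
exists (SigSub (mem_set (SUM k1 k2))); first by exists p2, p1.
apply/esym; apply: (class_of_conj k1) => /=.
by rewrite gE mulmxA mulmxK //; exact: SU_unit k1.
Qed.

Lemma decomposable_swap P1 P2 : P1 `<=` nonisotropic J -> P2 `<=` nonisotropic J ->
  decomposable J alpha1 alpha2 P1 P2 = decomposable J alpha2 alpha1 P2 P1.
Proof. by move=> h1 h2; apply/seteqP; split; apply: decomposable_swap_sub. Qed.

(** The shape depends on the decompositions only through the set [decomposable], which the exchange
    preserves; this transfers the case of signs +- to -+. *)
Lemma shape_pm_swap P1 P2 (x y : R * R) : P1 `<=` nonisotropic J -> P2 `<=` nonisotropic J ->
  shape_pm J alpha2 alpha1 P2 P1 x y -> shape_pm J alpha1 alpha2 P1 P2 x y.
Proof.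
move=> h1 h2; rewrite /shape_pm /Etri /Eset /corresponds_to /corresponding.
rewrite -(decomposable_swap h1 h2) => -[EE iff reg]; split=> //.
- by split=> [/iff|/esym/iff].
- by move=> nE; apply: reg => E; apply: nE.
Qed.

Lemma negative_nonisotropic : negative J `<=` nonisotropic J.
Proof. by move=> p h; rewrite /nonisotropic /= lt_eqF. Qed.

Lemma positive_nonisotropic : positive J `<=` nonisotropic J.
Proof. by move=> p h; rewrite /nonisotropic /= gt_eqF. Qed.

Lemma Eset_signs (N := negative J) (P := positive J) (E := Eset J alpha1 alpha2) :
  E (nonisotropic J) (nonisotropic J) = E N N `|` E N P `|` E P N `|` E P P.
Proof.
have sgn p : nonisotropic J p -> N p \/ P p.
  move=> p0; have [h|h] := orP (form_le0Vgt0 HJ p); last by right.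
  by left; rewrite /N /negative /= lt_neqAle p0.
rewrite /E /Eset -!image_setU -!setIUr; congr (_ @` (_ `&` _)); apply/seteqP; split=> c.
- move=> [g [p1 [p2 [h1 h2 gE]]] <-].
  have W (P1 P2 : set 'cV[CC R]_3) : P1 p1 -> P2 p2 -> decomposable J alpha1 alpha2 P1 P2 (class_of g).
    by move=> k1 k2; exists g => //; exists p1, p2.
  by case: (sgn _ h1) => k1; case: (sgn _ h2) => k2; [left; left; left|left; left; right|left; right|right];
    apply: W.
- have [nN nP] := (negative_nonisotropic, positive_nonisotropic).
  by move=> [[[]|]|] [g [p1 [p2 [h1 h2 gE]]] <-]; exists g => //; exists p1, p2; split=> //; auto.
Qed.

End Swap.

(** * The explicit segments *)

Section Instances.
Context {R : realType}.
Variables (J : 'M[CC R]_3) (HJ : signature_ppm J) (a1 a2 : R).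
Hypotheses (Ha1 : 0 < a1 < 2 * pi / 3) (Ha2 : 0 < a2 < 2 * pi / 3).
Local Notation S := (3 * (a1 + a2) / 2).
Local Notation delta := (3 * (a1 - a2) / 2).

Let bounds : [/\ 0 < a1, a1 < 2 * pi / 3, 0 < a2, a2 < 2 * pi / 3 & 0 < pi :> R].
Proof. by move: Ha1 Ha2 (pi_gt0 R) => /andP[? ?] /andP[? ?] ?; split. Qed.

Definition affine_path (u v : R * R) (psi : R) : R * R :=
  (u.1 + psi * v.1, u.2 + psi * v.2).

Lemma expi_mod (b d : R) : [\/ b = d, d = b + 2 * pi, b = d + 2 * pi | d = b + 4 * pi] ->
  expi b = expi d :> CC R.
Proof.
have shift (f : R) : expi (f + 2 * pi) = expi f :> CC R.
  by rewrite expiD expi2pi expi0 mulr1.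
case=> [->|->|->|->] //.
have -> : b + 4 * pi = b + 2 * pi + 2 * pi by lra.
by rewrite !shift.
Qed.

Ltac between_lra := repeat match goal with
  | H : is_true (_ <= _ <= _) |- _ => case/andP: H => ? ?
  | H : between _ _ _ |- _ => case: H => /andP[? ?] end; lra.

(** Injectivity of a path: equal angles inside the triangle leave five linear cases. *)
Ltac same_angles_lra T h h' E :=
  case: (same_angles_cases (T _ h) (T _ h') E) =>
    /= [[? ?]|[? ? ?]|[? ? ?]|[][[? ?][? ?]]]; between_lra.

Lemma shape_mm_small : a1 + a2 <= 2 * pi / 3 ->
  shape_mm J (expi a1) (expi a2) (3 * a1 + 3 * a2, 3 * a1 + 3 * a2)
    (2 * pi, pi + 3 * (a1 + a2) / 2).
Proof.
move=> hA; have [l1 u1 l2 u2 pi0] := bounds.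
(* For S <= psi <= pi the angles (2 psi, S + psi) already lie in the triangle. *)
pose Z := affine_path (0, S) (2, 1).
have -> : (3 * a1 + 3 * a2, 3 * a1 + 3 * a2) = Z S by congr (_, _) => /=; lra.
have -> : (2 * pi, pi + S) = Z pi by congr (_, _) => /=; lra.
have T b : between S pi b -> triangle (Z b).
  by rewrite /triangle /= => h; split; between_lra.
apply: (negative_negative_shape HJ Ha1 Ha2 (Z := Z) (fun=> erefl) T).
- by move=> psi; left; split; apply: expi_mod; constructor 1; rewrite /=; lra.
- move=> psi psi' h h' E; same_angles_lra T h h' E.
- move=> Spi; have {}Spi : S < pi by rewrite lt_neqAle Spi /=; lra.
  exists (2 * S); first by apply/andP; split; lra.
  by congr (tpoint (_, _)) => /=; lra.
- move=> Spi; have {}Spi : S < pi by rewrite lt_neqAle Spi /=; lra.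
  exists (S + pi); first by apply/andP; split; lra.
  rewrite tpoint_side; last by apply/andP; split; lra.
  by congr (tpoint (_, _)) => /=; lra.
Qed.

Lemma shape_mm_large : 2 * pi / 3 < a1 + a2 ->
  shape_mm J (expi a1) (expi a2)
    (3 * (a1 + a2) - 2 * pi, 3 * (a1 + a2) - 2 * pi) (3 * (a1 + a2) / 2 - pi, 0).
Proof.
move=> hA; have [l1 u1 l2 u2 pi0] := bounds.
(* For pi <= psi <= S both angles are lowered by 2 pi and exchanged. *)
pose Z := affine_path (S - 2 * pi, - 2 * pi) (1, 2).
have -> : (3 * (a1 + a2) - 2 * pi, 3 * (a1 + a2) - 2 * pi) = Z S by congr (_, _) => /=; lra.
have -> : (S - pi, 0) = Z pi by congr (_, _) => /=; lra.
have T b : between S pi b -> triangle (Z b).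
  by rewrite /triangle /= => h; split; between_lra.
apply: (negative_negative_shape HJ Ha1 Ha2 (Z := Z) (fun=> erefl) T).
- by move=> psi; right; split; apply: expi_mod; constructor 3; rewrite /=; lra.
- move=> psi psi' h h' E; same_angles_lra T h h' E.
- move=> _; exists (2 * S - 2 * pi); first by apply/andP; split; lra.
  by congr (tpoint (_, _)) => /=; lra.
- move=> _; exists (S - pi); first by apply/andP; split; lra.
  by congr (tpoint (_, _)) => /=; lra.
Qed.

Lemma shape_pm_le : a1 <= a2 ->
  shape_pm J (expi a1) (expi a2) (positive J) (negative J)
    (3 * a2, 3 * a2 - 3 * a1) (3 * (a1 + a2) / 2, 0).
Proof.
move=> hA; have [l1 u1 l2 u2 pi0] := bounds.
(* For delta <= psi <= 0 the angles (- 2 psi, S - psi) only have to be exchanged. *)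
pose Z := affine_path (S, 0) (-1, -2).
have -> : (3 * a2, 3 * a2 - 3 * a1) = Z delta by congr (_, _) => /=; lra.
have -> : (S, 0) = Z 0 by congr (_, _) => /=; lra.
have T b : between 0 delta b -> triangle (Z b).
  by rewrite /triangle /= => h; split; between_lra.
apply: (positive_negative_shape HJ Ha1 Ha2 (Z := Z) (fun=> erefl) T).
- by move=> psi; right; split; apply: expi_mod; constructor 1; rewrite /=; lra.
- move=> psi psi' h h' E; same_angles_lra T h h' E.
Qed.

Lemma shape_pm_ge : a2 <= a1 ->
  shape_pm J (expi a1) (expi a2) (positive J) (negative J)
    (2 * pi + 3 * a2 - 3 * a1, 3 * a2) (2 * pi, 3 * (a1 + a2) / 2).
Proof.
move=> hA; have [l1 u1 l2 u2 pi0] := bounds.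
(* For 0 <= psi <= delta the angle - 2 psi is raised by 2 pi. *)
pose Z := affine_path (2 * pi, S) (-2, -1).
have -> : (2 * pi + 3 * a2 - 3 * a1, 3 * a2) = Z delta by congr (_, _) => /=; lra.
have -> : (2 * pi, S) = Z 0 by congr (_, _) => /=; lra.
have T b : between 0 delta b -> triangle (Z b).
  by rewrite /triangle /= => h; split; between_lra.
apply: (positive_negative_shape HJ Ha1 Ha2 (Z := Z) (fun=> erefl) T).
- by move=> psi; left; split; apply: expi_mod; [constructor 2|constructor 1]; rewrite /=; lra.
- move=> psi psi' h h' E; same_angles_lra T h h' E.
Qed.

(** Here d is the absolute value of delta, which treats both orders of a1 and a2 together; the first
    segment starts at psi = d, where tau = 0. *)
Lemma shape_pp_small (d : R) (x : R * R) : a1 + a2 <= 2 * pi / 3 -> 0 <= d ->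
  d = delta \/ d = - delta -> x = (2 * pi - S + d, 2 * pi - S - d) ->
  shape_pp J (expi a1) (expi a2) x (2 * pi, 2 * pi - 3 * (a1 + a2))
    (pi + 3 * (a1 + a2) / 2, 0) 2.
Proof.
move=> hA d0 dE xE; have [l1 u1 l2 u2 pi0] := bounds.
pose Za := affine_path (2 * pi - S, 2 * pi - S) (1, -1).
(* For S <= psi <= pi the angles (- 2 psi, S - psi) are nonpositive; they are raised by 2 pi and
   exchanged. *)
pose Zb := affine_path (2 * pi + S, 2 * pi) (-1, -2).
have -> : x = Za d by rewrite xE; congr (_, _) => /=; lra.
have -> : (2 * pi, 2 * pi - 3 * (a1 + a2)) = Za S by congr (_, _) => /=; lra.
have -> : (pi + S, 0) = Zb pi by congr (_, _) => /=; lra.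
have dS : d < S by case: dE => ->; lra.
have Ta b : d <= b <= S -> triangle (Za b).
  by rewrite /triangle /= => h; split; between_lra.
have Tb b : between S pi b -> triangle (Zb b).
  by rewrite /triangle /= => h; split; between_lra.
apply: (positive_positive_shape HJ Ha1 Ha2 (Za := Za) (Zb := Zb) (fun=> erefl) (fun=> erefl)) => //.
- by case: dE => -> //; rewrite cosN.
- by split=> //; split=> //; lra.
- by move=> psi; left; split; apply: expi_mod; constructor 2; rewrite /=; lra.
- by move=> psi; right; split; apply: expi_mod; constructor 2; rewrite /=; lra.
- by congr (_, _) => /=; lra.
- move=> psi psi' h h' E; same_angles_lra Ta h h' E.
- move=> psi psi' h h' E.
  case: (same_angles_cases (Tb _ h) (Tb _ h') E) => /=.
  + by move=> [? ?]; constructor 1; lra.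
  + by move=> [? ? ?]; constructor 3; lra.
  + by move=> [? ? ?]; constructor 2; lra.
  + by move=> [] [[? ?] [? ?]]; between_lra.
- move=> psi psi' h h' E.
  case: (same_angles_cases (Ta _ h) (Tb _ h') E) => /=.
  + by move=> [? ?]; split; [|left]; lra.
  + by move=> [? ? ?]; split; [|left]; between_lra.
  + by move=> [? ? ?]; split; [|right]; lra.
  + by move=> [] [[? ?] [? ?]]; between_lra.
- by rewrite /slope /=; split; [apply/eqP|]; lra.
- by move=> /eqP Spi; rewrite /slope /=; split; [apply/eqP|]; lra.
Qed.

Lemma shape_pp_large (d : R) (x : R * R) : 2 * pi / 3 < a1 + a2 -> 0 <= d ->
  d = delta \/ d = - delta -> x = (2 * pi - S + d, 2 * pi - S - d) ->
  shape_pp J (expi a1) (expi a2) x (4 * pi - 3 * (a1 + a2), 0)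
    (2 * pi, 3 * (a1 + a2) / 2 - pi) (1 / 2).
Proof.
move=> hA d0 dE xE; have [l1 u1 l2 u2 pi0] := bounds.
pose Za := affine_path (2 * pi - S, 2 * pi - S) (1, -1).
(* For pi <= psi <= S the angle - 2 psi is raised by 4 pi, while S - psi is already nonnegative. *)
pose Zb := affine_path (4 * pi, S) (-2, -1).
have -> : x = Za d by rewrite xE; congr (_, _) => /=; lra.
have -> : (4 * pi - 3 * (a1 + a2), 0) = Za (2 * pi - S) by congr (_, _) => /=; lra.
have -> : (2 * pi, S - pi) = Zb pi by congr (_, _) => /=; lra.
have dS : d < 2 * pi - S by case: dE => ->; lra.
have Ta b : d <= b <= 2 * pi - S -> triangle (Za b).
  by rewrite /triangle /= => h; split; between_lra.
have Tb b : between S pi b -> triangle (Zb b).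
  by rewrite /triangle /= => h; split; between_lra.
apply: (positive_positive_shape HJ Ha1 Ha2 (Za := Za) (Zb := Zb) (fun=> erefl) (fun=> erefl)) => //.
- by case: dE => -> //; rewrite cosN.
- exact: cos2piB.
- by split=> //; split=> //; lra.
- by move=> psi; left; split; apply: expi_mod; constructor 2; rewrite /=; lra.
- by move=> psi; left; split; apply: expi_mod; [constructor 4|constructor 1]; rewrite /=; lra.
- by congr (_, _) => /=; lra.
- move=> psi psi' h h' E; same_angles_lra Ta h h' E.
- move=> psi psi' h h' E.
  case: (same_angles_cases (Tb _ h) (Tb _ h') E) => /=.
  + by move=> [? ?]; constructor 1; lra.
  + by move=> [? ? ?]; constructor 2; lra.
  + by move=> [? ? ?]; constructor 3; lra.
  + by move=> [] [[? ?] [? ?]]; between_lra.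
- move=> psi psi' h h' E.
  case: (same_angles_cases (Ta _ h) (Tb _ h') E) => /=.
  + by move=> [? ?]; split; [|left]; lra.
  + by move=> [? ? ?]; split; [|right]; lra.
  + by move=> [? ? ?]; split; [|left]; lra.
  + by move=> [] [[? ?] [? ?]]; between_lra.
- by rewrite /slope /=; split; [apply/eqP|]; lra.
- by move=> /eqP Spi; rewrite /slope /=; split; [apply/eqP|]; lra.
Qed.

End Instances.

Theorem proposition5p8 (R : realType) (J : 'M[CC R]_3)
    (HJ : signature_ppm J) (a1 a2 : R) (alpha1 alpha2 : CC R)
    (Halpha1 : alpha1 = expi a1) (Halpha2 : alpha2 = expi a2)
    (Ha1 : 0 < a1 < 2 * pi / 3) (Ha2 : 0 < a2 < 2 * pi / 3) :
  let N := negative J in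
  let P := positive J in
  let E := Eset J alpha1 alpha2 in
  [/\ E (nonisotropic J) (nonisotropic J) = E N N `|` E N P `|` E P N `|` E P P,
      (a1 + a2 <= 2 * pi / 3 ->
         shape_mm J alpha1 alpha2
           (3 * a1 + 3 * a2, 3 * a1 + 3 * a2)
           (2 * pi, pi + 3 * (a1 + a2) / 2)) /\
      (2 * pi / 3 < a1 + a2 ->
         shape_mm J alpha1 alpha2
           (3 * (a1 + a2) - 2 * pi, 3 * (a1 + a2) - 2 * pi)
           (3 * (a1 + a2) / 2 - pi, 0)),
      [/\ a1 <= a2 -> a1 + a2 <= 2 * pi / 3 ->
            shape_pp J alpha1 alpha2
              (2 * pi - 3 * a1, 2 * pi - 3 * a2)
              (2 * pi, 2 * pi - 3 * (a1 + a2))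
              (pi + 3 * (a1 + a2) / 2, 0) 2,
          a2 <= a1 -> a1 + a2 <= 2 * pi / 3 ->
            shape_pp J alpha1 alpha2
              (2 * pi - 3 * a2, 2 * pi - 3 * a1)
              (2 * pi, 2 * pi - 3 * (a1 + a2))
              (pi + 3 * (a1 + a2) / 2, 0) 2,
          a1 <= a2 -> 2 * pi / 3 < a1 + a2 ->
            shape_pp J alpha1 alpha2
              (2 * pi - 3 * a1, 2 * pi - 3 * a2)
              (4 * pi - 3 * (a1 + a2), 0)
              (2 * pi, 3 * (a1 + a2) / 2 - pi) (1 / 2)
        & a2 <= a1 -> 2 * pi / 3 < a1 + a2 ->
            shape_pp J alpha1 alpha2
              (2 * pi - 3 * a2, 2 * pi - 3 * a1)
              (4 * pi - 3 * (a1 + a2), 0)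
              (2 * pi, 3 * (a1 + a2) / 2 - pi) (1 / 2)],
      (a1 <= a2 ->
         shape_pm J alpha1 alpha2 P N
           (3 * a2, 3 * a2 - 3 * a1) (3 * (a1 + a2) / 2, 0)) /\
      (a2 <= a1 ->
         shape_pm J alpha1 alpha2 P N
           (2 * pi + 3 * a2 - 3 * a1, 3 * a2) (2 * pi, 3 * (a1 + a2) / 2))
    &      (a1 <= a2 ->
         shape_pm J alpha1 alpha2 N P
           (2 * pi + 3 * a1 - 3 * a2, 3 * a1) (2 * pi, 3 * (a1 + a2) / 2)) /\
      (a2 <= a1 ->
         shape_pm J alpha1 alpha2 N P
           (3 * a1, 3 * a1 - 3 * a2) (3 * (a1 + a2) / 2, 0))].
Proof.
move=> N P E; subst alpha1 alpha2.
have A12 : a2 + a1 = a1 + a2 by rewrite addrC.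
have nN := @negative_nonisotropic R J; have nP := @positive_nonisotropic R J.
have swap x y : shape_pm J (expi a2) (expi a1) P N x y -> shape_pm J (expi a1) (expi a2) N P x y.
  exact: (shape_pm_swap HJ (norm_expi a1) (norm_expi a2) nN nP).
split.
- exact: (Eset_signs HJ).
- by split; [exact: shape_mm_small|exact: shape_mm_large].
- split=> h hA.
  + apply: (shape_pp_small HJ Ha1 Ha2 (d := 3 * (a2 - a1) / 2)) => //; [lra|right; lra|congr (_, _); lra].
  + apply: (shape_pp_small HJ Ha1 Ha2 (d := 3 * (a1 - a2) / 2)) => //; [lra|left; lra|congr (_, _); lra].
  + apply: (shape_pp_large HJ Ha1 Ha2 (d := 3 * (a2 - a1) / 2)) => //; [lra|right; lra|congr (_, _); lra].
  + apply: (shape_pp_large HJ Ha1 Ha2 (d := 3 * (a1 - a2) / 2)) => //; [lra|left; lra|congr (_, _); lra].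
- by split; [exact: shape_pm_le|exact: shape_pm_ge].
(* Signs -+ are signs +- with the parameters exchanged; [A12] writes the sums in the exchanged
   order. *)
- rewrite -A12; split=> h; apply: swap; first exact: shape_pm_ge.
  exact: shape_pm_le.
Qed.
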